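(* Let $\mathcal{T}$ and $\mathcal{T}'$ be 3-manifold triangulations, where $\mathcal{T}'$ can be obtained from $\mathcal{T}$ by performing a 2-3 move followed by a 3-2 move. Then one of the following cases holds: (1) $\mathcal{T}'$ is isomorphic to $\mathcal{T}$; (2) $\mathcal{T}'$ can be obtained from $\mathcal{T}$ by performing a 3-2 move followed by a 2-3 move instead (i.e., using one fewer tetrahedron at the intermediate stage instead of one more); (3) $\mathcal{T}'$ can be obtained from $\mathcal{T}$ by performing either an octahedron flip, a pillow flip, or a prism flip.
   Context: A 3-manifold triangulation of size $n$ is a collection of $n$ abstract tetrahedra whose $4n$ faces are affinely identified in $2n$ pairs so that the resulting space is a connected closed 3-manifold (not necessarily orientable, any number of vertices). Faces of the same tetrahedron may be identified, and distinct edges or vertices of a tetrahedron may become identified. Triangulations are considered up to isomorphism, i.e. relabelling of tetrahedra and reordering of the four vertices of each tetrahedron. A 2-3 move replaces two distinct tetrahedra joined along a common face by three distinct tetrahedra joined around a new common edge (retriangulating the interior of the triangular bipyramid, whose boundary is unchanged); a 3-2 move is the inverse operation, performed around an edge of degree three that meets three distinct tetrahedra. In the following three moves, the listed tetrahedra are distinct, vertex names are names of local corners of the described polyhedron (which may be identified in the triangulation), and outer faces keep their gluings to the rest of the triangulation. Octahedron flip (4-4 move): four distinct tetrahedra surround a common edge of degree four, forming an octahedron of which this edge is one of the three main diagonals (axes); replace them by four tetrahedra surrounding one of the other two axes of the same octahedron. Pillow flip: a quadrilateral pillow consists of two distinct tetrahedra joined along two adjacent faces. Explicitly, tetrahedra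 $X=adbc$ and $Y=adbc$ are glued along both faces $adb$ and $adc$, so that the internal edge $ad$ has degree two; the outer faces are $abc, dbc$ of $Y$ (containing the copy of edge $bc$ in $Y$, denoted $bc$) and the corresponding two faces of $X$ (containing the copy of that edge in $X$, denoted $(bc)'$). The initial configuration is such a pillow plus a third tetrahedron $Z=abcf$ attached to the outer face $abc$ of $Y$. The flip replaces these three tetrahedra, keeping the six outer faces ($dbc$ of $Y$; $a(bc)'$ and $d(bc)'$ of $X$; $abf, acf, bcf$ of $Z$), by: a pillow around a new internal edge $df$ of degree two, formed by two tetrahedra on the corners $d,f,b,c$, glued along faces $dfb$ and $dfc$, one containing $bc$ and the other containing $(bc)'$; together with a third tetrahedron on the corners $a,f,b,c$ containing $(bc)'$, attached to the pillow along the face $f(bc)'$. (This is the reflected configuration, in which $a\leftrightarrow f$ and $bc\leftrightarrow (bc)'$.) Prism flip: take a triangular prism with triangular ends $p_0p_1p_2$ and $q_0q_1q_2$ and vertical edges $p_iq_i$, formed by three distinct tetrahedra $p_0p_1p_2q_2$, $p_0p_1q_1q_2$, $p_0q_0q_1q_2$. Suppose that the rectangular face $p_0p_2q_2q_0$ (with diagonal $p_0q_2$) is glued to the rectangular face $p_1p_2q_2q_1$ (with diagonal $p_1q_2$) either by folding, $p_0\mapsto p_1,\ p_2\mapsto p_2,\ q_2\mapsto q_2,\ q_0\mapsto q_1$ (type A), or by folding composed with a $180^\circ$ twist, $p_0\mapsto q_2,\ p_2\mapsto q_1,\ q_2\mapsto p_1,\ q_0\mapsto p_2$ (type B). The prism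 flip rotates the entire configuration so that the two triangular ends of the prism are interchanged, i.e. it applies $p_0\leftrightarrow q_1$, $p_1\leftrightarrow q_0$, $p_2\leftrightarrow q_2$ to the interior. Equivalently, the three tetrahedra are replaced by $p_2q_0q_1q_2$, $p_0p_2q_0q_1$, $p_0p_1p_2q_1$, with the same gluing of the two rectangles (now with diagonals $p_2q_0$ and $p_2q_1$), and with the outer faces $p_0p_1p_2$, $q_0q_1q_2$, $p_0p_1q_1$, $p_0q_0q_1$ unchanged. *)

(* Defs.v *)
From mathcomp Require Import all_boot all_order all_algebra all_fingroup.
From mathcomp Require Import all_classical all_reals all_analysis.
From Stdlib Require Relation_Operators.
Set Implicit Arguments.
Unset Strict Implicit.
Unset Printing Implicit Defensive.
Import Order.TTheory GRing.Theory Num.Theory.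
Import numFieldNormedType.Exports.

(* Face i of a tetrahedron is the face opposite vertex i.  Face i of t is
   identified with face [gluing t i i] of [neighbour t i] by the affine map
   sending vertex j != i of t to vertex [gluing t i j]; the value at i only
   records which face of the neighbour is used.  The last two fields say that
   the faces are matched in pairs. *)
Record triangulation (n : nat) := Triangulation {
  neighbour : 'I_n -> 'I_4 -> 'I_n ;
  gluing : 'I_n -> 'I_4 -> 'S_4 ;
  gluing_sym : forall t i,
    neighbour (neighbour t i) (gluing t i i) = t /\
    gluing (neighbour t i) (gluing t i i) = ((gluing t i)^-1)%g ;
  gluing_distinct : forall t i, (neighbour t i, gluing t i i) <> (t, i)
}.

(* (t, i, j) stands for vertex j of face i of tetrahedron t. *)
Definition face_corner (n : nat) : Type := ('I_n * 'I_4 * 'I_4)%type.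

Definition glue n (T : triangulation n) (x : face_corner n) : face_corner n :=
  let: (t, i, j) := x in (neighbour T t i, gluing T t i i, gluing T t i j).

Definition relabel n m (h : 'I_n -> 'I_m) (s : 'I_n -> 'S_4)
    (x : face_corner n) : face_corner m :=
  let: (t, i, j) := x in (h t, s t i, s t j).

Definition isomorphic n m (T : triangulation n) (T' : triangulation m) : Prop :=
  exists (h : 'I_n -> 'I_m) (s : 'I_n -> 'S_4),
    bijective h /\
    forall x, glue T' (relabel h s x) = relabel h s (glue T x).

Section Realization.
Variables (R : realType) (n : nat).
Local Open Scope ring_scope.
Local Open Scope classical_set_scope.

Definition std_simplex : set 'rV[R]_4 :=
  [set x | (forall i, 0 <= x ord0 i) /\ \sum_i x ord0 i = 1].

Definition disjoint_tetrahedra : topologicalType :=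
  {t : 'I_n & set_type std_simplex}.

Variable T : triangulation n.

(* Affine maps between faces are permutations of barycentric coordinates. *)
Definition glued_points (x y : disjoint_tetrahedra) : Prop :=
  exists i : 'I_4,
    [/\ \val (tagged x) ord0 i = 0,
        tag y = neighbour T (tag x) i
      & forall j, \val (tagged y) ord0 (gluing T (tag x) i j)
                = \val (tagged x) ord0 j].

Definition same_point (x y : disjoint_tetrahedra) : bool :=
  `[< Relation_Operators.clos_refl_sym_trans _ glued_points x y >].

Lemma same_point_refl : reflexive same_point.
Proof. by move=> x; apply/asboolP; exact: Relation_Operators.rst_refl. Qed.

Lemma same_point_sym : symmetric same_point.
Proof.
by move=> x y; apply/asboolP/asboolP; exact: Relation_Operators.rst_sym.
Qed.

Lemma same_point_trans : transitive same_point.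
Proof.
move=> y x z /asboolP xy /asboolP yz; apply/asboolP.
exact: Relation_Operators.rst_trans xy yz.
Qed.

Canonical same_point_equiv :=
  EquivRel same_point same_point_refl same_point_sym same_point_trans.

Definition realization : topologicalType :=
  quotient_topology {eq_quot same_point_equiv}%qT.

End Realization.

Section Manifold.
Local Open Scope classical_set_scope.

Definition homeomorphic_via (X Y : topologicalType) (U : set X) (V : set Y)
    (f : X -> Y) (g : Y -> X) : Prop :=
  [/\ set_fun U V f, set_fun V U g,
      {in U, cancel f g} /\ {in V, cancel g f},
      {within U, continuous f} & {within V, continuous g}].

Definition locally_euclidean (R : realType) (d : nat) (X : topologicalType) :
    Prop :=
  forall x : X, exists (U : set X) (V : set 'rV[R]_d) f g,
    [/\ open U, U x, open V & homeomorphic_via U V f g].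

Definition connected_closed_manifold (R : realType) (d : nat)
    (X : topologicalType) : Prop :=
  [/\ hausdorff_space X, @second_countable X, locally_euclidean R d X,
      compact [set: X] & connected [set: X]].

End Manifold.

Definition manifold_triangulation (R : realType) n (T : triangulation n) : Prop :=
  connected_closed_manifold R 3 (realization R T).

(* A polyhedron assembled from tetrahedra.  A tetrahedron is the list of the
   names of its four corners; distinct tetrahedra may use the same names, so a
   face is given by the position of its tetrahedron in the list together with
   the names of its three corners, in an order that matters when two faces are
   matched.  [inner] lists the pairs of faces that are glued to each other, and
   [outer] the remaining faces. *)
Definition named_face : Type := (nat * seq nat)%type.

Record polyhedron := Polyhedron {
  tets : seq (seq nat) ;
  inner : seq (named_face * named_face) ;
  outer : seq named_face
}.

Definition opposite (P : polyhedron) (F : named_face) : nat :=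
  head 0 [seq c <- nth [::] (tets P) F.1 | c \notin F.2].

Section Occurrence.
Variables (n : nat) (P : polyhedron).
Variables (e : nat -> 'I_n) (v : nat -> nat -> 'I_4).

(* [e k] is the tetrahedron of the triangulation playing the role of the k-th
   tetrahedron of P, and [v k c] is its vertex named c. *)
Definition corners (F : named_face) : seq (face_corner n) :=
  [seq (e F.1, v F.1 (opposite P F), v F.1 c) | c <- F.2].

Definition occurs (T : triangulation n) : Prop :=
  [/\ {in gtn (size (tets P)) &, injective e},
      forall k, k < size (tets P) ->
        {in nth [::] (tets P) k &, injective (v k)}
    & forall FG, FG \in inner P ->
        map (glue T) (corners FG.1) = corners FG.2].

Definition outside : {set 'I_n} :=
  [set t | t \notin [seq e k | k <- iota 0 (size (tets P))]]%SET.

End Occurrence.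

(* [kept x x'] : the corner x of a face of the old triangulation survives the
   replacement of P by Q, as the corner x' of the new triangulation.  The outer
   faces of P and of Q correspond to each other in the order of the lists. *)
Inductive kept n m (P Q : polyhedron)
    (e : nat -> 'I_n) (v : nat -> nat -> 'I_4)
    (e' : nat -> 'I_m) (v' : nat -> nat -> 'I_4)
    (h : 'I_n -> 'I_m) (s : 'I_n -> 'S_4) :
    face_corner n -> face_corner m -> Prop :=
| KeptOutside t i j of t \in outside P e & j != i :
    kept P Q e v e' v' h s (t, i, j) (relabel h s (t, i, j))
| KeptOuter F G x x' of
    (F, G) \in zip (outer P) (outer Q) &
    (x, x') \in zip (corners P e v F) (corners Q e' v' G) :
    kept P Q e v e' v' h s x x'.

(* T' is obtained from T, up to relabelling, by replacing an occurrence of P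
   with Q, all other face identifications being unchanged. *)
Definition replaces (P Q : polyhedron) n m
    (T : triangulation n) (T' : triangulation m) : Prop :=
  exists (e : nat -> 'I_n) (v : nat -> nat -> 'I_4)
         (e' : nat -> 'I_m) (v' : nat -> nat -> 'I_4)
         (h : 'I_n -> 'I_m) (s : 'I_n -> 'S_4),
    [/\ occurs P e v T, occurs Q e' v' T',
        {in outside P e &, injective h},
        [set h t | t in outside P e]%SET = outside Q e'
      & forall x x', kept P Q e v e' v' h s x x' ->
          kept P Q e v e' v' h s (glue T x) (glue T' x')].

Section Bipyramid.
(* Apexes a and b, equator u v w. *)
Local Notation a := 0.
Local Notation b := 1.
Local Notation u := 2.
Local Notation v := 3.
Local Notation w := 4.

Definition bipyramid2 := Polyhedron
  [:: [:: a; u; v; w]; [:: b; u; v; w]]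
  [:: ((0, [:: u; v; w]), (1, [:: u; v; w]))]
  [:: (0, [:: a; u; v]); (0, [:: a; v; w]); (0, [:: a; w; u]);
      (1, [:: b; u; v]); (1, [:: b; v; w]); (1, [:: b; w; u])].

Definition bipyramid3 := Polyhedron
  [:: [:: a; b; u; v]; [:: a; b; v; w]; [:: a; b; w; u]]
  [:: ((0, [:: a; b; v]), (1, [:: a; b; v]));
      ((1, [:: a; b; w]), (2, [:: a; b; w]));
      ((2, [:: a; b; u]), (0, [:: a; b; u]))]
  [:: (0, [:: a; u; v]); (1, [:: a; v; w]); (2, [:: a; w; u]);
      (0, [:: b; u; v]); (1, [:: b; v; w]); (2, [:: b; w; u])].
End Bipyramid.

Section Octahedron.
(* Main diagonals x x', y y', z z'. *)
Local Notation x := 0.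
Local Notation x' := 1.
Local Notation y := 2.
Local Notation y' := 3.
Local Notation z := 4.
Local Notation z' := 5.

Definition octahedron_x := Polyhedron
  [:: [:: x; x'; y; z]; [:: x; x'; z; y'];
      [:: x; x'; y'; z']; [:: x; x'; z'; y]]
  [:: ((0, [:: x; x'; z]), (1, [:: x; x'; z]));
      ((1, [:: x; x'; y']), (2, [:: x; x'; y']));
      ((2, [:: x; x'; z']), (3, [:: x; x'; z']));
      ((3, [:: x; x'; y]), (0, [:: x; x'; y]))]
  [:: (0, [:: x; y; z]); (1, [:: x; y'; z]);
      (2, [:: x; y'; z']); (3, [:: x; y; z']);
      (0, [:: x'; y; z]); (1, [:: x'; y'; z]);
      (2, [:: x'; y'; z']); (3, [:: x'; y; z'])].

Definition octahedron_y := Polyhedron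
  [:: [:: y; y'; x; z]; [:: y; y'; z; x'];
      [:: y; y'; x'; z']; [:: y; y'; z'; x]]
  [:: ((0, [:: y; y'; z]), (1, [:: y; y'; z]));
      ((1, [:: y; y'; x']), (2, [:: y; y'; x']));
      ((2, [:: y; y'; z']), (3, [:: y; y'; z']));
      ((3, [:: y; y'; x]), (0, [:: y; y'; x]))]
  [:: (0, [:: x; y; z]); (0, [:: x; y'; z]);
      (3, [:: x; y'; z']); (3, [:: x; y; z']);
      (1, [:: x'; y; z]); (1, [:: x'; y'; z]);
      (2, [:: x'; y'; z']); (2, [:: x'; y; z'])].

Definition octahedron_z := Polyhedron
  [:: [:: z; z'; x; y]; [:: z; z'; y; x'];
      [:: z; z'; x'; y']; [:: z; z'; y'; x]]
  [:: ((0, [:: z; z'; y]), (1, [:: z; z'; y]));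
      ((1, [:: z; z'; x']), (2, [:: z; z'; x']));
      ((2, [:: z; z'; y']), (3, [:: z; z'; y']));
      ((3, [:: z; z'; x]), (0, [:: z; z'; x]))]
  [:: (0, [:: x; y; z]); (3, [:: x; y'; z]);
      (3, [:: x; y'; z']); (0, [:: x; y; z']);
      (1, [:: x'; y; z]); (2, [:: x'; y'; z]);
      (2, [:: x'; y'; z']); (1, [:: x'; y; z'])].
End Octahedron.

Section Pillow.
Local Notation a := 0.
Local Notation b := 1.
Local Notation c := 2.
Local Notation d := 3.
Local Notation f := 4.

(* Tetrahedron 0 is X, containing the edge (bc)'; 1 is Y, containing bc; 2 is Z,
   attached along bc. *)
Definition pillow_before := Polyhedron
  [:: [:: a; d; b; c]; [:: a; d; b; c]; [:: a; b; c; f]]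
  [:: ((0, [:: a; d; b]), (1, [:: a; d; b]));
      ((0, [:: a; d; c]), (1, [:: a; d; c]));
      ((1, [:: a; b; c]), (2, [:: a; b; c]))]
  [:: (1, [:: d; b; c]); (0, [:: a; b; c]); (0, [:: d; b; c]);
      (2, [:: a; b; f]); (2, [:: a; c; f]); (2, [:: b; c; f])].

(* Tetrahedra 0 and 1 form the new pillow, with (bc)' in 0 and bc in 1;
   tetrahedron 2 is attached along (bc)'. *)
Definition pillow_after := Polyhedron
  [:: [:: d; f; b; c]; [:: d; f; b; c]; [:: a; f; b; c]]
  [:: ((0, [:: d; f; b]), (1, [:: d; f; b]));
      ((0, [:: d; f; c]), (1, [:: d; f; c]));
      ((0, [:: f; b; c]), (2, [:: f; b; c]))]
  [:: (1, [:: d; b; c]); (2, [:: a; b; c]); (0, [:: d; b; c]);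
      (2, [:: a; b; f]); (2, [:: a; c; f]); (1, [:: b; c; f])].
End Pillow.

Section Prism.
Local Notation p0 := 0.
Local Notation p1 := 1.
Local Notation p2 := 2.
Local Notation q0 := 3.
Local Notation q1 := 4.
Local Notation q2 := 5.

(* In each list of inner faces, the last two pairs glue the rectangle
   p0 p2 q2 q0 to the rectangle p1 p2 q2 q1. *)
Definition prismA_before := Polyhedron
  [:: [:: p0; p1; p2; q2]; [:: p0; p1; q1; q2]; [:: p0; q0; q1; q2]]
  [:: ((0, [:: p0; p1; q2]), (1, [:: p0; p1; q2]));
      ((1, [:: p0; q1; q2]), (2, [:: p0; q1; q2]));
      ((0, [:: p0; p2; q2]), (0, [:: p1; p2; q2]));
      ((2, [:: p0; q0; q2]), (1, [:: p1; q1; q2]))]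
  [:: (0, [:: p0; p1; p2]); (2, [:: q0; q1; q2]);
      (1, [:: p0; p1; q1]); (2, [:: p0; q0; q1])].

Definition prismA_after := Polyhedron
  [:: [:: p2; q0; q1; q2]; [:: p0; p2; q0; q1]; [:: p0; p1; p2; q1]]
  [:: ((0, [:: p2; q0; q1]), (1, [:: p2; q0; q1]));
      ((1, [:: p0; p2; q1]), (2, [:: p0; p2; q1]));
      ((0, [:: p2; q0; q2]), (0, [:: p2; q1; q2]));
      ((1, [:: p0; p2; q0]), (2, [:: p1; p2; q1]))]
  [:: (2, [:: p0; p1; p2]); (0, [:: q0; q1; q2]);
      (2, [:: p0; p1; q1]); (1, [:: p0; q0; q1])].

Definition prismB_before := Polyhedron
  [:: [:: p0; p1; p2; q2]; [:: p0; p1; q1; q2]; [:: p0; q0; q1; q2]]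
  [:: ((0, [:: p0; p1; q2]), (1, [:: p0; p1; q2]));
      ((1, [:: p0; q1; q2]), (2, [:: p0; q1; q2]));
      ((0, [:: p0; p2; q2]), (1, [:: q2; q1; p1]));
      ((2, [:: p0; q0; q2]), (0, [:: q2; p2; p1]))]
  [:: (0, [:: p0; p1; p2]); (2, [:: q0; q1; q2]);
      (1, [:: p0; p1; q1]); (2, [:: p0; q0; q1])].

Definition prismB_after := Polyhedron
  [:: [:: p2; q0; q1; q2]; [:: p0; p2; q0; q1]; [:: p0; p1; p2; q1]]
  [:: ((0, [:: p2; q0; q1]), (1, [:: p2; q0; q1]));
      ((1, [:: p0; p2; q1]), (2, [:: p0; p2; q1]));
      ((0, [:: p2; q0; q2]), (2, [:: q1; p2; p1]));
      ((1, [:: p0; p2; q0]), (0, [:: q2; q1; p2]))]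
  [:: (2, [:: p0; p1; p2]); (0, [:: q0; q1; q2]);
      (2, [:: p0; p1; q1]); (1, [:: p0; q0; q1])].
End Prism.

(* Sanity check: every face of every tetrahedron is listed exactly once. *)
Definition well_formed (P : polyhedron) : bool :=
  let faces := flatten [seq [:: FG.1; FG.2] | FG <- inner P] ++ outer P in
  [&& all (fun w => uniq w && (size w == 4)) (tets P),
      all (fun F => [&& uniq F.2, size F.2 == 3
                      & all (mem (nth [::] (tets P) F.1)) F.2]) faces
    & perm_eq [seq (F.1, opposite P F) | F <- faces]
              [seq (k, c) | k <- iota 0 (size (tets P)),
                            c <- nth [::] (tets P) k]].

Lemma polyhedra_well_formed :
  all well_formed [:: bipyramid2; bipyramid3;
    octahedron_x; octahedron_y; octahedron_z; pillow_before; pillow_after;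
    prismA_before; prismA_after; prismB_before; prismB_after].
Proof. by []. Qed.

Section Moves.
Variables (n m : nat) (T : triangulation n) (T' : triangulation m).

Definition move23 : Prop := replaces bipyramid2 bipyramid3 T T'.

Definition move32 : Prop := replaces bipyramid3 bipyramid2 T T'.

Definition octahedron_flip : Prop :=
  replaces octahedron_x octahedron_y T T' \/
  replaces octahedron_x octahedron_z T T'.

Definition pillow_flip : Prop := replaces pillow_before pillow_after T T'.

Definition prism_flip : Prop :=
  replaces prismA_before prismA_after T T' \/
  replaces prismB_before prismB_after T T'.
End Moves.

(* Main.v *)
(** Both moves take place at an edge of degree three of the intermediate
triangulation.  If the two bipyramids share no tetrahedron, the moves commute.
Otherwise the gluings around the two edges determine how the bipyramids overlap
up to finitely many configurations, and in each of them one compares the two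
ways of filling the union with two tetrahedra in place of one bipyramid.  All of
them give an isomorphism or one of the flips, except for some in which a
tetrahedron of the initial or final triangulation has two faces glued to each
other so as to form a Moebius band in the link of a vertex.

Such a corner cannot occur in a manifold.  A chart turns a neighbourhood of the
vertex, minus the vertex, into a punctured ball, over a spherical shell of which
the orientation double cover is trivial; but the core of the Moebius band lifts
to a path joining the two sheets.  *)

Require Import Defs.
From mathcomp Require Import all_boot all_reals.
From mathcomp Require Import all_fingroup boolp.
Require Import Defs.
Set Implicit Arguments.
Unset Strict Implicit.
Unset Printing Implicit Defensive.

(** * Local modifications of triangulations *)

(** The bookkeeping unit is a corner of a face. A move then becomes a partial matching [persists]
    between corners before and after, compatible with [glue], together with two finite gluing
    tables. Such data compose: two successive moves form one local modification, whose tables are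
    computed from the way the second bipyramid meets the first. Every overlap is thus settled by
    comparing finite lists, and one kernel computation can run over all of them.

    The topological half works without fundamental groups. A section of the orientation double cover
    is a Boolean function on the points of the disjoint tetrahedra, with a prescribed change across
    each gluing. Simple connectedness of the shell enters as gluing of sections over convex pieces
    with connected overlaps. The delicate input is a local section at points of edges: an edge may
    have any degree and, a priori, be glued to itself reversed. Points with one coordinate above 1/2
    stay away from the midpoint, where a reversal would have a fixed point. *)

Lemma glueK n (T : triangulation n) : involutive (glue T).
Proof.
case=> [[t i] j]; rewrite /glue; have [-> ->] := gluing_sym T t i.
by rewrite !permK.
Qed.

(* (k, i, j) is vertex j of face i of the k-th tetrahedron of a piece of a
   triangulation, the vertices of a tetrahedron being numbered 0, 1, 2, 3. *)
Definition corner : Type := nat * nat * nat.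

(** The vertex differs from the face number because [gluing t i i] names a face; only the values at
    [j != i] identify vertices. *)
Definition valid (S : seq nat) (x : corner) : bool :=
  [&& x.1.1 \in S, x.1.2 < 4, x.2 < 4 & x.2 != x.1.2].

Definition chart (n : nat) : Type := (nat -> 'I_n) * (nat -> nat -> 'I_4).

Definition loc n (c : chart n) (x : corner) : face_corner n :=
  (c.1 x.1.1, c.2 x.1.1 x.1.2, c.2 x.1.1 x.2).

(* A local modification: the tetrahedra [src], with the corner identifications
   [src_glue] among them, are replaced by [tgt] with [tgt_glue]; [shared] pairs
   the remaining corners before and after. *)
Record template := Template {
  src : seq nat; src_glue : seq (corner * corner);
  tgt : seq nat; tgt_glue : seq (corner * corner);
  shared : seq (corner * corner) }.

(** The last two [uniq] conditions make [persists] a partial bijection. That the tables exhaust all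
    corners is demanded in [performable], where a new triangulation has to be built. *)
Definition wf (L : template) : bool :=
  [&& uniq (src L), uniq (tgt L),
      all (fun p => valid (src L) p.1 && valid (src L) p.2) (src_glue L),
      all (fun p => valid (tgt L) p.1 && valid (tgt L) p.2) (tgt_glue L),
      all (fun p => valid (src L) p.1 && valid (tgt L) p.2) (shared L),
      uniq [seq p.1 | p <- shared L] & uniq [seq p.2 | p <- shared L]].

Lemma uniq_map_inj (A B : eqType) (f : A -> B) (s : seq A) :
  uniq (map f s) -> {in s &, injective f}.
Proof.
elim: s => // a s IH /= /andP[fa /IH inj] x y; rewrite !inE.
move=> /predU1P[->|xs] /predU1P[->|ys] // fxy; last exact: inj.
- by move: fa; rewrite fxy map_f.
- by move: fa; rewrite -fxy map_f.
Qed.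

Section Wf.
Variable L : template.
Hypothesis wfL : wf L.

Lemma wf_src_glue p : p \in src_glue L -> valid (src L) p.1 /\ valid (src L) p.2.
Proof. by case/and5P: wfL => _ _ /allP h _ _ /h /andP. Qed.

Lemma wf_tgt_glue p : p \in tgt_glue L -> valid (tgt L) p.1 /\ valid (tgt L) p.2.
Proof. by case/and5P: wfL => _ _ _ /allP h _ /h /andP. Qed.

Lemma wf_shared p : p \in shared L -> valid (src L) p.1 /\ valid (tgt L) p.2.
Proof. by case/and5P: wfL => _ _ _ _ /and3P[/allP h _ _] /h /andP. Qed.

Lemma wf_shared_inj1 p q : p \in shared L -> q \in shared L -> p.1 = q.1 -> p = q.
Proof. by case/and5P: wfL => _ _ _ _ /and3P[_ /uniq_map_inj h _]; exact: h. Qed.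

Lemma wf_shared_inj2 p q : p \in shared L -> q \in shared L -> p.2 = q.2 -> p = q.
Proof. by case/and5P: wfL => _ _ _ _ /and3P[_ _ /uniq_map_inj h]; exact: h. Qed.

End Wf.

Definition region n (S : seq nat) (c : chart n) : seq 'I_n := [seq c.1 k | k <- S].

Definition charts n (S : seq nat) (c : chart n) : Prop :=
  {in S &, injective c.1} /\
  forall k, k \in S -> {in gtn 4 &, injective (c.2 k)}.

Definition realizes n (G : seq (corner * corner)) (c : chart n)
    (T : triangulation n) : Prop :=
  forall p, p \in G -> glue T (loc c p.1) = loc c p.2.

Lemma loc_inj n S (c : chart n) x y : charts S c -> valid S x -> valid S y ->
  loc c x = loc c y -> x = y.
Proof.
case: x y => [[k i] j] [[k' i'] j'] [ic iv] /and4P[/= kS i4 j4 _] /and4P[/= kS' i4' j4' _].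
by case=> /ic -> // /iv -> // /iv ->.
Qed.

Lemma loc_region n S (c : chart n) x : valid S x -> (loc c x).1.1 \in region S c.
Proof. by case/and4P => xS _ _ _; exact: map_f. Qed.

Section Step.
Variables (L : template) (n m : nat).
Variables (c : chart n) (c' : chart m).
Variables (h : 'I_n -> 'I_m) (h' : 'I_m -> 'I_n) (s : 'I_n -> 'S_4).

Inductive persists : face_corner n -> face_corner m -> Prop :=
| PersistsOutside t i j of t \notin region (src L) c & j != i :
    persists (t, i, j) (h t, s t i, s t j)
| PersistsShared p of p \in shared L : persists (loc c p.1) (loc c' p.2).

(** The inverse [h'] is carried along explicitly, so that reversing a step only swaps it with
    [h]. *)
Record placed : Prop := Placed {
  placed_src : charts (src L) c;
  placed_tgt : charts (tgt L) c';
  placed_out : forall t, t \notin region (src L) c ->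
    h t \notin region (tgt L) c' /\ h' (h t) = t;
  placed_out' : forall t, t \notin region (tgt L) c' ->
    h' t \notin region (src L) c /\ h (h' t) = t
}.

Record step (T : triangulation n) (T' : triangulation m) : Prop := Step {
  step_placed : placed;
  step_src_glue : realizes (src_glue L) c T;
  step_tgt_glue : realizes (tgt_glue L) c' T';
  step_persists : forall x x', persists x x' -> persists (glue T x) (glue T' x')
}.

Definition step_src T T' (st : step T T') := placed_src (step_placed st).
Definition step_tgt T T' (st : step T T') := placed_tgt (step_placed st).
Definition step_out T T' (st : step T T') := placed_out (step_placed st).
Definition step_out' T T' (st : step T T') := placed_out' (step_placed st).

Hypothesis wfL : wf L.
Hypothesis pl : placed.

(** With [persists_fun], this allows an equation for [glue] to be carried between the two
    triangulations. The two constructors cannot clash: shared corners lie in the regions, the others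
    outside them. *)
Lemma persists_inj x y z : persists x z -> persists y z -> x = y.
Proof.
case=> [t i j nt ji|p pL].
  set z0 := (h t, s t i, s t j) => xz; have zE : z0 = (h t, s t i, s t j) by [].
  case: xz zE => [t' i' j' nt' _ [e1 e2 e3]|p pL pE].
    have e : t' = t.
      by rewrite -(placed_out pl nt').2 -(placed_out pl nt).2 e1.
    by rewrite e in e2 e3 *; rewrite (perm_inj e2) (perm_inj e3).
  have := (placed_out pl nt).1; rewrite -[h t]/(h t, s t i, s t j).1.1 -pE.
  by rewrite loc_region //; have [] := wf_shared wfL pL.
move zE: (loc c' p.2) => z0 yz; case: yz zE => [t i j nt _ pE|q qL pq].
  have := (placed_out pl nt).1; rewrite -[h t]/(h t, s t i, s t j).1.1 -pE.
  by rewrite loc_region //; have [] := wf_shared wfL pL.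
have /(loc_inj (placed_tgt pl)) : loc c' p.2 = loc c' q.2 by [].
have [_ vp] := wf_shared wfL pL; have [_ vq] := wf_shared wfL qL.
by move=> /(_ vp vq) /(wf_shared_inj2 wfL pL qL) ->.
Qed.

Lemma persists_fun x y z : persists x y -> persists x z -> y = z.
Proof.
case=> [t i j nt ji|p pL].
  move xE: (t, i, j) => x0 xz; case: xz xE => [t' i' j' _ _ [-> -> ->] //|p pL pE].
  move: nt; rewrite -[t]/(t, i, j).1.1 pE.
  by rewrite loc_region //; have [] := wf_shared wfL pL.
move xE: (loc c p.1) => x0 xz; case: xz xE => [t i j nt _ pE|q qL pq].
  move: nt; rewrite -[t]/(t, i, j).1.1 -pE.
  by rewrite loc_region //; have [] := wf_shared wfL pL.
have /(loc_inj (placed_src pl)) : loc c p.1 = loc c q.1 by [].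
have [vp _] := wf_shared wfL pL; have [vq _] := wf_shared wfL qL.
by move=> /(_ vp vq) /(wf_shared_inj1 wfL pL qL) ->.
Qed.

End Step.

Definition reverse (L : template) : template :=
  Template (tgt L) (tgt_glue L) (src L) (src_glue L) [seq (p.2, p.1) | p <- shared L].

Lemma persists_reverse L n m c c' h h' s (T : triangulation n) (T' : triangulation m) x x' :
  step L c c' h h' s T T' -> persists L c c' h s x x' <->
  persists (reverse L) c' c h' (fun t => (s (h' t))^-1)%g x' x.
Proof.
move=> st; split.
  case=> [t i j nt ji|p pL].
    have [nt' tE] := step_out st nt.
    have := @PersistsOutside (reverse L) _ _ c' c h' (fun t => (s (h' t))^-1)%g
      (h t) (s t i) (s t j) nt'.
    by rewrite (inj_eq perm_inj) tE !permK; apply.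
  have := @PersistsShared (reverse L) _ _ c' c h' (fun t => (s (h' t))^-1)%g (p.2, p.1).
  by apply; apply/mapP; exists p.
case=> [t i j nt ji|p /mapP[q qL ->]]; last exact: PersistsShared.
have [nt' tE] := step_out' st nt.
have := @PersistsOutside L _ _ c c' h s (h' t) ((s (h' t))^-1 i)%g ((s (h' t))^-1 j)%g nt'.
by rewrite (inj_eq perm_inj) tE !permKV; apply.
Qed.

Lemma step_reverse L n m c c' h h' s (T : triangulation n) (T' : triangulation m) :
  step L c c' h h' s T T' ->
  step (reverse L) c' c h' h (fun t => (s (h' t))^-1)%g T' T.
Proof.
move=> st; case: (st) => -[*] *; split=> // x' x /(persists_reverse _ _ st) xx'.
by apply/(persists_reverse _ _ st); exact: (step_persists st).
Qed.

Definition configuration : Type := seq (option (nat * seq nat)).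

Definition at_ (C : configuration) (k : nat) : option (nat * seq nat) := nth None C k.

Definition transport (C : configuration) (x : corner) : option corner :=
  if at_ C x.1.1 is Some (a, p) then Some (a, nth 0 p x.1.2, nth 0 p x.2) else None.

(* Composition of two modifications L1 : T -> T1 and L2 : T1 -> T'.  The entry k
   of C describes the tetrahedron k of [src L2]: either it is the tetrahedron a
   of [tgt L1], with vertices matched by a permutation, or it is not in the
   image of L1.  In the composite, tetrahedra of the outer ends of L1 and L2 get
   even numbers, and those touched by only one of the moves odd numbers. *)
Section Compose.
Variables (C : configuration) (L1 L2 : template).

Definition even_corner (x : corner) : corner := (x.1.1.*2, x.1.2, x.2).

Definition odd_corner (x : corner) : corner := (x.1.1.*2.+1, x.1.2, x.2).

Definition covered (a : nat) : bool :=
  has (fun k => if at_ C k is Some p then p.1 == a else false) (src L2).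

(** The answer is a list because a corner on an inner face of [tgt L1] has no counterpart before the
    first move: it gives the empty list, and gluings through it drop out of the product in
    [compose]. *)
Definition to_src (y : corner) : seq corner :=
  if transport C y is Some z
  then [seq even_corner o.1 | o <- shared L1 & o.2 == z] else [:: odd_corner y].

Definition to_tgt (y : corner) : seq corner :=
  if covered y.1.1
  then [seq even_corner o.2 | o <- shared L2 & transport C o.1 == Some y]
  else [:: odd_corner y].

Definition compose : template := Template
  ([seq k.*2 | k <- src L1] ++ [seq k.*2.+1 | k <- src L2 & at_ C k == None])
  ([seq (even_corner p.1, even_corner p.2) | p <- src_glue L1] ++
   flatten [seq [seq (x, y) | x <- to_src p.1, y <- to_src p.2] | p <- src_glue L2])
  ([seq k.*2 | k <- tgt L2] ++ [seq a.*2.+1 | a <- tgt L1 & ~~ covered a])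
  ([seq (even_corner p.1, even_corner p.2) | p <- tgt_glue L2] ++
   flatten [seq [seq (x, y) | x <- to_tgt p.1, y <- to_tgt p.2] | p <- tgt_glue L1])
  (flatten [seq [seq (even_corner o.1, even_corner q.2) | q <- shared L2 &
                  transport C q.1 == Some o.2] | o <- shared L1] ++
   [seq (odd_corner q.1, even_corner q.2) | q <- shared L2 & transport C q.1 == None] ++
   [seq (even_corner o.1, odd_corner o.2) | o <- shared L1 & ~~ covered o.2.1.1]).

Definition compatible n (c1 c2 : chart n) : Prop := forall k, k \in src L2 ->
  if at_ C k is Some (a, p) then
    [/\ a \in tgt L1, c2.1 k = c1.1 a
      & forall j, j < 4 -> nth 0 p j < 4 /\ c2.2 k j = c1.2 a (nth 0 p j)]
  else c2.1 k \notin region (tgt L1) c1.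

Variables (n n1 n' : nat).
Variables (T : triangulation n) (T1 : triangulation n1) (T' : triangulation n').
Variables (c : chart n) (c1 c2 : chart n1) (c' : chart n').
Variables (h1 : 'I_n -> 'I_n1) (h1' : 'I_n1 -> 'I_n) (s1 : 'I_n -> 'S_4).
Variables (h2 : 'I_n1 -> 'I_n') (h2' : 'I_n' -> 'I_n1) (s2 : 'I_n1 -> 'S_4).
Hypothesis wf1 : wf L1.
Hypothesis wf2 : wf L2.
Hypothesis st1 : step L1 c c1 h1 h1' s1 T T1.
Hypothesis st2 : step L2 c2 c' h2 h2' s2 T1 T'.
Hypothesis cpt : compatible c1 c2.

Definition src_chart : chart n :=
  (fun k => if odd k then h1' (c2.1 k./2) else c.1 k./2,
   fun k j => if odd k then ((s1 (h1' (c2.1 k./2)))^-1)%g (c2.2 k./2 j) else c.2 k./2 j).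

Definition tgt_chart : chart n' :=
  (fun k => if odd k then h2 (c1.1 k./2) else c'.1 k./2,
   fun k j => if odd k then s2 (c1.1 k./2) (c1.2 k./2 j) else c'.2 k./2 j).

Lemma src_even x : loc src_chart (even_corner x) = loc c x.
Proof. by rewrite /loc /= odd_double doubleK. Qed.

Lemma tgt_even x : loc tgt_chart (even_corner x) = loc c' x.
Proof. by rewrite /loc /= odd_double doubleK. Qed.

Lemma src_odd x : loc src_chart (odd_corner x) =
  (h1' (c2.1 x.1.1), ((s1 (h1' (c2.1 x.1.1)))^-1)%g (c2.2 x.1.1 x.1.2),
    ((s1 (h1' (c2.1 x.1.1)))^-1)%g (c2.2 x.1.1 x.2)).
Proof. by rewrite /loc /= odd_double /= uphalf_double. Qed.

Lemma tgt_odd x : loc tgt_chart (odd_corner x) =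
  (h2 (c1.1 x.1.1), s2 (c1.1 x.1.1) (c1.2 x.1.1 x.1.2),
    s2 (c1.1 x.1.1) (c1.2 x.1.1 x.2)).
Proof. by rewrite /loc /= odd_double /= uphalf_double. Qed.

Lemma transport_loc x z : valid (src L2) x -> transport C x = Some z ->
  loc c2 x = loc c1 z /\ z.1.1 \in tgt L1.
Proof.
rewrite /transport => /and4P[xS i4 j4 _]; have := cpt xS.
case: (at_ C x.1.1) => [[a p]|//] [aS e1 e2] [<-]; split=> //.
by rewrite /loc /= e1 (e2 _ i4).2 (e2 _ j4).2.
Qed.

Lemma transport_None x : valid (src L2) x -> transport C x = None ->
  c2.1 x.1.1 \notin region (tgt L1) c1.
Proof.
rewrite /transport => /and4P[xS _ _ _]; have := cpt xS.
by case: (at_ C x.1.1) => [[]|].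
Qed.

Lemma coveredP a : a \in tgt L1 ->
  reflect (c1.1 a \in region (src L2) c2) (covered a).
Proof.
move=> aT; apply: (iffP hasP) => [[k kS]|/mapP[k kS e]].
  have := cpt kS; case: (at_ C k) => [[b p]|//] [_ e _] /= /eqP <-.
  by rewrite -e; exact: map_f.
exists k => //; have := cpt kS; case: (at_ C k) => [[b p] [bT e' _]|].
  by apply/eqP; apply: (step_tgt st1).1 => //; rewrite -e' -e.
by rewrite -e => /negP []; exact: map_f.
Qed.

Lemma corner_neq S n0 (e : chart n0) x : charts S e -> valid S x ->
  e.2 x.1.1 x.2 != e.2 x.1.1 x.1.2.
Proof.
case=> _ iv /and4P[xS i4 j4 ji]; apply: contra ji => /eqP /iv -> //.
Qed.

Lemma transport_valid x z : valid (src L2) x -> transport C x = Some z ->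
  valid (tgt L1) z.
Proof.
rewrite /transport => vx; case/and4P: (vx) => xS i4 j4 ji; have := cpt xS.
have := @corner_neq _ _ _ _ (step_src st2) vx.
case: (at_ C _) => [[a p]|//] ne [aT e1 e2] [<-]; apply/and4P; split=> //=.
- exact: (e2 _ i4).1.
- exact: (e2 _ j4).1.
- by apply: contra ne => /eqP eij; rewrite (e2 _ i4).2 (e2 _ j4).2 eij.
Qed.

Lemma to_src_persists y x : valid (src L2) y -> x \in to_src y ->
  persists L1 c c1 h1 s1 (loc src_chart x) (loc c2 y).
Proof.
move=> vy; rewrite /to_src; case E: (transport C y) => [z|].
  case/mapP => o; rewrite mem_filter => /andP[/eqP oz oL] ->.
  rewrite (transport_loc vy E).1 src_even -oz; exact: PersistsShared.
rewrite inE => /eqP ->; rewrite src_odd.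
have [nt tE] := step_out' st1 (transport_None vy E).
have := @PersistsOutside L1 _ _ c c1 h1 s1 _
  (((s1 (h1' (c2.1 y.1.1)))^-1)%g (c2.2 y.1.1 y.1.2))
  (((s1 (h1' (c2.1 y.1.1)))^-1)%g (c2.2 y.1.1 y.2)) nt.
by rewrite (inj_eq perm_inj) !permKV tE; apply; exact: corner_neq (step_src st2) vy.
Qed.

Lemma to_tgt_persists y x : valid (tgt L1) y -> x \in to_tgt y ->
  persists L2 c2 c' h2 s2 (loc c1 y) (loc tgt_chart x).
Proof.
move=> vy; have yT : y.1.1 \in tgt L1 by case/and4P: vy.
rewrite /to_tgt; case: (coveredP yT) => cy.
  case/mapP => o; rewrite mem_filter => /andP[/eqP oz oL] ->.
  have [vo _] := wf_shared wf2 oL.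
  by rewrite -(transport_loc vo oz).1 tgt_even; exact: PersistsShared.
rewrite inE => /eqP ->; rewrite tgt_odd; move/negP: cy => cy.
have := @PersistsOutside L2 _ _ c2 c' h2 s2 _ (c1.2 y.1.1 y.1.2) (c1.2 y.1.1 y.2) cy.
by apply; exact: corner_neq (step_tgt st1) vy.
Qed.

Local Notation H := (fun t => h2 (h1 t)).
Local Notation H' := (fun t => h1' (h2' t)).
Local Notation S := (fun t => s1 t * s2 (h1 t))%g.

Lemma region_src t : t \notin region (src compose) src_chart ->
  t \notin region (src L1) c /\ h1 t \notin region (src L2) c2.
Proof.
rewrite /region /= map_cat mem_cat negb_or => /andP[n1_ n2_].
have nt : t \notin region (src L1) c.
  apply: contra n1_ => /mapP[k kS ->]; apply/mapP; exists k.*2; first exact: map_f.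
  by rewrite /= odd_double doubleK.
split=> //; apply: contra n2_ => /mapP[k kS e]; apply/mapP; exists k.*2.+1.
  apply/map_f; rewrite mem_filter kS andbT; have := cpt kS.
  case: (at_ C k) => [[a p] [aT e' _]|//].
  by have := (step_out st1 nt).1; rewrite e e' => /negP []; exact: map_f.
by rewrite /= odd_double /= uphalf_double -e (step_out st1 nt).2.
Qed.

Lemma region_tgt t : t \notin region (tgt compose) tgt_chart ->
  t \notin region (tgt L2) c' /\ h2' t \notin region (tgt L1) c1.
Proof.
rewrite /region /= map_cat mem_cat negb_or => /andP[n1_ n2_].
have nt : t \notin region (tgt L2) c'.
  apply: contra n1_ => /mapP[k kS ->]; apply/mapP; exists k.*2; first exact: map_f.
  by rewrite /= odd_double doubleK.
split=> //; apply: contra n2_ => /mapP[k kS e]; apply/mapP; exists k.*2.+1.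
  apply/map_f; rewrite mem_filter kS andbT; apply/(coveredP kS).
  by rewrite -e; apply/negP; exact: (step_out' st2 nt).1.
by rewrite /= odd_double /= uphalf_double -e (step_out' st2 nt).2.
Qed.

Lemma region_srcN t : t \notin region (src L1) c -> h1 t \notin region (src L2) c2 ->
  t \notin region (src compose) src_chart.
Proof.
move=> nt nt'; rewrite /region /= map_cat mem_cat negb_or; apply/andP; split.
  apply: contra nt => /mapP[_ /mapP[k kS ->] ->].
  by rewrite /= odd_double doubleK; exact: map_f.
apply: contra nt' => /mapP[_ /mapP[k + ->] ->]; rewrite mem_filter => /andP[/eqP kN kS].
rewrite /= odd_double /= uphalf_double; have := cpt kS; rewrite kN => /(step_out' st1).
by case=> _ ->; exact: map_f.
Qed.

Lemma region_tgtN t : t \notin region (tgt L2) c' -> h2' t \notin region (tgt L1) c1 ->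
  t \notin region (tgt compose) tgt_chart.
Proof.
move=> nt nt'; rewrite /region /= map_cat mem_cat negb_or; apply/andP; split.
  apply: contra nt => /mapP[_ /mapP[k kS ->] ->].
  by rewrite /= odd_double doubleK; exact: map_f.
apply: contra nt' => /mapP[_ /mapP[k + ->] ->]; rewrite mem_filter => /andP[kN kS].
rewrite /= odd_double /= uphalf_double.
move/(coveredP kS)/negP: kN => /(step_out st2) [_ ->]; exact: map_f.
Qed.

(** The middle corner lies inside or outside each of the two regions; the four combinations give the
    three lists in [shared compose] and the tetrahedra untouched by both moves. *)
Lemma persists_composeP x x' : persists compose src_chart tgt_chart H S x x' <->
  exists2 y, persists L1 c c1 h1 s1 x y & persists L2 c2 c' h2 s2 y x'.
Proof.
split.
  case=> [t i j /region_src [nt nt'] ji|p].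
    exists (h1 t, s1 t i, s1 t j); first exact: PersistsOutside.
    rewrite !permM; apply: PersistsOutside => //.
    by rewrite (inj_eq perm_inj).
  rewrite /= !mem_cat => /or3P[/flattenP[_ /mapP[o oL ->] /mapP[q + ->]]||].
  - rewrite mem_filter => /andP[/eqP E qL]; rewrite src_even tgt_even.
    have [vq _] := wf_shared wf2 qL.
    exists (loc c1 o.2); first exact: PersistsShared.
    by rewrite -(transport_loc vq E).1; exact: PersistsShared.
  - case/mapP => q; rewrite mem_filter => /andP[/eqP E qL] ->.
    have [vq _] := wf_shared wf2 qL.
    exists (loc c2 q.1); last by rewrite tgt_even; exact: PersistsShared.
    by apply: to_src_persists => //; rewrite /to_src E inE.
  - case/mapP => o; rewrite mem_filter => /andP[E oL] ->.
    have [_ vo] := wf_shared wf1 oL.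
    exists (loc c1 o.2); first by rewrite src_even; exact: PersistsShared.
    by apply: to_tgt_persists => //; rewrite /to_tgt (negbTE E) inE.
case=> y xy yx'; case: xy yx' => [t i j nt ji|o oL].
  move yE: (h1 t, s1 t i, s1 t j) => y0 yx'; case: yx' yE => [t' i' j' nt' _|q qL].
    move=> [e1 e2 e3]; subst t' i' j'; rewrite -!permM.
    by apply: PersistsOutside => //; exact: region_srcN.
  have [vq _] := wf_shared wf2 qL.
  move=> qE; have [e1 e2 e3] := qE.
  have E : transport C q.1 = None.
    case E: (transport C q.1) => [z|//].
    have [ez zT] := transport_loc vq E.
    have := (step_out st1 nt).1; rewrite e1 -[c2.1 _]/(loc c2 q.1).1.1 ez.
    by move/negP; case; exact: map_f.
  have -> : (t, i, j) = loc src_chart (odd_corner q.1).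
    by rewrite src_odd -e1 -e2 -e3 (step_out st1 nt).2 !permK.
  rewrite -tgt_even.
  apply: (@PersistsShared compose _ _ src_chart tgt_chart H S
    (odd_corner q.1, even_corner q.2)).
  rewrite /= !mem_cat; apply/or3P/Or32/mapP; exists q => //.
  by rewrite mem_filter E eqxx.
have [_ vo] := wf_shared wf1 oL.
have oT : o.2.1.1 \in tgt L1 by case/and4P: vo.
move yE: (loc c1 o.2) => y0 yx'; case: yx' yE => [t i j nt ji|q qL].
  move=> oE; have [e1 e2 e3] := oE.
  have E : ~~ covered o.2.1.1 by apply/(coveredP oT)/negP; rewrite e1.
  have -> : (h2 t, s2 t i, s2 t j) = loc tgt_chart (odd_corner o.2).
    by rewrite tgt_odd -e1 -e2 -e3.
  rewrite -src_even.
  apply: (@PersistsShared compose _ _ src_chart tgt_chart H S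
    (even_corner o.1, odd_corner o.2)).
  rewrite /= !mem_cat; apply/or3P/Or33/mapP; exists o => //.
  by rewrite mem_filter E.
move=> oq; have [vq _] := wf_shared wf2 qL.
have E : transport C q.1 = Some o.2.
  case E: (transport C q.1) => [z|].
    have [ez zT] := transport_loc vq E.
    congr Some; apply: (loc_inj (step_tgt st1)) => //; last by rewrite oq ez.
    exact: transport_valid E.
  have := transport_None vq E; rewrite -[c2.1 _]/(loc c2 q.1).1.1 -oq.
  by move/negP; case; exact: map_f.
rewrite -src_even -tgt_even.
apply: (@PersistsShared compose _ _ src_chart tgt_chart H S
  (even_corner o.1, even_corner q.2)).
rewrite /= !mem_cat; apply/or3P/Or31/flattenP; exists
  [seq (even_corner o.1, even_corner q.2) | q <- shared L2 & transport C q.1 == Some o.2].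
  by apply/mapP; exists o.
by apply/mapP; exists q => //; rewrite mem_filter E eqxx.
Qed.

Lemma placed_compose : placed compose src_chart tgt_chart H H'.
Proof.
split.
- split=> [k k'|k].
    rewrite !mem_cat => /orP[] /mapP[a +] -> /orP[] /mapP[b +] ->;
      rewrite /= !odd_double /= ?doubleK ?uphalf_double.
    + by move=> aS bS /(step_src st1).1 ->.
    + rewrite !mem_filter => aS /andP[/eqP bN bS] e; have := cpt bS.
      rewrite bN => /(step_out' st1) [+ _]; rewrite -e => /negP []; exact: map_f.
    + rewrite !mem_filter => /andP[/eqP aN aS] bS e; have := cpt aS.
      rewrite aN => /(step_out' st1) [+ _]; rewrite e => /negP []; exact: map_f.
    + rewrite !mem_filter => /andP[/eqP aN aS] /andP[/eqP bN bS] e.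
      have := cpt aS; rewrite aN => /(step_out' st1) [_ ea].
      have := cpt bS; rewrite bN => /(step_out' st1) [_ eb].
      by rewrite (_ : a = b) //; apply: (step_src st2).1 => //; rewrite -ea e eb.
  rewrite mem_cat => /orP[] /mapP[a +] -> i j i4 j4;
    rewrite /= !odd_double /= ?doubleK ?uphalf_double.
    by move=> aS; exact: (step_src st1).2.
  by rewrite mem_filter => /andP[_ aS] /perm_inj; exact: (step_src st2).2.
- split=> [k k'|k].
    rewrite !mem_cat => /orP[] /mapP[a +] -> /orP[] /mapP[b +] ->;
      rewrite /= !odd_double /= ?doubleK ?uphalf_double.
    + by move=> aS bS /(step_tgt st2).1 ->.
    + rewrite !mem_filter => aS /andP[bN bS] e.
      move/(coveredP bS)/negP: bN => /(step_out st2) [+ _].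
      by rewrite -e => /negP []; exact: map_f.
    + rewrite !mem_filter => /andP[aN aS] bS e.
      move/(coveredP aS)/negP: aN => /(step_out st2) [+ _].
      by rewrite e => /negP []; exact: map_f.
    + rewrite !mem_filter => /andP[aN aS] /andP[bN bS] e.
      move/(coveredP aS)/negP: aN => /(step_out st2) [_ ea].
      move/(coveredP bS)/negP: bN => /(step_out st2) [_ eb].
      by rewrite (_ : a = b) //; apply: (step_tgt st1).1 => //; rewrite -ea e eb.
  rewrite mem_cat => /orP[] /mapP[a +] -> i j i4 j4;
    rewrite /= !odd_double /= ?doubleK ?uphalf_double.
    by move=> aS; exact: (step_tgt st2).2.
  by rewrite mem_filter => /andP[_ aS] /perm_inj; exact: (step_tgt st1).2.
- move=> t /region_src [nt nt'].
  have [o1 e1] := step_out st1 nt; have [o2 e2] := step_out st2 nt'.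
  by split; [apply: region_tgtN; rewrite ?e2 | rewrite e2 e1].
- move=> t /region_tgt [nt nt'].
  have [o1 e1] := step_out' st2 nt; have [o2 e2] := step_out' st1 nt'.
  by split; [apply: region_srcN; rewrite ?e2 | rewrite e2 e1].
Qed.

Lemma step_compose : step compose src_chart tgt_chart H H' S T T'.
Proof.
split.
- exact: placed_compose.
- move=> p; rewrite mem_cat => /orP[/mapP[q qL ->]|].
    by rewrite !src_even; exact: (step_src_glue st1).
  case/flattenP => _ /mapP[q qL ->] /allpairsP [[x y] /= [xq yq ->]] /=.
  have [vq1 vq2] := wf_src_glue wf2 qL.
  (* The gluing of the middle triangulation is carried back along [persists], and injectivity pins
     down its image in [T]. *)
  have := step_persists st1 (to_src_persists vq1 xq).
  rewrite (step_src_glue st2 qL) => h.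
  exact: (persists_inj wf1 (step_placed st1) h (to_src_persists vq2 yq)).
- move=> p; rewrite mem_cat => /orP[/mapP[q qL ->]|].
    by rewrite !tgt_even; exact: (step_tgt_glue st2).
  case/flattenP => _ /mapP[q qL ->] /allpairsP [[x y] /= [xq yq ->]] /=.
  have [vq1 vq2] := wf_tgt_glue wf1 qL.
  have := step_persists st2 (to_tgt_persists vq1 xq).
  rewrite (step_tgt_glue st1 qL) => h.
  exact: (persists_fun wf2 (step_placed st2) h (to_tgt_persists vq2 yq)).
- move=> x x' /persists_composeP [y /(step_persists st1) xy /(step_persists st2) yx'].
  by apply/persists_composeP; exists (glue T1 y).
Qed.

End Compose.

Lemma perm4_extension (f g : nat -> 'I_4) : {in gtn 4 &, injective f} ->
  {in gtn 4 &, injective g} -> exists s : 'S_4, forall j, j < 4 -> s (f j) = g j.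
Proof.
move=> fI gI.
have inj (e : nat -> 'I_4) : {in gtn 4 &, injective e} -> injective (fun j : 'I_4 => e j).
  by move=> eI i j /eI ij; apply: val_inj; apply: ij; rewrite inE.
exists ((perm (inj f fI))^-1 * perm (inj g gI))%g => j j4.
have -> : f j = perm (inj f fI) (Ordinal j4) by rewrite permE.
by rewrite permM permK permE.
Qed.

Lemma other_vertex (i : 'I_4) : exists k : 'I_4, k != i.
Proof.
by have [->|] := eqVneq i ord0; [exists ord_max | exists ord0; rewrite eq_sym].
Qed.

Lemma chart_vertex n S (c : chart n) k v : charts S c -> k \in S ->
  exists2 j, j < 4 & v = c.2 k j.
Proof.
move=> [_ vI] kS; have [|r hr] := @perm4_extension (fun j => inord j) (c.2 k) _ (vI k kS).
  by move=> a b a4 b4 /(congr1 val); rewrite /= !inordK.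
by exists ((r^-1)%g v); rewrite // -hr // inord_val permKV.
Qed.

Definition perm4 (p : seq nat) : bool := perm_eq p (iota 0 4).

Lemma perm4_lt p j : perm4 p -> j < 4 -> nth 0 p j < 4.
Proof.
move=> pp j4; have : nth 0 p j \in p by rewrite mem_nth ?(perm_size pp).
by rewrite (perm_mem pp) mem_iota.
Qed.

Lemma perm4_inj p : perm4 p -> {in gtn 4 &, injective (nth 0 p)}.
Proof.
move=> pp i j; rewrite !inE => i4 j4 e; apply/eqP.
by rewrite -(nth_uniq 0 _ _ (_ : uniq p)) ?(perm_size pp) ?e ?eqxx // (perm_uniq pp) iota_uniq.
Qed.

(** A form of [has] that stops at the first success under [vm_compute]; a Boolean disjunction would
    evaluate the rest of the search too. *)
Fixpoint some_in (A : Type) (a : A -> bool) (s : seq A) : bool :=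
  if s is x :: s' then if a x then true else some_in a s' else false.

Lemma some_inP (A : eqType) (a : A -> bool) s : some_in a s -> exists2 x, x \in s & a x.
Proof.
elim: s => //= x s IH; case: ifP => [ax _|_ /IH [y ys ay]].
  by exists x; rewrite ?mem_head.
by exists y; rewrite // inE ys orbT.
Qed.

Definition same_corner (x y : corner) : bool :=
  if eqn x.1.1 y.1.1 then if eqn x.1.2 y.1.2 then eqn x.2 y.2 else false else false.

Lemma same_cornerP x y : reflect (x = y) (same_corner x y).
Proof.
case: x y => [[a b] c] [[a' b'] c']; apply: (iffP idP); rewrite /same_corner /=.
  by do 2 case: eqnP => [->|//]; move=> /eqnP ->.
by case=> -> -> ->; rewrite !eqnE !eqxx.
Qed.

Fixpoint lookup (G : seq (corner * corner)) (x : corner) : option corner :=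
  if G is p :: G' then if same_corner p.1 x then Some p.2 else lookup G' x else None.

Lemma lookup_mem G x y : lookup G x = Some y -> (x, y) \in G.
Proof.
elim: G => //= -[a b] G IH /=; case: same_cornerP => [-> [->]|_ /IH yG].
  by rewrite mem_head.
by rewrite inE yG orbT.
Qed.

(* A recognition criterion: L is seen to be the modification M, up to renaming
   tetrahedra and vertices by f and f', together with tetrahedra that are only
   renamed, as recorded in the list u. *)
Section Recognize.
Variables (L M : template).
Variables (f f' : nat -> nat * seq nat) (u : seq (nat * (nat * seq nat))).

Definition rename (g : nat -> nat * seq nat) (x : corner) : corner :=
  let p := g x.1.1 in (p.1, nth 0 p.2 x.1.2, nth 0 p.2 x.2).

Definition renamed_corners : seq (corner * corner) :=
  flatten [seq [seq ((p.1, ij.1, ij.2), (p.2.1, nth 0 p.2.2 ij.1, nth 0 p.2.2 ij.2))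
    | ij <- [seq ij <- [seq (i, j) | i <- iota 0 4, j <- iota 0 4] | ij.2 != ij.1]] | p <- u].

Definition matched : seq (corner * corner) :=
  [seq (rename f p.1, rename f' p.2) | p <- shared M] ++ renamed_corners.

(* Nested conditionals evaluate lazily in the virtual machine; [andb] does not. *)
Definition recognize : bool :=
  if all (fun p => (rename f p.1, rename f p.2) \in src_glue L) (src_glue M) then
  if all (fun p => (rename f' p.1, rename f' p.2) \in tgt_glue L) (tgt_glue M) then
  if perm_eq ([seq (f k).1 | k <- src M] ++ [seq p.1 | p <- u]) (src L) then
  if perm_eq ([seq (f' k).1 | k <- tgt M] ++ [seq p.2.1 | p <- u]) (tgt L) then
  if all (fun k => perm4 (f k).2) (src M) then
  if all (fun k => perm4 (f' k).2) (tgt M) then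
  if all (fun p => perm4 p.2.2) u then
  let pairs := matched in
  if all (mem pairs) (shared L) then
  all (fun p => if p \in shared L then true else
    if lookup (src_glue L) p.1 is Some y then
    if lookup (tgt_glue L) p.2 is Some y' then (y, y') \in pairs
    else false else false) pairs
  else false else false else false else false else false else false else false else false.

Lemma recognizeE : recognize =
  [&& all (fun p => (rename f p.1, rename f p.2) \in src_glue L) (src_glue M),
      all (fun p => (rename f' p.1, rename f' p.2) \in tgt_glue L) (tgt_glue M),
      perm_eq ([seq (f k).1 | k <- src M] ++ [seq p.1 | p <- u]) (src L),
      perm_eq ([seq (f' k).1 | k <- tgt M] ++ [seq p.2.1 | p <- u]) (tgt L),
      all (fun k => perm4 (f k).2) (src M), all (fun k => perm4 (f' k).2) (tgt M),
      all (fun p => perm4 p.2.2) u, all (mem matched) (shared L)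
    & all (fun p => (p \in shared L) ||
        if lookup (src_glue L) p.1 is Some y then
        if lookup (tgt_glue L) p.2 is Some y' then (y, y') \in matched
        else false else false) matched].
Proof. by []. Qed.

Variables (n m : nat) (T : triangulation n) (T' : triangulation m).
Variables (c : chart n) (c' : chart m).
Variables (h : 'I_n -> 'I_m) (h' : 'I_m -> 'I_n) (s : 'I_n -> 'S_4).
Hypothesis wfL : wf L.
Hypothesis wfM : wf M.
Hypothesis st : step L c c' h h' s T T'.

Definition rename_chart k (e : chart k) (g : nat -> nat * seq nat) : chart k :=
  (fun r => e.1 (g r).1, fun r j => e.2 (g r).1 (nth 0 (g r).2 j)).

Lemma loc_rename k (e : chart k) g x : loc (rename_chart e g) x = loc e (rename g x).
Proof. by []. Qed.

Lemma charts_rename k (e : chart k) g S S' (u' : seq nat) : charts S e -> uniq S ->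
  perm_eq ([seq (g r).1 | r <- S'] ++ u') S -> all (fun r => perm4 (g r).2) S' ->
  charts S' (rename_chart e g).
Proof.
move=> [eI vI] uS pS /allP p4.
have sub r : r \in S' -> (g r).1 \in S.
  by move=> rS; rewrite -(perm_mem pS) mem_cat (map_f (fun r => (g r).1)).
have inj : {in S' &, injective (fun r => (g r).1)}.
  by apply: uniq_map_inj; move: uS; rewrite -(perm_uniq pS) cat_uniq => /andP[].
split=> [r r' rS rS' /eI e1|r rS i j i4 j4 /(vI _ (sub r rS)) e1].
  by apply: inj => //; apply: e1; exact: sub.
apply: (perm4_inj (p4 r rS)) => //; apply: e1; rewrite !inE; exact: perm4_lt (p4 r rS) _.
Qed.

(** The tetrahedra listed in [u] are not replaced by [M], so they join the outside: [h] and [s] are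
    extended over them by the recorded renaming. Gluings are checked on [matched]: a pair is either
    shared by [L], or both gluings are read from the tables of [L] and form a matched pair again. *)
Lemma recognize_step : recognize -> exists g g' r,
  step M (rename_chart c f) (rename_chart c' f') g g' r T T'.
Proof.
rewrite recognizeE => /and5P[gs gt ps pt /and5P[fp fp' up subm subM]].
have [uS uT] : uniq (src L) /\ uniq (tgt L) by case/and5P: wfL.
have u_src p : p \in u -> p.1 \in src L.
  by move=> pu; rewrite -(perm_mem ps) mem_cat (map_f (fun p => p.1)) ?orbT.
have u_tgt p : p \in u -> p.2.1 \in tgt L.
  by move=> pu; rewrite -(perm_mem pt) mem_cat (map_f (fun p => p.2.1)) ?orbT.
have u_inj p q : p \in u -> q \in u -> c.1 p.1 = c.1 q.1 -> p = q.
  move=> pu qu /(step_src st).1 e.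
  have : uniq [seq p.1 | p <- u].
    by move: uS; rewrite -(perm_uniq ps) cat_uniq => /and3P[].
  by move/uniq_map_inj; apply=> //; apply: e; exact: u_src.
have u_inj' p q : p \in u -> q \in u -> c'.1 p.2.1 = c'.1 q.2.1 -> p = q.
  move=> pu qu /(step_tgt st).1 e.
  have : uniq [seq p.2.1 | p <- u].
    by move: uT; rewrite -(perm_uniq pt) cat_uniq => /and3P[].
  by move/uniq_map_inj; apply=> //; apply: e; exact: u_tgt.
(* [t] is listed in [u], is renamed to [z], and [r] realises the recorded vertex permutation in the
   actual charts. *)
pose P t z r := exists2 p, p \in u &
  [/\ c.1 p.1 = t, z = c'.1 p.2.1 & forall j, j < 4 -> (r : 'S_4) (c.2 p.1 j) = c'.2 p.2.1 (nth 0 p.2.2 j)].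
have [g hg] : exists g : 'I_n -> 'I_m * 'S_4, forall t,
    (P t (g t).1 (g t).2) \/ ((forall p, p \in u -> c.1 p.1 <> t) /\ g t = (h t, s t)).
  suff /choice [g hg] : forall t, exists g : 'I_m * 'S_4,
      P t g.1 g.2 \/ ((forall p, p \in u -> c.1 p.1 <> t) /\ g = (h t, s t)) by exists g.
  move=> t; have [[p [pu pt']]|no] := pselect (exists p, p \in u /\ c.1 p.1 = t).
    have [||r hr] := @perm4_extension (c.2 p.1) (fun j => c'.2 p.2.1 (nth 0 p.2.2 j)).
    - exact: (step_src st).2 (u_src p pu).
    - move=> i j i4 j4 /((step_tgt st).2 _ (u_tgt p pu)) e.
      have p4 := allP up p pu; apply: (perm4_inj p4) => //; apply: e; exact: perm4_lt.
    by exists (c'.1 p.2.1, r); left; exists p.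
  by exists (h t, s t); right; split=> // p pu e; apply: no; exists p.
have [g' hg'] : exists g' : 'I_m -> 'I_n, forall t,
    (exists2 p, p \in u & c'.1 p.2.1 = t /\ g' t = c.1 p.1) \/
    ((forall p, p \in u -> c'.1 p.2.1 <> t) /\ g' t = h' t).
  suff /choice [g' hg'] : forall t, exists z,
      (exists2 p, p \in u & c'.1 p.2.1 = t /\ z = c.1 p.1) \/
      ((forall p, p \in u -> c'.1 p.2.1 <> t) /\ z = h' t) by exists g'.
  move=> t; have [[p [pu pt']]|no] := pselect (exists p, p \in u /\ c'.1 p.2.1 = t).
    by exists (c.1 p.1); left; exists p.
  by exists (h' t); right; split=> // p pu e; apply: no; exists p.
have src_split t : t \notin region (src M) (rename_chart c f) ->
    (exists2 p, p \in u & c.1 p.1 = t) \/ t \notin region (src L) c.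
  move=> nt; have [/mapP[k kS tE]|] := boolP (t \in region (src L) c); last by right.
  left; move: kS; rewrite -(perm_mem ps) mem_cat => /orP[] /mapP[p pu kE].
    by case/negP: nt; apply/mapP; exists p; rewrite // tE kE.
  by exists p; rewrite // tE kE.
have tgt_split t : t \notin region (tgt M) (rename_chart c' f') ->
    (exists2 p, p \in u & c'.1 p.2.1 = t) \/ t \notin region (tgt L) c'.
  move=> nt; have [/mapP[k kS tE]|] := boolP (t \in region (tgt L) c'); last by right.
  left; move: kS; rewrite -(perm_mem pt) mem_cat => /orP[] /mapP[p pu kE].
    by case/negP: nt; apply/mapP; exists p; rewrite // tE kE.
  by exists p; rewrite // tE kE.
have src_in t : t \notin region (src L) c -> t \notin region (src M) (rename_chart c f).
  apply: contra => /mapP[k kS ->]; apply: map_f.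
  by rewrite -(perm_mem ps) mem_cat (map_f (fun r => (f r).1)).
have tgt_in t : t \notin region (tgt L) c' -> t \notin region (tgt M) (rename_chart c' f').
  apply: contra => /mapP[k kS ->]; apply: map_f.
  by rewrite -(perm_mem pt) mem_cat (map_f (fun r => (f' r).1)).
have u_src_out p : p \in u -> c.1 p.1 \notin region (src M) (rename_chart c f).
  move=> pu; apply/negP => /mapP[k kS] /(step_src st).1 e.
  move: uS; rewrite -(perm_uniq ps) cat_uniq => /and3P[_ /hasP h1 _]; case: h1.
  exists p.1; first exact: map_f.
  rewrite /= e ?u_src ?(map_f (fun r => (f r).1)) //.
  by rewrite -(perm_mem ps) mem_cat (map_f (fun r => (f r).1)).
have u_tgt_out p : p \in u -> c'.1 p.2.1 \notin region (tgt M) (rename_chart c' f').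
  move=> pu; apply/negP => /mapP[k kS] /(step_tgt st).1 e.
  move: uT; rewrite -(perm_uniq pt) cat_uniq => /and3P[_ /hasP h1 _]; case: h1.
  exists p.2.1; first exact: (map_f (fun p => p.2.1)).
  rewrite /= e ?u_tgt ?(map_f (fun r => (f' r).1)) //.
  by rewrite -(perm_mem pt) mem_cat (map_f (fun r => (f' r).1)).
have g_u p : p \in u -> (g (c.1 p.1)).1 = c'.1 p.2.1 /\
    forall j, j < 4 -> (g (c.1 p.1)).2 (c.2 p.1 j) = c'.2 p.2.1 (nth 0 p.2.2 j).
  move=> pu; have [[q qu [e -> hr]]|[/(_ p pu)] //] := hg (c.1 p.1).
  by rewrite (u_inj _ _ qu pu e) in hr *.
have g_out t : t \notin region (src L) c -> g t = (h t, s t).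
  move=> nt; have [[q qu [e _ _]]|[_ ->] //] := hg t.
  by case/negP: nt; rewrite -e; apply: map_f; exact: u_src.
have g'_u p : p \in u -> g' (c'.1 p.2.1) = c.1 p.1.
  move=> pu; have [[q qu [e ->]]|[/(_ p pu)] //] := hg' (c'.1 p.2.1).
  by rewrite (u_inj' _ _ qu pu e).
have g'_out t : t \notin region (tgt L) c' -> g' t = h' t.
  move=> nt; have [[q qu [e _]]|[_ ->] //] := hg' t.
  by case/negP: nt; rewrite -e; apply: map_f; exact: u_tgt.
pose K := persists M (rename_chart c f) (rename_chart c' f') (fun t => (g t).1) (fun t => (g t).2).
have K_matched p : p \in matched -> K (loc c p.1) (loc c' p.2).
  rewrite mem_cat => /orP[/mapP[q qM ->]|]; first exact: PersistsShared.
  case/flattenP => _ /mapP[p0 pu ->] /mapP[[i j]].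
  rewrite mem_filter => /andP[ji /allpairsP [p1 [iI jI e]]] ->.
  move: iI jI ji; rewrite !mem_iota; case: e => -> -> i4 j4 ji; have [e1 e2] := g_u _ pu.
  rewrite /K /loc /= -e1 -!e2 //; apply: PersistsOutside; first exact: u_src_out.
  by apply: contra ji => /eqP /((step_src st).2 _ (u_src _ pu)) ->.
have K_out t i j : t \notin region (src L) c -> j != i -> K (t, i, j) (h t, s t i, s t j).
  move=> nt ji; have <- : (g t).1 = h t by rewrite g_out.
  have <- : (g t).2 = s t by rewrite g_out.
  by apply: PersistsOutside => //; exact: src_in.
have K_all x x' : persists L c c' h s x x' -> K x x'.
  by case=> [t i j nt ji|p pL]; [exact: K_out | apply/K_matched/(allP subm)].
exists (fun t => (g t).1), g', (fun t => (g t).2); split; first split.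
- exact: charts_rename (step_src st) uS ps fp.
- exact: charts_rename (step_tgt st) uT pt fp'.
- move=> t /src_split [[p pu <-]|nt].
    by rewrite (g_u p pu).1 g'_u //; split=> //; exact: u_tgt_out.
  have [nt' e] := step_out st nt; rewrite g_out //= g'_out //; split=> //.
  exact: tgt_in.
- move=> t /tgt_split [[p pu <-]|nt].
    by rewrite g'_u // (g_u p pu).1; split=> //; exact: u_src_out.
  have [nt' e] := step_out' st nt; rewrite g'_out // g_out //=; split=> //.
  exact: src_in.
- by move=> p pM; rewrite !loc_rename; exact: (step_src_glue st (allP gs p pM)).
- by move=> p pM; rewrite !loc_rename; exact: (step_tgt_glue st (allP gt p pM)).
- have base p : p \in matched -> K (glue T (loc c p.1)) (glue T' (loc c' p.2)).
    move=> pm; have /orP[pL|] := allP subM p pm.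
      by apply/K_all/(step_persists st)/PersistsShared.
    case E: (lookup _ p.1) => [y|//]; case E': (lookup _ p.2) => [y'|//] yy'.
    rewrite (step_src_glue st (lookup_mem E)) (step_tgt_glue st (lookup_mem E')).
    exact: (K_matched (y, y')).
  move=> x x' [t i j /src_split [[p pu <-]|nt] ji|p pM].
  + have [i0 i04 iE] := chart_vertex i (step_src st) (u_src p pu).
    have [j0 j04 jE] := chart_vertex j (step_src st) (u_src p pu).
    have [e1 e2] := g_u p pu; rewrite e1 iE jE !e2 //.
    apply: (base ((p.1, i0, j0), (p.2.1, nth 0 p.2.2 i0, nth 0 p.2.2 j0))).
    rewrite mem_cat; apply/orP; right; apply/flattenP; eexists.
      by apply/mapP; exists p.
    apply/mapP; exists (i0, j0) => //; rewrite mem_filter; apply/andP; split.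
      by apply: contra ji => /eqP /= e; rewrite iE jE e.
    by apply/allpairsP; exists (i0, j0); rewrite !mem_iota.
  + by rewrite g_out //; apply/K_all/(step_persists st); exact: PersistsOutside.
  + by apply: (base (rename f p.1, rename f' p.2)); rewrite mem_cat; apply/orP; left; apply/mapP; exists p.
Qed.

End Recognize.

Definition empty_template : template := Template [::] [::] [::] [::] [::].

Lemma step_isomorphic n m (T : triangulation n) (T' : triangulation m) c c' h h' s :
  step empty_template c c' h h' s T T' -> isomorphic T T'.
Proof.
move=> st; exists h, s; split.
  by exists h' => t; [have [] := step_out st (t := t) isT | have [] := step_out' st (t := t) isT].
move=> [[t i] j].
have base i' j' : j' != i' -> glue T' (relabel h s (t, i', j')) = relabel h s (glue T (t, i', j')).
  move=> ji; have := step_persists st (@PersistsOutside empty_template _ _ c c' h s t i' j' isT ji).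
  by move E: (glue T _) => x xy; case: xy E => // t0 i0 j0 _ _ <-.
(* [persists] says nothing about the position [j = i]; the face number there is read off at another
   vertex [k] of the same face. *)
have [ij|] := eqVneq j i; last exact: base.
have [k ki] := other_vertex i.
by have := base i k ki; rewrite ij /= => -[-> -> _].
Qed.

(** * Polyhedra as templates *)

Section Polyhedra.
Variables P Q : polyhedron.

Definition position (R : polyhedron) (k : nat) (a : nat) : nat :=
  index a (nth [::] (tets R) k).

Definition face_corners (R : polyhedron) (F : named_face) : seq corner :=
  [seq (F.1, position R F.1 (opposite R F), position R F.1 a) | a <- F.2].

(** Each face pairing is listed in both directions, as [glue] is an involution; a lookup then
    succeeds from either side. *)
Definition inner_corners (R : polyhedron) : seq (corner * corner) :=
  flatten [seq zip (face_corners R FG.1) (face_corners R FG.2) ++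
               zip (face_corners R FG.2) (face_corners R FG.1) | FG <- inner R].

Definition replacement : template := Template
  (iota 0 (size (tets P))) (inner_corners P) (iota 0 (size (tets Q))) (inner_corners Q)
  (flatten [seq zip (face_corners P FG.1) (face_corners Q FG.2)
     | FG <- zip (outer P) (outer Q)]).

Definition vertex_named (R : polyhedron) n (c : chart n) (k a : nat) : 'I_4 :=
  c.2 k (position R k a).

Lemma corners_loc (R : polyhedron) n (c : chart n) F :
  corners R c.1 (vertex_named R c) F = map (loc c) (face_corners R F).
Proof. by rewrite /corners -map_comp. Qed.

Lemma mem_zip_map (A B A' B' : eqType) (a : A -> A') (b : B -> B') s t x y :
  (x, y) \in zip (map a s) (map b t) ->
  exists2 p, p \in zip s t & x = a p.1 /\ y = b p.2.
Proof.
elim: s t => [|z s IH] [|w t] //=; rewrite inE => /orP[/eqP[-> ->]|/IH [p pI e]].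
  by exists (z, w); rewrite ?mem_head.
by exists p; rewrite // inE pI orbT.
Qed.

Lemma zip_map_mem (A B A' B' : eqType) (a : A -> A') (b : B -> B') s t p :
  p \in zip s t -> (a p.1, b p.2) \in zip (map a s) (map b t).
Proof.
elim: s t => [|z s IH] [|w t] //=; rewrite !inE => /orP[/eqP -> /=|/IH ->].
  by rewrite eqxx.
by rewrite orbT.
Qed.

Lemma occurs_realizes (R : polyhedron) n (c : chart n) (T : triangulation n) :
  (forall FG, FG \in inner R -> size (face_corners R FG.1) = size (face_corners R FG.2)) ->
  (forall FG, FG \in inner R -> map (glue T) (map (loc c) (face_corners R FG.1)) =
     map (loc c) (face_corners R FG.2)) <-> realizes (inner_corners R) c T.
Proof.
move=> sz; split=> [H p /flattenP[_ /mapP[FG FGR ->]]|H FG FGR].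
  have e := H FG FGR.
  have key q : q \in zip (face_corners R FG.1) (face_corners R FG.2) ->
      glue T (loc c q.1) = loc c q.2.
    have := sz _ FGR; move: e; move: (face_corners R FG.1) (face_corners R FG.2).
    elim=> [|x s IH] [|y t] //=.
    move=> /eqP; rewrite eqseq_cons => /andP[/eqP e /eqP es] [ss]; rewrite inE => /orP[/eqP -> //|].
    exact: IH.
  rewrite mem_cat => /orP[/key //|pI].
  have : (p.2, p.1) \in zip (face_corners R FG.1) (face_corners R FG.2).
    have := sz _ FGR; move: pI; move: (face_corners R FG.1) (face_corners R FG.2).
    case: p => p1 p2; elim=> [|x s IH] [|y t] //=.
    by rewrite !inE => /orP[/eqP[-> ->]|/IH H'] [ss]; rewrite ?eqxx // H' ?orbT.
  by move=> /key e'; rewrite -[in LHS](e' : glue T (loc c p.2) = loc c p.1) glueK.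
have key q : q \in zip (face_corners R FG.1) (face_corners R FG.2) ->
    glue T (loc c q.1) = loc c q.2.
  move=> qI; apply: H; apply/flattenP; eexists; first by apply/mapP; exists FG.
  by rewrite mem_cat qI.
have := sz _ FGR; move: key; move: (face_corners R FG.1) (face_corners R FG.2).
elim=> [|x s IH] [|y t] //= key [ss].
congr cons; first exact: (key (x, y) (mem_head _ _)).
by apply: IH => // q qI; apply: key; rewrite inE qI orbT.
Qed.

Hypothesis wfP : well_formed P.
Hypothesis wfQ : well_formed Q.

Lemma well_formed_size (R : polyhedron) : well_formed R ->
  forall k, k < size (tets R) -> uniq (nth [::] (tets R) k) /\ size (nth [::] (tets R) k) = 4.
Proof.
case/and3P => /allP w _ _ k kR; have /andP[u /eqP s] := w _ (mem_nth [::] kR).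
by split.
Qed.

Lemma well_formed_face (R : polyhedron) F : well_formed R ->
  F \in flatten [seq [:: FG.1; FG.2] | FG <- inner R] ++ outer R ->
  [/\ F.1 < size (tets R), size F.2 = 3, opposite R F \in nth [::] (tets R) F.1
    & {subset F.2 <= nth [::] (tets R) F.1}].
Proof.
case/and3P => _ /allP w /perm_mem e FR; have /and3P[_ /eqP s3 /allP sub] := w F FR.
have : (F.1, opposite R F) \in [seq (k, c) | k <- iota 0 (size (tets R)),
                            c <- nth [::] (tets R) k].
  by rewrite -e; exact: (map_f (fun F => (F.1, opposite R F))).
case/allpairsPdep => k [a [kR aR [eF ea]]]; split=> //.
- by move: kR; rewrite mem_iota eF.
- by rewrite eF ea.
Qed.

Lemma named_chart (R : polyhedron) n (e : nat -> 'I_n) v F : well_formed R ->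
  F \in flatten [seq [:: FG.1; FG.2] | FG <- inner R] ++ outer R ->
  corners R e v F =
  map (loc (e, fun k j => v k (nth 0 (nth [::] (tets R) k) j))) (face_corners R F).
Proof.
move=> wR /(well_formed_face wR) [_ _ oR sub]; rewrite /corners /face_corners -map_comp.
apply/eq_in_map => a /sub aR /=.
by rewrite /loc /= /position !nth_index.
Qed.

Lemma inner_size (R : polyhedron) : well_formed R -> forall FG, FG \in inner R ->
  size (face_corners R FG.1) = size (face_corners R FG.2).
Proof.
move=> wR FG FGR; rewrite !size_map.
have [|_ -> _ _] := @well_formed_face R FG.1 wR.
  rewrite mem_cat; apply/orP; left; apply/flattenP; exists [:: FG.1; FG.2].
    by apply/mapP; exists FG.
  by rewrite mem_head.
have [|_ -> _ _] // := @well_formed_face R FG.2 wR.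
rewrite mem_cat; apply/orP; left; apply/flattenP; exists [:: FG.1; FG.2].
  by apply/mapP; exists FG.
by rewrite !inE eqxx orbT.
Qed.

Lemma outside_region (R : polyhedron) n (e : nat -> 'I_n) v t :
  (t \in outside R e) = (t \notin region (iota 0 (size (tets R))) (e, v)).
Proof. by rewrite inE. Qed.

Lemma replaces_step n m (T : triangulation n) (T' : triangulation m) :
  replaces P Q T T' -> exists c c' h h' s, step replacement c c' h h' s T T'.
Proof.
case=> e [v [e' [v' [h [s [[eI vI gP] [eI' vI' gQ] hI hE kp]]]]]].
pose cP : chart n := (e, fun k j => v k (nth 0 (nth [::] (tets P) k) j)).
pose cQ : chart m := (e', fun k j => v' k (nth 0 (nth [::] (tets Q) k) j)).
have mem_inner (R : polyhedron) FG : FG \in inner R ->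
    FG.1 \in flatten [seq [:: FG.1; FG.2] | FG <- inner R] ++ outer R /\
    FG.2 \in flatten [seq [:: FG.1; FG.2] | FG <- inner R] ++ outer R.
  move=> FGR; rewrite !mem_cat; split; apply/orP; left; apply/flattenP;
    exists [:: FG.1; FG.2]; try by apply/mapP; exists FG.
    by rewrite mem_head.
  by rewrite !inE eqxx orbT.
have mem_outer (R : polyhedron) F : F \in outer R ->
    F \in flatten [seq [:: FG.1; FG.2] | FG <- inner R] ++ outer R.
  by rewrite mem_cat => ->; rewrite orbT.
have zip_outer F G : (F, G) \in zip (outer P) (outer Q) -> F \in outer P /\ G \in outer Q.
  elim: (outer P) (outer Q) => [|x sP IH] [|y sQ] //=.
  by rewrite !inE => /orP[/eqP[-> ->]|/IH [-> ->]]; rewrite ?eqxx ?orbT.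
have [h' hh'] : exists h' : 'I_m -> 'I_n, forall t, t \in outside Q e' ->
    h' t \in outside P e /\ h (h' t) = t.
  suff /choice [h' hh'] : forall t, exists z, t \in outside Q e' ->
      z \in outside P e /\ h z = t by exists h'.
  (* [e 0] is a filler for the values of [h'] on the new tetrahedra. *)
  move=> t; have [|nt] := boolP (t \in outside Q e'); last by exists (e 0).
  by rewrite -hE => /imsetP[z zP ->]; exists z.
have kept_persists x x' : kept P Q e v e' v' h s x x' <-> persists replacement cP cQ h s x x'.
  split.
    case=> [t i j tP ji|F G y y' FG yy'].
      by apply: PersistsOutside => //; rewrite -outside_region.
    have [FP GQ] := zip_outer _ _ FG.
    move: yy'; rewrite (named_chart _ _ wfP (mem_outer _ _ FP)) (named_chart _ _ wfQ (mem_outer _ _ GQ)).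
    case/mem_zip_map => p pFG [-> ->]; apply: PersistsShared; apply/flattenP.
    by eexists; [apply/mapP; exists (F, G) | exact: pFG].
  case=> [t i j tP ji|p /flattenP[_ /mapP[[F G] FG ->] pFG]].
    by apply: KeptOutside => //; rewrite (outside_region _ _ cP.2).
  have [FP GQ] := zip_outer _ _ FG.
  apply: KeptOuter FG _.
  rewrite (named_chart _ _ wfP (mem_outer _ _ FP)) (named_chart _ _ wfQ (mem_outer _ _ GQ)).
  exact: zip_map_mem.
have occ_charts (R : polyhedron) k (e0 : nat -> 'I_k) (v0 : nat -> nat -> 'I_4) : well_formed R ->
    {in gtn (size (tets R)) &, injective e0} ->
    (forall k, k < size (tets R) -> {in nth [::] (tets R) k &, injective (v0 k)}) ->
    charts (iota 0 (size (tets R))) (e0, fun k j => v0 k (nth 0 (nth [::] (tets R) k) j)).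
  move=> wR eI0 vI0; split=> [a b|a]; rewrite !mem_iota /= ?add0n; first exact: eI0.
  move=> aR; have [u s4] := well_formed_size wR aR => i j; rewrite !inE => i4 j4.
  move=> /(vI0 a aR); rewrite !mem_nth ?s4 // => /(_ isT isT) /eqP.
  by rewrite nth_uniq ?s4 // => /eqP.
have occ_glue (R : polyhedron) k (e0 : nat -> 'I_k) v0 (T0 : triangulation k) : well_formed R ->
    (forall FG, FG \in inner R -> map (glue T0) (corners R e0 v0 FG.1) = corners R e0 v0 FG.2) ->
    realizes (inner_corners R) (e0, fun k j => v0 k (nth 0 (nth [::] (tets R) k) j)) T0.
  move=> wR g0; apply/(occurs_realizes _ _ (inner_size wR)) => FG FGR.
  have [m1 m2] := mem_inner _ _ FGR.
  by rewrite -!(named_chart _ _ wR) // g0.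
exists cP, cQ, h, h', s; split; first split.
- exact: occ_charts.
- exact: occ_charts.
- move=> t; rewrite -outside_region => tP.
  have htQ : h t \in outside Q e' by rewrite -hE; exact: imset_f.
  rewrite -outside_region htQ; split=> //; have [a b] := hh' _ htQ; exact: hI.
- by move=> t; rewrite -!outside_region; exact: hh'.
- exact: occ_glue.
- exact: occ_glue.
- by move=> x x' /kept_persists /kp /kept_persists.
Qed.

Lemma step_replaces n m (T : triangulation n) (T' : triangulation m) c c' h h' s :
  step replacement c c' h h' s T T' -> replaces P Q T T'.
Proof.
move=> st; exists c.1, (vertex_named P c), c'.1, (vertex_named Q c'), h, s.
have zip_outer F G : (F, G) \in zip (outer P) (outer Q) -> F \in outer P /\ G \in outer Q.
  elim: (outer P) (outer Q) => [|x sP IH] [|y sQ] //=.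
  by rewrite !inE => /orP[/eqP[-> ->]|/IH [-> ->]]; rewrite ?eqxx ?orbT.
have kept_persists x x' : kept P Q c.1 (vertex_named P c) c'.1 (vertex_named Q c') h s x x'
    <-> persists replacement c c' h s x x'.
  split.
    case=> [t i j tP ji|F G y y' FG].
      by apply: PersistsOutside => //; move: tP; rewrite inE.
    rewrite !corners_loc => /mem_zip_map [p pFG [-> ->]]; apply: PersistsShared; apply/flattenP.
    by eexists; [apply/mapP; exists (F, G) | exact: pFG].
  case=> [t i j tP ji|p /flattenP[_ /mapP[[F G] FG ->] pFG]].
    by apply: KeptOutside => //; rewrite inE.
  apply: KeptOuter FG _; rewrite !corners_loc; exact: zip_map_mem.
have occ (R : polyhedron) k (c0 : chart k) T0 : well_formed R -> charts (iota 0 (size (tets R))) c0 ->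
    realizes (inner_corners R) c0 T0 -> occurs R c0.1 (vertex_named R c0) T0.
  move=> wR [eI vI] g0; split.
  - by move=> a b aR bR; apply: eI; rewrite mem_iota.
  - move=> a aR x y xR yR e; have [u s4] := well_formed_size wR aR.
    have := vI a; rewrite mem_iota => /(_ aR _ _ _ _ e).
    rewrite !inE /position -s4 !index_mem => /(_ xR yR) e'.
    by rewrite -(nth_index 0 xR) e' nth_index.
  - by move=> FG FGR; rewrite !corners_loc; move/(occurs_realizes _ _ (inner_size wR)): g0; apply.
split.
- exact: occ (step_src st) (step_src_glue st).
- exact: occ (step_tgt st) (step_tgt_glue st).
- move=> t t'; rewrite !(outside_region _ _ c.2) -surjective_pairing => nt nt' e.
  by rewrite -(step_out st nt).2 e (step_out st nt').2.
- apply/setP => t; rewrite (outside_region _ _ c'.2) -surjective_pairing.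
  apply/imsetP/idP => [[z + ->]|nt].
    by rewrite (outside_region _ _ c.2) -surjective_pairing => /(step_out st) [].
  exists (h' t); last by rewrite (step_out' st nt).2.
  by rewrite (outside_region _ _ c.2) -surjective_pairing (step_out' st nt).1.
- by move=> x x' /kept_persists /(step_persists st) /kept_persists.
Qed.

End Polyhedra.

(** * Performing a modification *)

Section TriangulationOfRelation.
Variables (m : nat) (K : face_corner m -> face_corner m -> Prop).
Hypothesis K_total : forall t i j, j != i -> exists z, K (t, i, j) z.
Hypothesis K_sym : forall y z, K y z -> K z y.
Hypothesis K_fun : forall y z z', K y z -> K y z' -> z = z'.
Hypothesis K_off : forall y z, K y z -> z.2 != z.1.2.
Hypothesis K_face : forall y z y' z', K y z -> K y' z' -> y.1 = y'.1 -> z.1 = z'.1.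
Hypothesis K_self : forall y z, K y z -> z.1 <> y.1.

(** By [K_face] the three corners of face [i] go to corners of one face, and by [K_off] they avoid
    its opposite vertex. Sending [i] to that opposite vertex completes the assignment to a
    permutation. *)
Lemma gluing_of_relation t i : exists G : 'I_m * 'S_4,
  forall j, j != i -> K (t, i, j) (G.1, G.2 i, G.2 j).
Proof.
have [f hf] : exists f : 'I_4 -> face_corner m, forall j, j != i -> K (t, i, j) (f j).
  suff /choice [f hf] : forall j, exists z, j != i -> K (t, i, j) z by exists f.
  move=> j; have [ji|ji] := boolP (j != i); last by exists (t, i, j).
  by have [z hz] := K_total t ji; exists z.
have [k ki] := other_vertex i.
have fk j : j != i -> (f j).1 = (f k).1 by move=> ji; apply: K_face (hf j ji) (hf k ki) _.
pose g j := if j == i then (f k).1.2 else (f j).2.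
have g_inj : injective g.
  have ne j : j != i -> (f j).2 != (f k).1.2.
    by move=> ji; rewrite -(fk j ji); exact: K_off (hf j ji).
  move=> j j'; rewrite /g; case: eqP => [->|/eqP ji]; case: eqP => [->|/eqP ji'] //.
  - by move=> e; case/eqP: (ne j' ji').
  - by move=> e; case/eqP: (ne j ji).
  - move=> e; have ff : f j = f j'.
      by rewrite [LHS]surjective_pairing [RHS]surjective_pairing !fk // e.
    have := hf j' ji'; rewrite -ff => /K_sym h.
    by have [] := K_fun (K_sym (hf j ji)) h.
exists ((f k).1.1, perm g_inj) => j ji /=.
rewrite !permE /g eqxx (negbTE ji) -surjective_pairing -(fk j ji) -surjective_pairing.
exact: hf.
Qed.

Lemma triangulation_of_relation : exists T : triangulation m,
  forall y z, y.2 != y.1.2 -> K y z -> glue T y = z.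
Proof.
have [G hG] : exists G : 'I_m * 'I_4 -> 'I_m * 'S_4, forall f j, j != f.2 ->
    K (f.1, f.2, j) ((G f).1, (G f).2 f.2, (G f).2 j).
  suff /choice [G hG] : forall f : 'I_m * 'I_4, exists z : 'I_m * 'S_4,
      forall j, j != f.2 -> K (f.1, f.2, j) (z.1, z.2 f.2, z.2 j) by exists G.
  by case=> t i; exact: gluing_of_relation.
pose nb t i := (G (t, i)).1.
pose gl t i := (G (t, i)).2.
have KG t i j : j != i -> K (t, i, j) (nb t i, gl t i i, gl t i j) by move/(hG (t, i)).
have inv t i j : j != i ->
    [/\ nb (nb t i) (gl t i i) = t, gl (nb t i) (gl t i i) (gl t i i) = i
      & gl (nb t i) (gl t i i) (gl t i j) = j].
  move=> ji; have ne : gl t i j != gl t i i by rewrite (inj_eq perm_inj).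
  by have [] := K_fun (KG _ _ _ ne) (K_sym (KG _ _ _ ji)).
have sym t i : nb (nb t i) (gl t i i) = t /\ gl (nb t i) (gl t i i) = ((gl t i)^-1)%g.
  have [k ki] := other_vertex i; have [e1 e2 _] := inv t i k ki; split=> //.
  apply: (mulgI (gl t i)); rewrite mulgV; apply/permP => j; rewrite permM perm1.
  by have [->|ji] := eqVneq j i; last have [_ _] := inv t i j ji.
have distinct t i : (nb t i, gl t i i) <> (t, i).
  by have [k ki] := other_vertex i; have := K_self (KG t i k ki).
exists (Triangulation sym distinct) => -[[t i] j] z /= ji Kz.
exact: K_fun (KG t i j ji) Kz.
Qed.

End TriangulationOfRelation.

Definition faces_match (G : seq (corner * corner)) : bool :=
  all (fun p => all (fun q => (p.1.1 == q.1.1) == (p.2.1 == q.2.1)) G) G.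

Definition all_corners_of (S : seq nat) : seq corner :=
  [seq x <- [seq (ki.1, ki.2, j) | ki <- [seq (k, i) | k <- S, i <- iota 0 4], j <- iota 0 4]
     | valid S x].

(** The exclusive disjunctions say that each corner is either glued inside or shared, never both.
    [faces_match] and [p.1.1 != r.2.1] make the new gluing well defined on whole faces, and
    [p.1.1 != p.2.1] keeps a face from being glued to itself. *)
Definition performable (L : template) : bool :=
  [&& wf L, tgt L == iota 0 (size (tgt L)), 0 < size (tgt L), 0 < size (src L),
      all (fun x => (x \in map fst (src_glue L)) (+) (x \in map fst (shared L)))
        (all_corners_of (src L)),
      all (fun p => p.2 \in map fst (src_glue L)) (src_glue L),
      all (fun x => (x \in map fst (tgt_glue L)) (+) (x \in map snd (shared L)))
        (all_corners_of (tgt L)),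
      uniq (map fst (tgt_glue L)),
      all (fun p => (p.2, p.1) \in tgt_glue L) (tgt_glue L),
      faces_match (tgt_glue L), all (fun p => p.1.1 != p.2.1) (tgt_glue L),
      all (fun p => all (fun r => p.1.1 != r.2.1) (shared L)) (tgt_glue L)
    & faces_match (shared L)].

Lemma mem_all_corners S x : valid S x -> x \in all_corners_of S.
Proof.
move=> vx; rewrite mem_filter; apply/andP; split=> //; case/and4P: vx => xS i4 j4 _.
case: x xS i4 j4 => [[k i] j] kS i4 j4; apply/allpairsP; exists ((k, i), j).
split=> //; last by rewrite mem_iota.
by apply/allpairsP; exists (k, i); split=> //; rewrite mem_iota.
Qed.

Section Perform.
Variables (L : template) (n : nat) (T : triangulation n) (c : chart n).
Hypothesis perfL : performable L.
Hypothesis cS : charts (src L) c.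
Hypothesis cG : realizes (src_glue L) c T.

Let q := size (tgt L).
Local Notation kept_tet := {t : 'I_n | t \notin region (src L) c}.
(** The successor form makes [inord] and [ord0] available; the size is right because [q] is
    positive. *)
Local Notation new_tet := 'I_q.-1.+1.
Local Notation new_size := #|{: kept_tet + new_tet}|.

Let new_chart : chart new_size :=
  (fun k => enum_rank (inr (inord k) : kept_tet + new_tet)%type, fun k j => inord j).

Let new_out (t : 'I_n) : 'I_new_size :=
  if insub t is Some u then enum_rank (inl u : kept_tet + new_tet)%type
  else enum_rank (inr ord0 : kept_tet + new_tet)%type.

Let old_out (t : 'I_new_size) : 'I_n :=
  match enum_val t with inl u => val u | inr _ => c.1 0 end.

Let q_gt0 : 0 < q. Proof. by case/and5P: perfL. Qed.

Let tgt_lt k : (k \in tgt L) = (k < q).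
Proof. by case/and5P: perfL => _ /eqP -> _ _ _; rewrite mem_iota. Qed.

Lemma perform_placed : placed L c new_chart new_out old_out.
Proof.
have outE t (nt : t \notin region (src L) c) : new_out t = enum_rank (inl (Sub t nt) : kept_tet + new_tet)%type.
  by rewrite /new_out insubT.
split=> //.
- split=> [k k'|k _ i j]; last first.
    by rewrite !inE => i4 j4 /(congr1 val); rewrite /= !inordK.
  rewrite !tgt_lt => kq kq' /enum_rank_inj [] /(congr1 val) /=.
  by rewrite !inordK // prednK.
- move=> t nt; rewrite outE; split; last by rewrite /old_out enum_rankK SubK.
  by apply/negP => /mapP[k kS] /enum_rank_inj.
- move=> t nt; rewrite /old_out; case E: (enum_val t) => [u|z].
    split; first exact: (valP u).
    rewrite (outE _ (valP u)) -[RHS]enum_valK E; congr (enum_rank (inl _)).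
    exact: val_inj.
  case/negP: nt; apply/mapP; exists (val z).
    by rewrite tgt_lt; apply: leq_trans (ltn_ord z) _; rewrite prednK.
  by rewrite /= inord_val -E enum_valK.
Qed.

Let P := persists L c new_chart new_out (fun=> 1%g).

Let wfL : wf L. Proof. by case/and5P: perfL. Qed.

Lemma persists_face x y x' y' : P x y -> P x' y' -> x.1 = x'.1 <-> y.1 = y'.1.
Proof.
have pl := perform_placed.
have side p : p \in shared L -> valid (src L) p.1 /\ valid (tgt L) p.2.
  exact: wf_shared.
have fm p r : p \in shared L -> r \in shared L -> (p.1.1 == r.1.1) = (p.2.1 == r.2.1).
  move=> pL rL; case/and5P: perfL => _ _ _ _ /and5P[_ _ _ _ /and5P[_ _ _ _ h]].
  by have /allP/(_ r rL)/eqP := allP h p pL.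
have face k (e : chart k) S x0 y0 : charts S e -> valid S x0 -> valid S y0 ->
    (loc e x0).1 = (loc e y0).1 <-> x0.1 = y0.1.
  case: x0 y0 => [[a i] j] [[b i'] j'] [eI vI] /and4P[/= aS i4 _ _] /and4P[/= bS i4' _ _].
  split=> [[] /(eI _ _ aS bS) ab|[-> ->] //].
  by rewrite ab in aS *; move=> /(vI _ aS) ->.
have apart t r : t \notin region (src L) c -> r \in shared L ->
    t <> (loc c r.1).1.1 /\ new_out t <> (loc new_chart r.2).1.1.
  move=> nt rL; have [v v'] := side _ rL.
  split=> e; [move: nt | move: (placed_out pl nt).1]; by rewrite e loc_region.
case=> [t i j nt ji|p pL]; case=> [t' i' j' nt' ji'|r rL].
- split=> [[-> ->] //|[e]]; rewrite !perm1 => ->; congr pair.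
  by rewrite -(placed_out pl nt).2 e (placed_out pl nt').2.
- by have [a b] := apart _ _ nt rL; split=> [[e _]|[e _]]; [case: (a e) | case: (b e)].
- by have [a b] := apart _ _ nt' pL; split=> [[e _]|[e _]]; [case: (a (esym e)) | case: (b (esym e))].
- have [vp vp'] := side _ pL; have [vr vr'] := side _ rL.
  apply: iff_trans (face _ _ _ _ _ cS vp vr) _; apply: iff_trans _ (iff_sym (face _ _ _ _ _ (placed_tgt pl) vp' vr')).
  by have := fm _ _ pL rL => e; split=> /eqP h; apply/eqP; rewrite ?e // -e.
Qed.

Lemma perform : exists m (T' : triangulation m) c' h h' s, step L c c' h h' s T T'.
Proof.
have pl := perform_placed.
have [srcc srcs tgtc tgtu [tgts tgtf tgtd tgtn]] : [/\
  (forall x, valid (src L) x -> (x \in map fst (src_glue L)) (+) (x \in map fst (shared L))),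
  (forall p, p \in src_glue L -> p.2 \in map fst (src_glue L)),
  (forall x, valid (tgt L) x -> (x \in map fst (tgt_glue L)) (+) (x \in map snd (shared L))),
  uniq (map fst (tgt_glue L)) &
  [/\ forall p, p \in tgt_glue L -> (p.2, p.1) \in tgt_glue L,
     faces_match (tgt_glue L), forall p, p \in tgt_glue L -> p.1.1 != p.2.1
     & forall p r, p \in tgt_glue L -> r \in shared L -> p.1.1 != r.2.1]].
  case/and5P: perfL => _ _ _ _ /and5P[/allP a /allP b /allP d e /and5P[/allP f g /allP h /allP l _]].
  split=> // [x vx|x vx|]; [apply: a | apply: d | split=> // p r /l /allP]; last exact.
    exact: mem_all_corners.
  exact: mem_all_corners.
have Poff x y : P x y -> (x.2 != x.1.2) /\ (y.2 != y.1.2).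
  case=> [t i j nt ji|p pL] /=; first by rewrite !perm1.
  have [v v'] := wf_shared wfL pL.
  by split; [apply: corner_neq cS v | apply: corner_neq (placed_tgt pl) v'].
have Pglue x y : P x y -> exists z, P (glue T x) z.
  move=> xy; have [xo _] := Poff _ _ xy.
  have : (glue T x).2 != (glue T x).1.2.
    by case: x xo {xy} => [[t i] j] /= ji; rewrite (inj_eq perm_inj).
  case E: (glue T x) => [[t i] j] /= ji.
  have [/mapP[k kS tE]|nt] := boolP (t \in region (src L) c); last first.
    by eexists; exact: PersistsOutside.
  have [i0 i04 iE] := chart_vertex i cS kS.
  have [j0 j04 jE] := chart_vertex j cS kS.
  have v : valid (src L) (k, i0, j0).
    by apply/and4P; split=> //=; apply: contra ji => /eqP e; rewrite iE jE e.
  have e : (t, i, j) = loc c (k, i0, j0) by rewrite /loc /= tE iE jE.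
  (* If the image corner lay on an inner face of the source, so would its partner [x], contradicting
     that [x] survives. *)
  have := srcc _ v; have [/mapP[p pL pE] /= H|_ /= /mapP[p pL pE]] := boolP (_ \in map fst (src_glue L)).
    have xE : x = loc c p.2.
      by rewrite -(cG pL) -[p.1]/(fst p) -pE -e -E glueK.
    have [_ v2] := wf_src_glue wfL pL.
    have := srcc _ v2; rewrite (srcs _ pL) /= => /negP []; apply/mapP.
    case: xy xE => [t' i' j' nt' _ [tE' _ _]|r rL].
      move: nt'; rewrite tE' -[c.1 _]/(loc c p.2).1.1 loc_region //.
    have [vr _] := wf_shared wfL rL.
    by move=> /(loc_inj cS vr v2) <-; exists r.
  by rewrite e pE; eexists; exact: PersistsShared.
(* The new gluing is the table inside the new piece, and the old gluing transported through [P]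
   elsewhere. *)
pose K y z := (exists2 p, p \in tgt_glue L & y = loc new_chart p.1 /\ z = loc new_chart p.2) \/
  (exists2 x, P x y & P (glue T x) z).
have tgt_shared p r : p \in tgt_glue L -> r \in shared L -> loc new_chart p.1 = loc new_chart r.2 -> False.
  move=> pL rL; have [v _] := wf_tgt_glue wfL pL; have [_ v'] := wf_shared wfL rL.
  move/(loc_inj (placed_tgt pl) v v') => e; have := tgtc _ v.
  have -> : p.1 \in map fst (tgt_glue L) by exact: map_f.
  by rewrite e /= => /negP []; exact: (map_f snd).
have tgt_P p x : p \in tgt_glue L -> P x (loc new_chart p.1) -> False.
  move=> pL; move E: (loc _ _) => y xy; case: xy E => [t i j nt _ e|r rL]; last exact: tgt_shared.
  have [v _] := wf_tgt_glue wfL pL.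
  have := (placed_out pl nt).1; rewrite -[new_out t]/(new_out t, (1%g : 'S_4) i, (1%g : 'S_4) j).1.1 -e.
  by rewrite loc_region.
have face_inj x y : valid (tgt L) x -> valid (tgt L) y ->
    (loc new_chart x).1 = (loc new_chart y).1 -> x.1 = y.1.
  case/and4P => vS v4 _ _; case/and4P => vS' v4' _ _ [].
  move=> /(placed_tgt pl).1 -/(_ vS vS') e1 /(congr1 val); rewrite /= !inordK // => e2.
  by rewrite [LHS]surjective_pairing e1 e2 -surjective_pairing.
have tgt_P_face p x y : p \in tgt_glue L -> P x y -> (loc new_chart p.1).1 = y.1 -> False.
  move=> pL; have [v _] := wf_tgt_glue wfL pL; case=> [t i j nt _ e|r rL].
    have e' : (loc new_chart p.1).1.1 = new_out t by rewrite e.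
    by have := (placed_out pl nt).1; rewrite -e' loc_region.
  have [_ v'] := wf_shared wfL rL.
  by move/(face_inj _ _ v v') => e; have := tgtn _ _ pL rL; rewrite e eqxx.
have tgt_inj p r : p \in tgt_glue L -> r \in tgt_glue L -> loc new_chart p.1 = loc new_chart r.1 -> p = r.
  move=> pL rL; have [v _] := wf_tgt_glue wfL pL; have [v' _] := wf_tgt_glue wfL rL.
  by move/(loc_inj (placed_tgt pl) v v'); exact: (uniq_map_inj tgtu).
have K_sym y z : K y z -> K z y.
  case=> [[p pL [-> ->]]|[x xy xz]]; first by left; exists (p.2, p.1) => //; exact: tgts.
  by right; exists (glue T x); rewrite ?glueK.
have [T' hT'] : exists T' : triangulation new_size,
    forall y z, y.2 != y.1.2 -> K y z -> glue T' y = z.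
  apply: triangulation_of_relation => //.
  - move=> t i j ji.
    have [tR|nt] := boolP (t \in region (tgt L) new_chart); last first.
      have [nt' e] := placed_out' pl nt.
      have : P (old_out t, i, j) (t, i, j).
        have := @PersistsOutside L _ _ c new_chart new_out (fun=> 1%g) _ i j nt' ji.
        by rewrite !perm1 e.
      move=> xy; have [z hz] := Pglue _ _ xy; exists z; right; by exists (old_out t, i, j).
    case/mapP: tR => k kS tE.
    have v : valid (tgt L) (k, val i, val j).
      by apply/and4P; split=> //=; apply: contra ji => /eqP/val_inj ->.
    have e : (t, i, j) = loc new_chart (k, val i, val j) by rewrite /loc /= !inord_val tE.
    have := tgtc _ v; have [/mapP[p pL pE] _|_ /= /mapP[p pL pE]] := boolP (_ \in map fst (tgt_glue L)).
      by exists (loc new_chart p.2); left; exists p; rewrite // e pE.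
    have xy : P (loc c p.1) (t, i, j) by rewrite e pE; exact: PersistsShared.
    by have [z hz] := Pglue _ _ xy; exists z; right; exists (loc c p.1).
  - move=> y z z' [[p pL [yE ->]]|[x xy xz]] [[r rL [yE' ->]]|[x' xy' xz']].
    + by rewrite (tgt_inj p r) // -yE.
    + by case: (tgt_P _ _ pL (_ : P x' _)); rewrite -yE.
    + by case: (tgt_P _ _ rL (_ : P x _)); rewrite -yE'.
    + have xx' : x = x' := persists_inj wfL pl xy xy'.
      subst x'; exact: (persists_fun wfL pl xz xz').
  - move=> y z [[p pL [_ ->]]|[x _ /Poff []] //].
    by have [_ v] := wf_tgt_glue wfL pL; exact: corner_neq (placed_tgt pl) v.
  - move=> y z y' z' [[p pL [-> ->]]|[x xy xz]] [[r rL [-> ->]]|[x' xy' xz']] e.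
    + have [v _] := wf_tgt_glue wfL pL; have [v' _] := wf_tgt_glue wfL rL.
      have {}e : p.1.1 = r.1.1 by exact: face_inj.
      have /allP/(_ r rL)/eqP := allP tgtf p pL; rewrite e eqxx => /esym/eqP e2.
      by rewrite /loc /= e2.
    + by case: (tgt_P_face _ _ _ pL xy').
    + by case: (tgt_P_face _ _ _ rL xy).
    + have xx' : x.1 = x'.1 by apply/(persists_face xy xy').
      apply/(persists_face xz xz').
      by case: x x' xx' {xy xy' xz xz'} => [[t i] j] [[t' i'] j'] /= [-> ->].
  - move=> y z [[p pL [-> ->]]|[x xy xz]] e.
    + have [v v'] := wf_tgt_glue wfL pL; have /eqP := tgtd _ pL; apply.
      by apply/esym/face_inj.
    + have /(persists_face xz xy) : z.1 = y.1 by [].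
      by case: x {xy xz} => [[t i] j] /=; exact: gluing_distinct.
exists new_size, T', new_chart, new_out, old_out, (fun=> 1%g); split=> //.
- move=> p pL; apply: hT'; last by left; exists p.
  by have [v _] := wf_tgt_glue wfL pL; exact: corner_neq (placed_tgt pl) v.
- move=> x y xy; have [z hz] := Pglue _ _ xy.
  rewrite (hT' y z) //; first by have [] := Poff _ _ xy.
  by right; exists x.
Qed.

End Perform.

(** * The overlaps of two bipyramids *)

Definition template23 : template := replacement bipyramid2 bipyramid3.
Definition template32 : template := replacement bipyramid3 bipyramid2.

Definition permutations4 : seq (seq nat) := permutations (iota 0 4).

(* The image of the tetrahedron k determined by the images of the three corners
   of one of its faces; [::] signals failure. *)
Definition read_off (G : seq (corner * option corner)) : nat * seq nat :=
  if G is [:: (x, Some x'); (y, Some y'); (z, Some z')] then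
    (x'.1.1, [seq if j == x.1.2 then x'.1.2 else if j == x.2 then x'.2
                  else if j == y.2 then y'.2 else z'.2 | j <- iota 0 4])
  else (0, [::]).

(* The guesses need no correctness proof, since [recognize] checks them. *)
Section Recognition.
Variable L : template.

(** The tables list faces in blocks of three corners, so [take 3] selects one face between [k] and
    an earlier tetrahedron; its image determines that of [k]. *)
Definition extend_src (M : template) (f : seq (nat * seq nat)) (k : nat) :=
  rcons f (read_off [seq (g.2, lookup (src_glue L) (rename (nth (0, [::]) f) g.1))
    | g <- take 3 [seq g <- src_glue M | (g.1.1.1 < k) && (g.2.1.1 == k)]]).

Definition guess_src (M : template) (e : nat * seq nat) : seq (nat * seq nat) :=
  foldl (extend_src M) [:: e] (behead (src M)).

Definition guess_tgt (M : template) (f : seq (nat * seq nat)) : seq (nat * seq nat) :=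
  [seq read_off [seq (q.2, lookup (shared L) (rename (nth (0, [::]) f) q.1))
     | q <- take 3 [seq q <- shared M | q.2.1.1 == k]] | k <- tgt M].

Definition successful (f : seq (nat * seq nat)) : bool := all (fun e => ~~ nilp e.2) f.

(** Only the image of the first tetrahedron of [M] is searched for; the inner faces propagate it to
    the others. *)
Definition recognizes (M : template) : bool :=
  some_in (fun r => some_in (fun p => let f := guess_src M (r, p) in
    if successful f then let f' := guess_tgt M f in
      if successful f' then recognize L M (nth (0, [::]) f) (nth (0, [::]) f') [::]
      else false
    else false) permutations4) (src L).

Definition guess_match (r0 : nat) (e : nat * seq nat) (r : nat) : nat * seq nat :=
  read_off [seq (g.2, lookup (tgt_glue L) (rename (fun=> e) g.1))
    | g <- take 3 [seq g <- src_glue L | (g.1.1.1 == r0) && (g.2.1.1 == r)]].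

Definition recognizes_identity : bool :=
  if src L is r0 :: rs then
    some_in (fun r => some_in (fun p => let f := [seq guess_match r0 (r, p) r' | r' <- rs] in
      if successful f then
        recognize L empty_template (fun=> (0, [::])) (fun=> (0, [::])) (zip (src L) ((r, p) :: f))
      else false) permutations4) (tgt L)
  else false.

End Recognition.

(** In the link of vertex [k], the triangle [i j l] has its side opposite [i] glued to its side
    opposite [j] by [j -> l], [l -> i]: a Moebius band. Together with the face numbers, [i -> j],
    the gluing is a 3-cycle. *)
Definition moebius_corner (S : seq nat) (G : seq (corner * corner)) : bool :=
  some_in (fun r => some_in (fun p =>
    let: (i, j, l, k) := (nth 0 p 0, nth 0 p 1, nth 0 p 2, nth 0 p 3) in
    if lookup G (r, i, k) is Some x then if same_corner x (r, j, k) then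
    if lookup G (r, i, j) is Some y then if same_corner y (r, j, l) then
    if lookup G (r, i, l) is Some z then same_corner z (r, j, i)
    else false else false else false else false else false) permutations4) S.

Definition distinct_entries (x y : option (nat * seq nat)) : bool :=
  if x is Some p then if y is Some q then p.1 != q.1 else true else true.

(* The compatibility of the last entry of C with the previous ones. *)
Definition consistent (C : configuration) : bool :=
  if pairwise distinct_entries C then
    all (fun p => if maxn p.1.1.1 p.2.1.1 == (size C).-1 then
        if transport C p.1 is Some z then
          if lookup (tgt_glue template23) z is Some y then
            if transport C p.2 is Some y' then same_corner y' y else false
          else true
        else true
      else true) (src_glue template32)
  else false.

(** The count is the number of tetrahedra of the second bipyramid outside the first, so the
    composite replaces two more tetrahedra than that. For four of them [octahedron_y] is enough: a
    rotation about the axis [x x'] exchanges the other two axes, and the search covers all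
    labellings. *)
Definition resolved (C : configuration) : bool :=
  let L := compose C template23 template32 in
  if wf L then match count (fun x => ~~ isSome x) C with
  | 3 => true
  | 2 => recognizes L (replacement octahedron_x octahedron_y)
  | 1 => if moebius_corner (src L) (src_glue L) then true else
         if moebius_corner (tgt L) (tgt_glue L) then true else
         if recognizes L (replacement pillow_before pillow_after) then true else
         if recognizes L (replacement prismA_before prismA_after) then true else
         recognizes L (replacement prismB_before prismB_after)
  | _ => if moebius_corner (src L) (src_glue L) then true else
         if moebius_corner (tgt L) (tgt_glue L) then true else recognizes_identity L
  end else false.

Definition entries : seq (option (nat * seq nat)) :=
  None :: [seq Some (a, p) | a <- iota 0 3, p <- permutations4].


(** An entry has 73 values: [None], or one of three tetrahedra with one of 24 vertex orders. Testing
    [consistent] after every choice prunes the search for triples. *)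
Lemma all_resolved :
  all (fun x => if consistent [:: x] then
    all (fun y => if consistent [:: x; y] then
      all (fun z => if consistent [:: x; y; z] then resolved [:: x; y; z] else true) entries
    else true) entries else true) entries.
Proof. by vm_compute. Qed.

Lemma template23_wf : wf template23. Proof. by vm_compute. Qed.

Lemma template32_wf : wf template32. Proof. by vm_compute. Qed.

Lemma mem_permutations4 p : (p \in permutations4) = perm4 p.
Proof. by rewrite mem_permutations. Qed.

(** * Reading the overlap off two charts *)

Section ReadConfiguration.
Variables (n : nat) (c1 c2 : chart n) (T : triangulation n).
Hypothesis cS1 : charts (iota 0 3) c1.
Hypothesis cS2 : charts (iota 0 3) c2.
Hypothesis cG1 : realizes (tgt_glue template23) c1 T.
Hypothesis cG2 : realizes (src_glue template32) c2 T.

Definition entry (k : nat) : option (nat * seq nat) :=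
  if c2.1 k \in region (iota 0 3) c1 then
    let a := index (c2.1 k) (region (iota 0 3) c1) in
    Some (a, [seq index (c2.2 k j) [seq c1.2 a i | i <- iota 0 4] | j <- iota 0 4])
  else None.

Lemma vertex_onto (c : chart n) k v : charts (iota 0 3) c -> k \in iota 0 3 ->
  v \in [seq c.2 k i | i <- iota 0 4].
Proof.
move=> cS kS; have [j j4 ->] := chart_vertex v cS kS.
by apply: map_f; rewrite mem_iota.
Qed.

Lemma nth_region a : a < 3 -> nth (c1.1 0) (region (iota 0 3) c1) a = c1.1 a.
Proof. by move=> a3; rewrite (nth_map 0) ?size_iota // nth_iota. Qed.

Lemma entryP k : k \in iota 0 3 ->
  if entry k is Some (a, p) then
    [/\ a \in iota 0 3, c2.1 k = c1.1 a, perm4 p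
      & forall j, j < 4 -> nth 0 p j < 4 /\ c2.2 k j = c1.2 a (nth 0 p j)]
  else c2.1 k \notin region (iota 0 3) c1.
Proof.
move=> kS; rewrite /entry; case: ifP => [kR|/negbT //].
set a := index _ _; have a3 : a < 3 by rewrite -[3](size_map c1.1 (iota 0 3)) index_mem.
have aS : a \in iota 0 3 by rewrite mem_iota.
have nthE j : j < 4 -> nth 0 [seq index (c2.2 k j0) [seq c1.2 a i | i <- iota 0 4] | j0 <- iota 0 4] j =
    index (c2.2 k j) [seq c1.2 a i | i <- iota 0 4].
  by move=> j4; rewrite (nth_map 0) ?size_iota // nth_iota.
have lt4 j : index (c2.2 k j) [seq c1.2 a i | i <- iota 0 4] < 4.
  by rewrite -[X in _ < X](size_map (c1.2 a) (iota 0 4)) index_mem vertex_onto.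
have vE j : c2.2 k j = c1.2 a (index (c2.2 k j) [seq c1.2 a i | i <- iota 0 4]).
  rewrite -[LHS](nth_index (c1.2 a 0) (vertex_onto (c2.2 k j) cS1 aS)).
  by rewrite (nth_map 0) ?size_iota // nth_iota.
split=> //.
- by rewrite -nth_region // nth_index.
- rewrite /perm4 perm_sym; apply: uniq_perm; rewrite ?iota_uniq //.
    rewrite map_inj_in_uniq ?iota_uniq // => i j; rewrite !mem_iota => i4 j4 e.
    by apply: (cS2.2 k kS) => //; rewrite vE e -vE.
  apply: fsym; apply: (uniq_min_size _ _ _).2; rewrite ?iota_uniq ?size_map //.
    rewrite map_inj_in_uniq ?iota_uniq // => i j; rewrite !mem_iota => i4 j4 e.
    by apply: (cS2.2 k kS) => //; rewrite vE e -vE.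
  by move=> _ /mapP[j _ ->]; rewrite mem_iota lt4.
- by move=> j j4; rewrite nthE.
Qed.

Lemma entry_in k : k \in iota 0 3 -> entry k \in entries.
Proof.
move=> kS; have := entryP kS; case: (entry k) => [[a p] [aS _ pp _]|_]; last exact: mem_head.
rewrite inE; apply/orP; right; apply/allpairsP; exists (a, p).
by rewrite mem_permutations4.
Qed.

Lemma transport_read m x y : m <= 3 -> x.1.1 < m -> valid (iota 0 3) x ->
  loc c2 x = loc c1 y -> valid (iota 0 3) y ->
  transport (mkseq entry m) x = Some y.
Proof.
case: x y => [[k i] j] [[b i'] j'] /= m3 km /and4P[/= kS i4 j4 _] [e1 e2 e3] /and4P[/= bS i4' j4' _].
rewrite /transport /at_ nth_mkseq //=; have := entryP kS.
case: (entry k) => [[a p] [aS ea pp ep]|]; last first.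
  by rewrite e1 => /negP[]; exact: map_f.
have ab : a = b by apply: cS1.1 => //; rewrite -ea.
subst b; have [pi ei] := ep i i4; have [pj ej] := ep j j4.
have -> : nth 0 p i = i' by apply: (cS1.2 a aS) => //; rewrite -ei.
by have -> : nth 0 p j = j' by apply: (cS1.2 a aS) => //; rewrite -ej.
Qed.

Lemma transport_read_loc m x z : m <= 3 -> valid (iota 0 3) x ->
  transport (mkseq entry m) x = Some z -> x.1.1 < m -> loc c2 x = loc c1 z.
Proof.
case: x => [[k i] j] /= m3 /and4P[/= kS i4 j4 _] + km.
rewrite /transport /at_ nth_mkseq //=; have := entryP kS.
case: (entry k) => [[a p] [aS ea pp ep]|//] [<-].
by rewrite /loc /= ea (ep i i4).2 (ep j j4).2.
Qed.

(** Equal tetrahedra in two entries would contradict injectivity of [c2]; and where both tables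
    describe the gluing at a corner, they describe the same [glue T]. *)
Lemma consistent_read m : m <= 3 -> consistent (mkseq entry m).
Proof.
move=> m3; rewrite /consistent ifT; last first.
  apply/(pairwiseP None) => i j; rewrite !inE size_mkseq => im jm ij.
  rewrite !nth_mkseq // /distinct_entries.
  have iS : i \in iota 0 3 by rewrite mem_iota (leq_trans im).
  have jS : j \in iota 0 3 by rewrite mem_iota (leq_trans jm).
  have := entryP iS; have := entryP jS.
  case: (entry i) (entry j) => [[a p]|] [[b q]|] //= [_ eb _ _] [_ ea _ _].
  apply/eqP => ab; have e : c2.1 i = c2.1 j by rewrite ea eb ab.
  by rewrite (cS2.1 i j iS jS e) ltnn in ij.
apply/allP => p pG; rewrite size_mkseq; case: eqP => // pm.
case E: (transport _ p.1) => [z|//]; case Ey: (lookup _ z) => [y|//].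
have [v1 v2] := wf_src_glue template32_wf pG.
have [vz vy] := wf_tgt_glue template23_wf (lookup_mem Ey).
have m0 : 0 < m.
  by case: (m) E => //; rewrite /transport /at_ nth_nil.
have pm1 : p.1.1.1 < m by rewrite -(prednK m0) ltnS -pm leq_maxl.
have pm2 : p.2.1.1 < m by rewrite -(prednK m0) ltnS -pm leq_maxr.
have e : loc c2 p.2 = loc c1 y.
  rewrite -(cG2 pG) (transport_read_loc m3 v1 E pm1).
  exact: (cG1 (lookup_mem Ey)).
by rewrite (transport_read m3 pm2 v2 e vy); case: same_cornerP.
Qed.

Lemma compatible_read : compatible (mkseq entry 3) template23 template32 c1 c2.
Proof.
move=> k kS; have k3 : k < 3 by move: kS; rewrite mem_iota.
rewrite /at_ nth_mkseq //; have := entryP kS.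
by case: (entry k) => [[a p] [aS ea _ ep]|].
Qed.

Lemma resolved_read : resolved (mkseq entry 3).
Proof.
have e0 : entry 0 \in entries by apply: entry_in.
have e1 : entry 1 \in entries by apply: entry_in.
have e2 : entry 2 \in entries by apply: entry_in.
have c1_ok : consistent [:: entry 0] := @consistent_read 1 isT.
have c2_ok : consistent [:: entry 0; entry 1] := @consistent_read 2 isT.
have c3_ok : consistent [:: entry 0; entry 1; entry 2] := @consistent_read 3 isT.
have := allP all_resolved _ e0; rewrite c1_ok => /allP /(_ _ e1); rewrite c2_ok.
by move=> /allP /(_ _ e2); rewrite c3_ok.
Qed.

End ReadConfiguration.

Lemma recognizes_replaces P Q L n m (T : triangulation n) (T' : triangulation m) c c' h h' s :
  well_formed P -> well_formed Q -> wf L -> step L c c' h h' s T T' ->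
  recognizes L (replacement P Q) -> replaces P Q T T'.
Proof.
move=> wP wQ wL st /some_inP [r _] /some_inP [p _]; cbv beta zeta.
case: ifP => // _; case: ifP => // _ /(recognize_step wL st) [g [g' [s' st']]].
exact: (step_replaces wP wQ st').
Qed.

Lemma recognizes_isomorphic L n m (T : triangulation n) (T' : triangulation m) c c' h h' s :
  wf L -> step L c c' h h' s T T' -> recognizes_identity L -> isomorphic T T'.
Proof.
move=> wL st; rewrite /recognizes_identity; case: (src L) => [//|r0 rs].
case/some_inP => r _ /some_inP [p _]; cbv beta zeta; case: ifP => // _ /(recognize_step wL st) [g [g' [s' st']]].
exact: step_isomorphic st'.
Qed.

Lemma moebius_cornerP S G n (T : triangulation n) (c : chart n) :
  charts S c -> realizes G c T -> moebius_corner S G ->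
  exists t i j l k, [/\ uniq [:: i; j; l; k], glue T (t, i, k) = (t, j, k),
    glue T (t, i, j) = (t, j, l) & glue T (t, i, l) = (t, j, i)].
Proof.
move=> [_ vI] g /some_inP [r rS] /some_inP [p]; rewrite mem_permutations4 => p4.
case E1: lookup => [x|//]; case: same_cornerP => // xE.
case E2: lookup => [y|//]; case: same_cornerP => // yE.
case E3: lookup => [z|//] /same_cornerP zE.
move: (g _ (lookup_mem E1)) (g _ (lookup_mem E2)) (g _ (lookup_mem E3)).
rewrite xE yE zE /loc /= => g1 g2 g3.
exists (c.1 r), (c.2 r (nth 0 p 0)), (c.2 r (nth 0 p 1)), (c.2 r (nth 0 p 2)), (c.2 r (nth 0 p 3)).
split=> //.
change (uniq (map (fun j => c.2 r (nth 0 p j)) (iota 0 4))).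
rewrite map_inj_in_uniq ?iota_uniq // => i j; rewrite !mem_iota => i4 j4.
by move=> /(vI r rS) e; apply: (perm4_inj p4) => //; apply: e; exact: perm4_lt.
Qed.

(** * Disjoint bipyramids: the moves commute *)

Lemma template32_performable : performable template32. Proof. by vm_compute. Qed.

Definition disjoint_configuration : configuration := [:: None; None; None].

Definition disjoint_step : template := compose disjoint_configuration template23 template32.

(* Undoing the move at the second bipyramid brings back its two tetrahedra, with
   numbers 0 and 2; those of the first bipyramid are 1 and 5 before the move, and
   2, 6 and 10 after it. *)
Definition commuted_configuration : configuration :=
  [:: None; Some (0, iota 0 4); None; Some (1, iota 0 4); None; Some (2, iota 0 4)].

Definition commuted_step : template :=
  compose commuted_configuration (reverse template32) disjoint_step.

(** Composition doubles the numbers in [tgt disjoint_step]: [k.*2.+1] becomes [4 * k + 2] on the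
    first bipyramid, and the tetrahedra 0 and 2 of the second, merely renamed here, become 0 and
    4. *)
Lemma commuted_step_recognized :
  recognize commuted_step template23 (nth (0, [::]) [:: (1, iota 0 4); (5, iota 0 4)])
    (fun k => (4 * k + 2, iota 0 4)) [:: (0, (0, iota 0 4)); (2, (4, iota 0 4))].
Proof. by vm_compute. Qed.

Lemma reverse_template32_wf : wf (reverse template32). Proof. by vm_compute. Qed.

Lemma disjoint_step_wf : wf disjoint_step. Proof. by vm_compute. Qed.

Lemma commuted_step_wf : wf commuted_step. Proof. by vm_compute. Qed.

Lemma even_neq_odd a b : a \in [:: 0; 2] -> a <> b.*2.+1.
Proof.
by rewrite !inE => /orP[] /eqP -> /(congr1 odd); rewrite /= odd_double.
Qed.

(** The second bipyramid is already present in [T], so its 3-2 move can be performed there, giving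
    [T2]. Undoing that move and then doing both is a step from [T2] to [T'], recognized as a 2-3
    move. *)
Lemma disjoint_moves_commute n n' (T : triangulation n) (T' : triangulation n') c c' h h' s :
  step disjoint_step c c' h h' s T T' ->
  exists (m : nat) (T2 : triangulation m), move32 T T2 /\ move23 T2 T'.
Proof.
move=> st.
(* The second bipyramid, untouched by the first move, has the odd numbers 1, 3, 5 in
   [src disjoint_step]. *)
pose c3 : chart n := (fun k => c.1 k.*2.+1, fun k j => c.2 k.*2.+1 j).
have odd_src k : k \in iota 0 3 -> k.*2.+1 \in src disjoint_step.
  by rewrite mem_iota; case: k => [|[|[|]]].
have cS : charts (src template32) c3.
  split=> [k k' kS kS' /(step_src st).1|k kS i j i4 j4].
    by move=> e; apply: double_inj; apply: succn_inj; apply: e; exact: odd_src.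
  exact: ((step_src st).2 _ (odd_src _ kS)).
have cG : realizes (src_glue template32) c3 T.
  have sub : all (fun p => (odd_corner p.1, odd_corner p.2) \in src_glue disjoint_step)
    (src_glue template32) by vm_compute.
  by move=> p /(allP sub) /(step_src_glue st).
have [m [T2 [c2 [k [k' [r st2]]]]]] := perform template32_performable cS cG.
exists m, T2; split; first exact: step_replaces st2.
have cpt : compatible commuted_configuration (reverse template32) disjoint_step c3 c.
  have even_out a : a \in [:: 0; 2] -> c.1 a \notin region (iota 0 3) c3.
    move=> aS; apply/negP => /mapP[b bS] /((step_src st).1) e.
    apply: (even_neq_odd (b := b) aS); apply: e; last exact: odd_src.
    by move: aS; rewrite !inE => /orP[] /eqP ->.
  have moved a b : b \in iota 0 3 -> a = b.*2.+1 ->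
      [/\ b \in iota 0 3, c.1 a = c3.1 b & forall j, j < 4 ->
         nth 0 (iota 0 4) j < 4 /\ c.2 a j = c3.2 b (nth 0 (iota 0 4) j)].
    by move=> bS ->; split=> // j j4; rewrite nth_iota.
  have srcE : src disjoint_step = [:: 0; 2; 1; 3; 5] by vm_compute.
  move=> a aS; have : [|| a == 0, a == 2, a == 1 | (a == 3) || (a == 5)].
    by move: aS; rewrite srcE !inE.
  case/or4P => [/eqP ->|/eqP ->|/eqP ->|/orP[] /eqP ->].
  - exact: (even_out 0 isT).
  - exact: (even_out 2 isT).
  - exact: (moved 1 0 isT erefl).
  - exact: (moved 3 1 isT erefl).
  - exact: (moved 5 2 isT erefl).
have st3 := step_compose reverse_template32_wf disjoint_step_wf (step_reverse st2) st cpt.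
have [g [g' [s' st4]]] := recognize_step commuted_step_wf st3 commuted_step_recognized.
exact: step_replaces st4.
Qed.

Lemma count_None3 (x y z : option (nat * seq nat)) :
  count (fun x => ~~ isSome x) [:: x; y; z] = 3 -> [:: x; y; z] = disjoint_configuration.
Proof. by case: x y z => [?|] [?|] [?|]. Qed.

(** * Moebius corners *)

From mathcomp Require Import all_order all_algebra all_classical all_analysis lra.
From Stdlib Require Relation_Operators.
Require Import Defs.
Import Order.TTheory GRing.Theory Num.Theory.
Import numFieldNormedType.Exports.

Section Topology.
Local Open Scope ring_scope.

(** * Charts of the realization, read on the disjoint tetrahedra *)

Section Chart.
Variables (R : realType) (n : nat) (T : triangulation n).
Local Open Scope ring_scope.
Local Open Scope classical_set_scope.
Local Notation D := (disjoint_tetrahedra R n).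

Definition bary (x : D) (i : 'I_4) : R := \val (tagged x) ord0 i.

Definition tet_close (d : R) (x y : D) : Prop :=
  tag y = tag x /\ forall i, `|bary x i - bary y i| < d.

Definition tet_open (O : D -> Prop) : Prop :=
  forall x, O x -> exists2 d, 0 < d & forall y, tet_close d x y -> O y.

Definition saturated (O : D -> Prop) : Prop :=
  forall x y, same_point T x y -> O x -> O y.

Lemma nbhs_close (x : D) (O : set D) :
  nbhs x O <-> exists2 d, 0 < d & forall y, tet_close d x y -> O y.
Proof.
case: x => t [w hw]; split.
  rewrite /nbhs /= sigT_nbhsE /= nbhs_simpl /= => -[_ [[W oW <-] /= Ww sub]].
  have : nbhs (w : 'rV[R]_4) W by apply: open_nbhs_nbhs; split.
  move=> /nbhs_ballP [d /= d0 bd]; exists d => // -[t' [w' hw']] [/= tt' cl].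
  subst t'; apply: (sub (exist _ w' hw')); apply: bd.
  by split=> // i j; rewrite !(ord1 i); exact: cl.
move=> [d d0 sub]; rewrite /nbhs /= sigT_nbhsE /= nbhs_simpl /=.
exists (set_val @^-1` (ball (w : 'rV[R]_4) d)°); split=> /=.
- by exists ((ball (w : 'rV[R]_4) d)°) => //; exact: open_interior.
- by apply: nbhsx_ballx.
- move=> [w' hw'] /= /interior_subset [_ bw]; apply: sub; split=> //= i.
  exact: bw.
Qed.

(** The quotient topology is dealt with here once and for all: later arguments see only a map [F] on
    the disjoint tetrahedra, constant and injective on classes, continuous, and open on saturated
    open sets. *)
Lemma local_chart (x0 : D) : manifold_triangulation R T ->
  exists (DU : D -> Prop) (F : D -> 'rV[R]_3),
  [/\ DU x0,
      forall x y, same_point T x y -> DU x -> DU y /\ F x = F y,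
      forall x y, DU x -> DU y -> F x = F y -> same_point T x y,
      forall x, DU x -> forall e, 0 < e -> exists2 d, 0 < d &
        forall y, tet_close d x y -> DU y /\ `|F x - F y| < e
    & forall x O, DU x -> O x -> saturated O -> tet_open O ->
        exists2 e, 0 < e & forall z, `|F x - z| < e ->
          exists y, [/\ DU y, O y & F y = z]].
Proof.
case=> _ _ le _ _.
have [U [V [f [g [oU Ux oV [fUV gVU [fK gK] cf cg]]]]]] :=
  le (\pi_(realization R T)%qT x0).
have piE (x y : D) : same_point T x y <->
    \pi_(realization R T)%qT x = \pi_(realization R T)%qT y.
  split=> [xy|xy]; first by apply/eqmodP.
  by move/eqmodP: xy.
have cpi := @pi_continuous D {eq_quot same_point_equiv R T}%qT.
exists (fun x => U (\pi_(realization R T)%qT x)),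
  (fun x => f (\pi_(realization R T)%qT x)); split=> //.
- by move=> x y /piE ->.
- move=> x y Ux' Uy fxy; apply/piE.
  by rewrite -(fK _ (mem_set Ux')) fxy fK ?inE.
- move=> x Ux' e e0.
  have cfx : {for \pi_(realization R T)%qT x, continuous f}.
    by move: cf; rewrite continuous_open_subspace // => /(_ _ (mem_set Ux')).
  have nb : nbhs (\pi_(realization R T)%qT x)
     (U `&` f @^-1` (ball (f (\pi_(realization R T)%qT x)) e)).
    apply: filterI; first by apply: open_nbhs_nbhs.
    by apply: cfx; exact: nbhsx_ballx.
  have /nbhs_close [d d0 sub] := cpi x _ nb.
  exists d => // y /sub [Uy].
  by rewrite /= -ball_normE /ball_.
- move=> x O Ux' Ox sO oO.
  (* By saturation, the preimage under the projection of the second set is [O] itself, hence [P] is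
     open. *)
  pose P : set (realization R T) :=
    U `&` (fun z => exists2 y, O y & \pi_(realization R T)%qT y = z).
  have oP : open P.
    apply: openI => //; rewrite /open/= /quotient_open.
    rewrite openE => y /= [y' Oy' /piE /sO Oy].
    apply/nbhs_close; have [d d0 sub] := oO _ (Oy Oy').
    by exists d => // z /sub Oz; exists z.
  have Vfx : V (f (\pi_(realization R T)%qT x)) by apply: fUV.
  have cgx : {for f (\pi_(realization R T)%qT x), continuous g}.
    by move: cg; rewrite continuous_open_subspace // => /(_ _ (mem_set Vfx)).
  have nb : nbhs (f (\pi_(realization R T)%qT x)) (V `&` g @^-1` P).
    apply: filterI; first by apply: open_nbhs_nbhs.
    apply: cgx; apply: open_nbhs_nbhs; split=> //.
    rewrite fK ?inE //; split=> //.
    by exists x.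
  move: nb => /nbhs_ballP [e /= e0 sub].
  exists e => // z ze; have [] := sub z.
    by rewrite -ball_normE /ball_.
  move=> Vz [Ug [y Oy yz]]; exists y; split=> //; first by rewrite yz.
  by rewrite yz gK ?inE.
Qed.
End Chart.

Lemma positive_lower_bound (R : realType) (I : finType) (p : I -> R) :
  (forall i, 0 < p i) -> exists2 d, 0 < d & forall i, d <= p i.
Proof.
move=> p0; exists (\big[Num.min/1]_i p i); last by move=> i; exact: bigmin_le.
by apply/bigmin_gtP; split.
Qed.

(** Compactness of the interval in usable form: the supremum of the points reachable from [a] is
    reachable, and the local hypothesis there leads beyond it unless it is [b]. *)
Lemma interval_induction (R : realType) (Q : R -> R -> Prop) (a b : R) :
  a <= b ->
  (forall s m t, s <= m <= t -> Q s m -> Q m t -> Q s t) ->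
  (forall s, a <= s <= b -> exists2 e, 0 < e & forall s' t',
     a <= s' -> s - e < s' -> s' <= s <= t' -> t' < s + e -> t' <= b ->
     Q s' t') ->
  Q a b.
Proof.
move=> ab trans loc.
pose A : set R := [set t | a <= t <= b /\ Q a t]%classic.
have Aa : A a.
  split; first by rewrite lexx.
  by have [|e e0] := loc a; [rewrite lexx|apply => //; lra].
have supA : has_sup A.
  by split; [exists a | exists b => t [/andP[]]].
have am : a <= sup A by apply: ub_le_sup => //; case: supA.
have mb : sup A <= b by apply: ge_sup; [exists a | move=> t [/andP[]]].
have [|e e0 Qe] := loc (sup A); first by rewrite am mb.
have [t [/andP[at_ tb] Qat] mt] := sup_adherent e0 supA.
have tm : t <= sup A by apply: ub_le_sup; [case: supA | split => //; rewrite at_].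
pose t' := Num.min b (sup A + e / 2).
have tt' : sup A <= t' by rewrite /t' le_min mb; lra.
have Qat' : Q a t'.
  apply: (trans a t) => //; first by rewrite at_ (le_trans tm).
  apply: Qe => //; first by rewrite tm.
    by rewrite /t' gt_min; apply/orP; right; lra.
  by rewrite /t' ge_min lexx.
have [bs|sb] := leP b (sup A + e / 2); first by rewrite /t' (min_idPl bs) in Qat'.
rewrite /t' (min_idPr (ltW sb)) in Qat'.
have : sup A + e / 2 <= sup A.
  apply: ub_le_sup; first by case: supA.
  split; last exact: Qat'.
  by rewrite (ltW sb) andbT; lra.
lra.
Qed.

(** * Sections of the orientation double cover over subsets of a chart *)

Section Points.
Variables (R : realType) (n : nat) (T : triangulation n).
Local Notation D := (disjoint_tetrahedra R n).

Lemma bary_ge0 (x : D) i : 0 <= bary x i.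
Proof. by case: x => t [w hw]; have [h _] := set_mem hw; exact: h. Qed.

Lemma bary_sum (x : D) : \sum_i bary x i = 1.
Proof. by case: x => t [w hw]; have [_ h] := set_mem hw; exact: h. Qed.

Lemma bary_inj (x y : D) : tag x = tag y -> bary x =1 bary y -> x = y.
Proof.
case: x y => t [w hw] [t' [w' hw']] /= tt'; subst t' => ww'.
congr existT; apply: val_inj => /=.
by apply/rowP => i; exact: ww'.
Qed.

Lemma point_of (t : 'I_n) (w : 'I_4 -> R) : (forall i, 0 <= w i) ->
  \sum_i w i = 1 -> exists x : D, tag x = t /\ bary x =1 w.
Proof.
move=> w0 w1.
have hw : (\row_i w i) \in @std_simplex R.
  apply/mem_set; split; first by move=> i; rewrite mxE.
  by rewrite -w1; apply: eq_bigr => i _; rewrite mxE.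
pose p : set_type (@std_simplex R) := exist (fun z => z \in @std_simplex R) _ hw.
exists (existT (fun=> set_type (@std_simplex R)) t p); split=> // i.
by rewrite /bary /= mxE.
Qed.

Definition glued_at (i : 'I_4) (x y : D) : Prop :=
  [/\ bary x i = 0, tag y = neighbour T (tag x) i
    & forall j, bary y (gluing T (tag x) i j) = bary x j].

Lemma glued_atP x y : glued_points T x y <-> exists i, glued_at i x y.
Proof. by []. Qed.

Lemma glued_at_sym i x y :
  glued_at i x y -> glued_at (gluing T (tag x) i i) y x.
Proof.
case=> x0 tE cE; have [nE gE] := gluing_sym T (tag x) i.
split; first by rewrite cE.
  by rewrite tE nE.
by move=> j; rewrite tE gE -cE permKV.
Qed.

Lemma glued_at_ex i x : bary x i = 0 -> exists y, glued_at i x y.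
Proof.
move=> x0; set g := gluing T (tag x) i.
have [||y [ty cy]] := @point_of (neighbour T (tag x) i)
    (fun j => bary x ((g^-1)%g j)).
- by move=> j; exact: bary_ge0.
- rewrite -(bary_sum x) [RHS](reindex_inj (@perm_inj _ (g^-1)%g)).
  exact: eq_bigr.
- by exists y; split=> // j; rewrite cy permK.
Qed.

(** The converse of a gluing is again a gluing, so steps in one direction reach the whole class. *)
Lemma same_point_ind (P : D -> Prop) (x : D) : P x ->
  (forall i y z, same_point T x y -> P y -> glued_at i y z -> P z) ->
  forall y, same_point T x y -> P y.
Proof.
move=> Px step y /asboolP xy.
pose S z := same_point T x z /\ P z.
suff H a b : Relation_Operators.clos_refl_sym_trans _ (glued_points T) a b ->
    S a <-> S b.
  by have [] : S y; [apply/(H _ _ xy); split=> //; exact: same_point_refl|].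
elim=> {a b} [a b /glued_atP [i ab]|a|a b _ ->|a b d _ -> _ ->] //.
have sab : same_point T a b.
  by apply/asboolP/Relation_Operators.rst_step/glued_atP; exists i.
split=> -[xa Pa]; split.
- exact: same_point_trans xa sab.
- exact: step xa Pa ab.
- by apply: same_point_trans xa _; rewrite same_point_sym.
- exact: step xa Pa (glued_at_sym ab).
Qed.

Lemma glued_at_same i x y : glued_at i x y -> same_point T x y.
Proof.
move=> xy; apply/asboolP/Relation_Operators.rst_step/glued_atP; by exists i.
Qed.

Lemma glued_saturated (O : D -> Prop) :
  (forall i x y, glued_at i x y -> O x -> O y) -> saturated T O.
Proof.
move=> step x y xy Ox; move: y xy; apply: same_point_ind => // i y z _ Oy yz.
exact: step yz Oy.
Qed.

Lemma same_point_bary (x y : D) : same_point T x y ->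
  forall i, exists j, bary y i = bary x j.
Proof.
move: y; apply: same_point_ind => [i|i y z _ IH [_ _ cz] j]; first by exists i.
have [k kE] := IH (((gluing T (tag y) i)^-1)%g j).
by exists k; rewrite -kE -cz permKV.
Qed.

Lemma tet_close_shrink (d : R) (x y : D) : tet_close d x y ->
  exists2 e, 0 < e & forall z, tet_close e y z -> tet_close d x z.
Proof.
case=> txy cxy.
have [|e e0 he] := @positive_lower_bound R _ (fun i : 'I_4 => d - `|bary x i - bary y i|).
  by move=> i; rewrite subr_gt0.
exists e => // z [tyz cyz]; split; first by rewrite tyz.
move=> i; have := he i; have := cyz i.
have := ler_distD (bary y i) (bary x i) (bary z i); lra.
Qed.

(** An odd gluing permutation makes the orientations given by the vertex orders of the two
    tetrahedra agree; an even one makes them disagree. *)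
Definition twist (t : 'I_n) (i : 'I_4) : bool := ~~ odd_perm (gluing T t i).

Variables (DU : D -> Prop) (F : D -> 'rV[R]_3).
Hypothesis DU_same : forall x y, same_point T x y -> DU x -> DU y /\ F x = F y.
Hypothesis F_inj : forall x y, DU x -> DU y -> F x = F y -> same_point T x y.
Hypothesis F_cont : forall x, DU x -> forall e, 0 < e -> exists2 d, 0 < d &
  forall y, tet_close d x y -> DU y /\ `|F x - F y| < e.
Hypothesis F_open : forall x O, DU x -> O x -> saturated T O -> tet_open O ->
  exists2 e, 0 < e & forall z, `|F x - z| < e ->
    exists y, [/\ DU y, O y & F y = z].

Definition lies_over (W : set 'rV[R]_3) (x : D) := DU x /\ W (F x).

(* A section over W of the orientation double cover, pulled back to the
   tetrahedra. *)
Definition orients (W : set 'rV[R]_3) (f : D -> bool) : Prop :=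
  (forall i x y, lies_over W x -> glued_at i x y -> f y = f x (+) twist (tag x) i) /\
  (forall x, lies_over W x -> exists2 d, 0 < d & forall y, tet_close d x y ->
     lies_over W y -> f y = f x).

Definition orientable W := exists f, orients W f.

Definition closedset (W : set 'rV[R]_3) :=
  forall z, ~ W z -> exists2 e, 0 < e & forall z', `|z - z'| < e -> ~ W z'.

(** The working substitute for connectedness of [W]: two sections differ by a single deck
    transformation. *)
Definition rigid W := forall f1 f2, orients W f1 -> orients W f2 ->
  forall x y, lies_over W x -> lies_over W y -> f1 x (+) f2 x = f1 y (+) f2 y.

Lemma lies_over_same W x y : same_point T x y -> lies_over W x -> lies_over W y.
Proof. by move=> xy [Dx Wx]; have [Dy e] := DU_same xy Dx; split=> //; rewrite -e. Qed.

Lemma closedset_near W x : closedset W -> DU x -> ~ W (F x) ->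
  exists2 d, 0 < d & forall y, tet_close d x y -> ~ lies_over W y.
Proof.
move=> cW Dx nW; have [e e0 he] := cW _ nW.
have [d d0 hd] := F_cont Dx e0; exists d => // y /hd [Dy /he nWy] [_ Wy].
exact: nWy.
Qed.

Lemma orients_diff_saturated W f1 f2 b : orients W f1 -> orients W f2 ->
  saturated T (fun y => DU y /\ (W (F y) -> f1 y (+) f2 y = b)).
Proof.
move=> [g1 _] [g2 _]; apply: glued_saturated => i x y xy [Dx hx].
have [Dy Fxy] := DU_same (glued_at_same xy) Dx; split=> // Wy.
have ox : lies_over W x by split=> //; rewrite Fxy.
rewrite (g1 i x y) // (g2 i x y) // -(hx ox.2).
by case: (f1 x) (f2 x) (twist _ _) => [] [] [].
Qed.

(** Both sections change by the same twist, so their difference is constant on classes and locally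
    constant; openness of [F] turns this into a ball in the chart. *)
Lemma orients_diff_locally W f1 f2 x : closedset W ->
  orients W f1 -> orients W f2 -> DU x -> exists b, exists2 e, 0 < e &
  forall y, lies_over W y -> `|F x - F y| < e -> f1 y (+) f2 y = b.
Proof.
move=> cW o1 o2 Dx; pose b := f1 x (+) f2 x.
exists b.
have [|||e e0 he] := @F_open x (fun y => DU y /\ (W (F y) -> f1 y (+) f2 y = b)) Dx.
- by split.
- exact: orients_diff_saturated.
- move=> y [Dy hy]; have [d0 d00 hd0] := F_cont Dy ltr01.
  have [Wy|nWy] := pselect (W (F y)); last first.
    have [d d1 hd] := closedset_near cW Dy nWy.
    exists (Num.min d0 d); first by rewrite lt_min d00.
    move=> z yz; have [|Dz _] := hd0 z.
      by split; [case: yz | move=> i; case: yz => _ /(_ i); rewrite lt_min => /andP[]].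
    split=> // Wz; case: (hd z) => //.
    by split; [case: yz | move=> i; case: yz => _ /(_ i); rewrite lt_min => /andP[]].
  have oy : lies_over W y by split.
  have [d1 d10 hd1] := o1.2 y oy; have [d2 d20 hd2] := o2.2 y oy.
  exists (Num.min d0 (Num.min d1 d2)); first by rewrite !lt_min d00 d10.
  move=> z [tz cz]; have [|Dz _] := hd0 z.
    by split=> // i; have := cz i; rewrite !lt_min => /and3P[].
  split=> // Wz; rewrite hd1 ?hd2 ?hy //; try by split.
    by split=> // i; have := cz i; rewrite !lt_min => /and3P[].
  by split=> // i; have := cz i; rewrite !lt_min => /and3P[].
exists e => // y [Dy Wy] /he [y' [Dy' [_ hy'] Fy]].
have := hy'; rewrite Fy => /(_ Wy) <-.
have [_ h] := @orients_diff_saturated W f1 f2 (f1 y' (+) f2 y') o1 o2 y' y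
   (F_inj Dy' Dy Fy) (conj Dy' (fun=> erefl)).
exact: h.
Qed.

Definition charted (W : set 'rV[R]_3) := forall z, W z -> exists2 x, DU x & F x = z.

Definition convexset (W : set 'rV[R]_3) := forall z z' u, W z -> W z' ->
  0 <= u <= 1 -> W ((1 - u) *: z + u *: z').

(** The difference of two sections is locally constant along the segment from [F x] to [F y], hence
    constant by [interval_induction]. *)
Lemma convex_rigid W : closedset W -> convexset W -> charted W -> rigid W.
Proof.
move=> cW vW sW f1 f2 o1 o2 x y ox oy.
pose p u := (1 - u) *: F x + u *: F y.
pose Q s t := 0 <= s -> t <= 1 -> exists b, forall u w, s <= u <= t -> lies_over W w -> F w = p u ->
  f1 w (+) f2 w = b.
suff [//|//|b hb] : Q 0 1.
  rewrite (hb 0) ?(hb 1) ?lexx ?ler01 //; rewrite /p.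
    by rewrite subrr scale0r scale1r add0r.
  by rewrite subr0 scale0r scale1r addr0.
apply: interval_induction => //.
  - move=> s m t /andP[sm mt] Qsm Qmt s0 t1.
    have [||b hb] := Qsm; [by []|lra|].
    have [||b' hb'] := Qmt; [lra|by []|].
    exists b => u w /andP[su ut] ow wE.
    have [um|mu] := leP u m; first by apply: hb wE => //; rewrite su.
    have Wm : W (p m) by apply: vW; [case: ox|case: oy|apply/andP; split; lra].
    have [v Dv vE] := sW _ Wm.
    rewrite -(hb m v) ?sm ?lexx //; last by rewrite /lies_over vE.
    rewrite (hb' m v) ?mt ?lexx //; last by rewrite /lies_over vE.
    by apply: hb' wE => //; rewrite (ltW mu).
  - move=> s s01.
    have Wp : W (p s) by case: ox oy => _ Wx [_ Wy]; exact: vW.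
    have [v Dv vE] := sW _ Wp.
    have [b [e e0 he]] := orients_diff_locally cW o1 o2 Dv.
    pose N := `|F y - F x| + 1.
    have N0 : 0 < N by rewrite /N ltr_wpDl.
    exists (e / N); first by rewrite divr_gt0.
    move=> s' t' _ ss' /andP[s's st'] t's _ _ _; exists b => u w /andP[s'u ut'] ow wE.
    apply: he => //; rewrite vE wE /p.
    have -> : (1 - s) *: F x + s *: F y - ((1 - u) *: F x + u *: F y)
       = (s - u) *: (F y - F x).
      by rewrite !scalerBl !scalerBr scale1r; apply/rowP => i; rewrite !mxE; lra.
    rewrite normrZ.
    have h1 : `|s - u| < e / N by rewrite ltr_norml; apply/andP; split; lra.
    have h2 : `|s - u| * N < e by rewrite -ltr_pdivlMr.
    apply: le_lt_trans h2; rewrite ler_wpM2l // /N; lra.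
Qed.

Lemma orients_sub (W W' : set 'rV[R]_3) f : (W `<=` W')%classic ->
  orients W' f -> orients W f.
Proof.
move=> sub [g l]; have so x : lies_over W x -> lies_over W' x by case=> ? /sub.
split=> [i x y /so|x /so /l [d d0 hd]]; first exact: g.
by exists d => // y /hd h /so /h.
Qed.

Lemma orientable_sub (W W' : set 'rV[R]_3) : (W `<=` W')%classic ->
  orientable W' -> orientable W.
Proof. by move=> sub [f /(orients_sub sub)]; exists f. Qed.

Lemma closedsetI W W' : closedset W -> closedset W' -> closedset (W `&` W')%classic.
Proof.
move=> cW cW' z nz; have [Wz|/cW [e e0 he]] := pselect (W z); last first.
  by exists e => // z' /he nW [].
have [|e e0 he] := cW' z; first by move=> W'z; apply: nz.
by exists e => // z' /he nW [].
Qed.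

Lemma convexsetI W W' : convexset W -> convexset W' -> convexset (W `&` W')%classic.
Proof. by move=> c c' z z' u [? ?] [? ?] u01; split; [exact: c | exact: c']. Qed.

(** On the rigid overlap the sections differ by one Boolean, and correcting [f2] by it makes them
    agree. Closedness keeps a point outside one of the sets away from that set, so local constancy
    survives. *)
Lemma orientable_glue W1 W2 : closedset W1 -> closedset W2 ->
  orientable W1 -> orientable W2 -> rigid (W1 `&` W2)%classic ->
  orientable (W1 `|` W2)%classic.
Proof.
move=> c1 c2 [f1 o1] [f2 o2] rig.
have [b agree] : exists b, forall y, lies_over (W1 `&` W2)%classic y -> f1 y = f2 y (+) b.
  have [[x ox]|no] := pselect (exists x, lies_over (W1 `&` W2)%classic x); last first.
    by exists false => y oy; case: no; exists y.
  exists (f1 x (+) f2 x) => y oy.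
  have := rig f1 f2 (orients_sub (@subIsetl _ _ _) o1)
    (orients_sub (@subIsetr _ _ _) o2) x y ox oy.
  by move=> ->; rewrite addbC -addbA addbb addbF.
pose f y := if `[< W1 (F y) >] then f1 y else f2 y (+) b.
have fE1 y : lies_over W1 y -> f y = f1 y by case=> _ Wy; rewrite /f asboolT.
have fE2 y : lies_over W2 y -> f y = f2 y (+) b.
  case=> Dy Wy; rewrite /f; case: asboolP => // W1y.
  by apply: agree.
exists f; split=> [i x y [Dx [] Wx] xy|x [Dx Wx]].
- have ox : lies_over W1 x by [].
  by rewrite !fE1 //; [exact: o1.1 ox xy | exact: lies_over_same (glued_at_same xy) ox].
- have ox : lies_over W2 x by [].
  rewrite !fE2 //; last exact: lies_over_same (glued_at_same xy) ox.
  by rewrite (o2.1 _ _ _ ox xy) addbAC.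
have near1 : exists2 d, 0 < d & forall y, tet_close d x y -> lies_over W1 y -> f y = f x.
  have [W1x|/(closedset_near c1 Dx) [d d0 hd]] := pselect (W1 (F x)); last first.
    by exists d => // y /hd.
  have ox : lies_over W1 x by [].
  have [d d0 hd] := o1.2 x ox; exists d => // y /hd h oy.
  by rewrite !fE1 ?h.
have near2 : exists2 d, 0 < d & forall y, tet_close d x y -> lies_over W2 y -> f y = f x.
  have [W2x|/(closedset_near c2 Dx) [d d0 hd]] := pselect (W2 (F x)); last first.
    by exists d => // y /hd.
  have ox : lies_over W2 x by [].
  have [d d0 hd] := o2.2 x ox; exists d => // y /hd h oy.
  by rewrite !fE2 ?h.
have [d d0 hd] := near1; have [d' d'0 hd'] := near2.
exists (Num.min d d'); first by rewrite lt_min d0.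
move=> y [ty cy] [Dy [] Wy]; [apply: hd | apply: hd'] => //.
  by split=> // i; have := cy i; rewrite lt_min => /andP[].
by split=> // i; have := cy i; rewrite lt_min => /andP[].
Qed.

Lemma rigidU W1 W2 x : rigid W1 -> rigid W2 -> lies_over W1 x -> lies_over W2 x ->
  rigid (W1 `|` W2)%classic.
Proof.
move=> r1 r2 o1 o2 f1 f2 h1 h2.
suff H y : lies_over (W1 `|` W2)%classic y -> f1 y (+) f2 y = f1 x (+) f2 x.
  by move=> y z /H -> /H ->.
case=> Dy [] Wy.
  by apply: r1 => //; [move: h1 | move: h2]; apply: orients_sub; exact: subsetUl.
by apply: r2 => //; [move: h1 | move: h2]; apply: orients_sub; exact: subsetUr.
Qed.

(** The norm is the maximum norm: balls are cubes, which gives the shell flat sides. *)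
Lemma row_norm_ltP (w : 'rV[R]_3) (e : R) : 0 < e ->
  `|w| < e <-> forall i, `|w ord0 i| < e.
Proof.
move=> e0; rewrite -normrN -sub0r; change (ball_ (fun z : 'rV[R]_3 => `|z|) 0 e w <-> forall i, `|w ord0 i| < e).
rewrite ball_normE; split=> [[_ h] i|h].
  by have := h ord0 i; rewrite mxE -ball_normE /ball_ /= sub0r normrN.
by split=> // j i; rewrite (ord1 j) mxE -ball_normE /ball_ /= sub0r normrN.
Qed.

Lemma row_coord_dist (z w : 'rV[R]_3) (e : R) i :
  `|z - w| < e -> `|z ord0 i - w ord0 i| < e.
Proof.
move=> h; have e0 : 0 < e by apply: le_lt_trans h.
by move/(row_norm_ltP _ e0): h => /(_ i); rewrite !mxE.
Qed.

Definition cube (P : pred 'I_3) (z : 'rV[R]_3) (e : R) : set 'rV[R]_3 :=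
  [set w | forall i, P i -> `|w ord0 i - z ord0 i| <= e]%classic.

Lemma closed_cube P z e : closedset (cube P z e).
Proof.
move=> w /existsNP [i /not_implyP [Pi /negP]]; rewrite -ltNge => h.
exists (`|w ord0 i - z ord0 i| - e); first by rewrite subr_gt0.
move=> w' /(row_coord_dist i) h1 /(_ i Pi) h2.
have := ler_distD (w' ord0 i) (w ord0 i) (z ord0 i); lra.
Qed.

Lemma convex_cube P z e : convexset (cube P z e).
Proof.
move=> w w' u hw hw' u01 i Pi; have := hw i Pi; have := hw' i Pi.
rewrite !mxE !ler_norml; move: u01 => /andP[u0 u1] /andP[a b] /andP[c d].
apply/andP; split; nra.
Qed.

Definition halfspace (i : 'I_3) (b : bool) (a : R) : set 'rV[R]_3 :=
  [set w | if b then a <= w ord0 i else w ord0 i <= a]%classic.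

Lemma closed_halfspace i b a : closedset (halfspace i b a).
Proof.
rewrite /halfspace; case: b => z /= /negP; rewrite -ltNge => h.
  exists (a - z ord0 i); first by rewrite subr_gt0.
  move=> w /(row_coord_dist i); rewrite ltr_norml => /andP[h1 h2] h3; lra.
exists (z ord0 i - a); first by rewrite subr_gt0.
move=> w /(row_coord_dist i); rewrite ltr_norml => /andP[h1 h2] h3; lra.
Qed.

Lemma convex_halfspace i b a : convexset (halfspace i b a).
Proof.
by rewrite /halfspace; case: b => z w u /= hz hw /andP[u0 u1]; rewrite !mxE; nra.
Qed.

Definition locally_orientable (z : 'rV[R]_3) : Prop :=
  exists2 e, 0 < e & orientable [set w | `|z - w| < e]%classic.

Lemma orientable0 : orientable set0.
Proof. by exists (fun=> false); split=> [i x y|x] [_ []]. Qed.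

(** Induction on the number [k] of unrestricted coordinates. Slabs thin also in coordinate [k] have
    sections by induction; they meet in convex, hence rigid, sets, and [interval_induction] joins
    them from [- M] to [M]. *)
Lemma convex_orientable B M : closedset B -> convexset B -> charted B ->
  (forall z i, B z -> `|z ord0 i| <= M) ->
  (forall z, B z -> locally_orientable z) -> orientable B.
Proof.
move=> cB vB sB bM loc.
have [M0|M0] := leP 0 M; last first.
  apply: orientable_sub orientable0 => z Bz.
  by have := bM z ord0 Bz; have := normr_ge0 (z ord0 ord0); lra.
suff H k : (k <= 3)%N -> forall z, exists2 e, 0 < e &
    orientable (B `&` cube (fun i => (k <= i)%N) z e)%classic.
  have [//|e _] := H 3%N _ 0; apply: orientable_sub => w Bw; split=> // i.
  by rewrite leqNgt ltn_ord.
elim: k => [_ z|k IH k3 z].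
  have [/loc [e e0 he]|/cB [e e0 he]] := pselect (B z).
    exists (e / 2); first by rewrite divr_gt0.
    apply: orientable_sub he => w [_ hw]; apply/row_norm_ltP => // i.
    by have := hw i isT; rewrite !mxE distrC; lra.
  exists (e / 2); first by rewrite divr_gt0.
  apply: orientable_sub orientable0 => w [Bw hw]; case: (he w) => //.
  apply/row_norm_ltP => // i.
  by have := hw i isT; rewrite !mxE distrC; lra.
pose kk := Ordinal k3.
pose S (e s t : R) := (B `&` (cube (fun i => (k < i)%N) z e `&`
  (halfspace kk true s `&` halfspace kk false t)))%classic.
have cS e s t : closedset (S e s t).
  apply: closedsetI => //; apply: closedsetI; first exact: closed_cube.
  by apply: closedsetI; exact: closed_halfspace.
have vS e s t : convexset (S e s t).
  apply: convexsetI => //; apply: convexsetI; first exact: convex_cube.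
  by apply: convexsetI; exact: convex_halfspace.
have mono e e' s t : e <= e' -> (S e s t `<=` S e' s t)%classic.
  by move=> ee' w [Bw [hw hh]]; split=> //; split=> // i ki; apply: le_trans ee'; exact: hw.
suff [e e0 he] : exists2 e, 0 < e & orientable (S e (- M) M).
  exists e => //; apply: orientable_sub he => w [Bw hw]; split=> //; split=> //.
  by have := bM w kk Bw; rewrite ler_norml => /andP[].
apply: (@interval_induction R (fun s t => exists2 e, 0 < e & orientable (S e s t))).
- lra.
- move=> s m t _ [e e0 he] [e' e'0 he'].
  exists (Num.min e e'); first by rewrite lt_min e0.
  have -> : S (Num.min e e') s t =
     (S (Num.min e e') s t `&` (S (Num.min e e') s m `|` S (Num.min e e') m t))%classic.
    apply/seteqP; split=> [w Sw|w []//]; split=> //.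
    case: Sw => [Bw [hw [h1 h2]]].
    have [wm|mw] := leP (w ord0 kk) m; [left|right]; split=> //; split=> //; split=> //.
    exact: ltW.
  apply: orientable_sub (@subIsetr _ _ _) _.
  apply: orientable_glue => //.
  + by apply: orientable_sub he; apply: mono; rewrite ge_min lexx.
  + by apply: orientable_sub he'; apply: mono; rewrite ge_min lexx orbT.
  + apply: convex_rigid; [exact: closedsetI|exact: convexsetI|].
    by move=> w [[/sB]].
- move=> s _; pose z' := \row_i (if i == kk then s else z ord0 i).
  have [|e e0 he] := IH _ z'; first exact: ltnW.
  exists e => // s' t' _ es' /andP[s's st'] t'e _; exists e => //.
  apply: orientable_sub he => w [Bw [hw [h1 h2]]]; split=> // i ki.
  rewrite mxE; case: eqP => [->|/eqP ik].
    by move: h1 h2; rewrite /halfspace /= ler_norml => h1 h2; apply/andP; split; lra.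
  apply: hw; rewrite ltn_neqAle ki andbT eq_sym.
  by apply: contra ik => /eqP ik; apply/eqP/val_inj.
Qed.

(** The shell is a union of six convex slabs, one for each coordinate and sign. They are added one
    at a time: opposite slabs are disjoint, and each new slab meets the previous union in convex
    sets chained together at vertices of the cube, so the overlap is rigid. *)
Lemma shell_orientable (q : 'rV[R]_3) (d r : R) : 0 < d <= r ->
  charted [set z : 'rV[R]_3 | forall i, `|z ord0 i - q ord0 i| <= r]%classic ->
  (forall z : 'rV[R]_3, (forall i, `|z ord0 i - q ord0 i| <= r) -> z <> q ->
     locally_orientable z) ->
  orientable [set z : 'rV[R]_3 | (forall i, `|z ord0 i - q ord0 i| <= r) /\ d <= `|q - z|]%classic.
Proof.
move=> /andP[d0 dr] cov loc.
pose S (i : 'I_3) b := (cube predT q r `&`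
  halfspace i b (q ord0 i + (if b then d else - d)))%classic.
have cS i b : closedset (S i b).
  by apply: closedsetI; [exact: closed_cube | exact: closed_halfspace].
have vS i b : convexset (S i b).
  by apply: convexsetI; [exact: convex_cube | exact: convex_halfspace].
have sS i b : charted (S i b) by move=> z [hz _]; apply: cov => j; exact: hz.
have oS i b : orientable (S i b).
  have [M hM] : exists M, forall j, `|q ord0 j| + r <= M.
    exists (\big[Num.max/0]_j (`|q ord0 j| + r)) => j; exact: le_bigmax.
  apply: (@convex_orientable _ M) => //.
    move=> z j [/(_ j isT) hz _]; apply: le_trans (hM j).
    by have := ler_normD (z ord0 j - q ord0 j) (q ord0 j); rewrite subrK; lra.
  move=> z [hz hh]; apply: loc => [j|zq]; first exact: hz.
  by move: hh; rewrite zq /halfspace; case: b => /=; lra.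
have rS i b j c : rigid (S i b `&` S j c)%classic.
  apply: convex_rigid; [exact: closedsetI|exact: convexsetI|].
  by move=> w [/sS].
have opp i : (S i true `&` S i false = set0)%classic.
  by apply/seteqP; split=> // z [[_ h1] [_ h2]]; move: h1 h2; rewrite /halfspace /=; lra.
(* A vertex of the cube lies in three slabs; these points link the pieces of the overlaps. *)
have corner (s : 'I_3 -> bool) : exists x, forall i, lies_over (S i (s i)) x.
  have [|x Dx xE] := cov (\row_i (q ord0 i + (if s i then r else - r))).
    move=> i; rewrite mxE addrC addKr; case: (s i); rewrite ?normrN ger0_norm //; lra.
  exists x => i; split=> //; rewrite xE; split=> [j _|].
    rewrite mxE addrC addKr; case: (s j); rewrite ?normrN ger0_norm //; lra.
  rewrite /halfspace; case si: (s i) => /=; rewrite mxE si; lra.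
have corner3 b0 b1 b2 : exists x, [/\ lies_over (S 0 b0) x, lies_over (S 1 b1) x & lies_over (S 2 b2) x].
  have [x hx] := corner (fun i => nth true [:: b0; b1; b2] i).
  exists x; split; [exact: (hx 0) | exact: (hx 1) | exact: (hx 2)].
have capo W W' x : lies_over W x -> lies_over W' x -> lies_over (W `&` W')%classic x by case=> ? ? [].
have cU W W' : closedset W -> closedset W' -> closedset (W `|` W')%classic.
  move=> c c' z nz; have [|e e0 he] := c z; first by move=> Wz; apply: nz; left.
  have [|e' e'0 he'] := c' z; first by move=> Wz; apply: nz; right.
  exists (Num.min e e'); first by rewrite lt_min e0.
  by move=> z'; rewrite lt_min => /andP[/he h /he' h'] [].
have o1 : orientable (S 2 true `|` S 0 true)%classic.
  exact: orientable_glue.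
have o2 : orientable (S 2 true `|` S 0 true `|` S 1 true)%classic.
  apply: orientable_glue => //; first exact: (cU).
  have [x [x0 x1 x2]] := corner3 true true true.
  by rewrite setIUl; apply: (@rigidU _ _ x) => //; apply: capo.
have o3 : orientable (S 2 true `|` S 0 true `|` S 1 true `|` S 0 false)%classic.
  apply: orientable_glue => //; first by apply: (cU) => //; exact: (cU).
  have [x [x0 x1 x2]] := corner3 false true true.
  by rewrite !setIUl opp setU0; apply: (@rigidU _ _ x) => //; apply: capo.
have o4 : orientable (S 2 true `|` S 0 true `|` S 1 true `|` S 0 false `|` S 1 false)%classic.
  apply: orientable_glue => //; first by do 2 apply: (cU) => //; exact: (cU).
  have [x [x0 x1 x2]] := corner3 true false true.
  have [y [y0 y1 y2]] := corner3 false false true.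
  rewrite !setIUl opp setU0; apply: (@rigidU _ _ y) => //; last exact: capo.
    by apply: (@rigidU _ _ x) => //; apply: capo.
  by case: (capo _ _ _ y2 y1) => ? ?; split => //; left.
have o5 : orientable (S 2 true `|` S 0 true `|` S 1 true `|` S 0 false `|` S 1 false
    `|` S 2 false)%classic.
  apply: orientable_glue => //; first by do 3 apply: (cU) => //; exact: (cU).
  have [x [x0 x1 x2]] := corner3 true true false.
  have [y [y0 y1 y2]] := corner3 false true false.
  have [z [z0 z1 z2]] := corner3 false false false.
  rewrite !setIUl opp set0U; apply: (@rigidU _ _ z) => //; last exact: capo.
    apply: (@rigidU _ _ y) => //; last exact: capo.
      by apply: (@rigidU _ _ x) => //; apply: capo.
    by case: (capo _ _ _ y1 y2) => ? ?; split => //; right.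
  by case: (capo _ _ _ z0 z2) => ? ?; split => //; right.
apply: orientable_sub o5 => z [hz dz].
have [i hi] : exists i, d <= `|q ord0 i - z ord0 i|.
  apply: contrapT => /forallNP h; have : `|q - z| < d; last lra.
  by apply/row_norm_ltP => // i; rewrite !mxE ltNge; apply/negP.
have {hi} [b Sz] : exists b, S i b z.
  move: hi; rewrite ler_normr => /orP[] hi; [exists false|exists true].
    by split=> [j _|]; [exact: hz | rewrite /halfspace /=; lra].
  by split=> [j _|]; [exact: hz | rewrite /halfspace /=; lra].
have : [\/ i = 0, i = 1 | i = 2].
  case: i {Sz} => [[|[|[|]]] //] h; [apply: Or31|apply: Or32|apply: Or33]; exact: val_inj.
by case=> iE; move: Sz; rewrite iE; case: b => Sz; rewrite /setU /=; tauto.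
Qed.
End Points.

Lemma other_corners (k a : 'I_4) : k != a ->
  exists i j, uniq [:: k; a; i; j].
Proof.
move=> ka; have : (1 < #|[predC [:: k; a]]|)%N.
  have := cardC (mem [:: k; a]); rewrite card_ord.
  have /card_uniqP -> : uniq [:: k; a] by rewrite /= inE ka.
  by rewrite /= => /addnI ->.
case/card_gt1P => i [j [hi hj ij]]; exists i, j.
move: hi hj; rewrite !inE !negb_or => /andP[ik ia] /andP[jk ja].
by rewrite /= !inE !negb_or ka ij ![k == _]eq_sym ![a == _]eq_sym ik ia jk ja.
Qed.

Lemma all_corners (s : seq 'I_4) : uniq s -> size s = 4 -> forall p, p \in s.
Proof.
move=> us ss p; have /subset_cardP h : #|s| = #|'I_4| by rewrite card_ord (card_uniqP us).
by have /h -> : s \subset 'I_4 by exact/fintype.subsetP.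
Qed.

(** * Local sections at points near a vertex *)

Section FibreColouring.
Variables (R : realType) (n : nat) (T : triangulation n).
Local Notation D := (disjoint_tetrahedra R n).

(** This is a section of the double cover over the single point represented by [x];
    [fibre_neighbourhood] extends it to nearby points. *)
Definition fibre_coloured (x : D) : Prop := exists col : D -> bool,
  forall x' y i, same_point T x x' -> glued_at T i x' y ->
    col y = col x' (+) twist T (tag x') i.

Definition cross_face (p : 'I_4) (s : 'I_n * 'S_4) : 'I_n * 'S_4 :=
  (neighbour T s.1 (s.2 p), s.2 * gluing T s.1 (s.2 p))%g.

(* The triple (t, rho, e) records the copy of x in t whose coordinates are
   those of x permuted by rho, reached after crossing a number of faces of
   parity e. *)
Lemma colouring_of_orbit (x : D) (C : 'I_n * 'S_4 -> bool -> Prop) :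
  C (tag x, 1%g) false ->
  (forall s e p, C s e -> bary x p = 0 -> C (cross_face p s) (~~ e)) ->
  (forall t r r' e e', C (t, r) e -> C (t, r') e' ->
     (forall p, bary x (((r' : 'S_4)^-1)%g ((r : 'S_4) p)) = bary x p) ->
     odd_perm r (+) e = odd_perm r' (+) e') ->
  fibre_coloured x.
Proof.
move=> C0 Cstep Cuniq.
pose rep y (s : 'I_n * 'S_4) e :=
  [/\ C s e, tag y = s.1 & forall j, bary y (s.2 j) = bary x j].
(* The colour is the parity of the permutation plus that of the crossings. A crossing composes with
   the gluing and adds one, so the sum changes by [twist]. *)
pose col y := `[< exists s e, rep y s e /\ odd_perm s.2 (+) e >].
have colE y s e : rep y s e -> col y = odd_perm s.2 (+) e.
  move=> [Cs ty cy]; apply/asboolP/idP => [[s' [e' [[Cs' ty' cy'] o']]]|h].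
    suff <- : odd_perm s'.2 (+) e' = odd_perm s.2 (+) e by [].
    case: s s' {o'} Cs Cs' ty ty' cy cy' => t r [t' r'] /= Cs Cs' ty ty' cy cy'.
    rewrite ty in ty'; subst t'; apply: Cuniq Cs' Cs _ => p.
    by rewrite -cy permKV cy'.
  by exists s, e.
have step y z i s e : rep y s e -> glued_at T i y z ->
    exists p, i = s.2 p /\ rep z (cross_face p s) (~~ e).
  move=> [Cs ty cy] [y0 tz cz]; exists ((s.2)^-1%g i).
  rewrite permKV; split=> //; split=> /=.
  - by apply: Cstep => //; rewrite -cy permKV.
  - by rewrite permKV tz ty.
  - by move=> j; rewrite permKV permM -ty cz cy.
exists col => x' y i xx' x'y.
have [s [e se]] : exists s e, rep x' s e.
  move: x' xx' {x'y}; apply: same_point_ind.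
    by exists (tag x, 1%g), false; split=> // j; rewrite perm1.
  move=> j y' z _ [s [e se]] /(step _ _ _ _ _ se) [p [_ h]].
  by exists (cross_face p s), (~~ e).
have [p [ip h]] := step _ _ _ _ _ se x'y.
rewrite (colE _ _ _ se) (colE _ _ _ h) /= odd_permM /twist ip.
by case: se => _ -> _; case: (odd_perm _) (odd_perm _) e {h} => [] [] [].
Qed.

Lemma cross_faceK p : involutive (cross_face p).
Proof.
move=> [t r]; rewrite /cross_face /= !permM.
by have [-> ->] := gluing_sym T t (r p); rewrite mulgK.
Qed.

Lemma cross_face_neq p s : cross_face p s <> s.
Proof.
case: s => t r [nE gE]; apply: (@gluing_distinct _ T t (r p)).
have -> : gluing T t (r p) = 1%g by apply: (mulgI r); rewrite gE mulg1.
by rewrite nE perm1.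
Qed.

Section Edge.
Variables i j : 'I_4.
Hypothesis ij : i != j.

Definition flip (s : 'I_n * 'S_4) : 'I_n * 'S_4 := (s.1, tperm i j * s.2)%g.

(** After a crossing, the flip exchanges the names of the two faces at the edge, so the next face in
    the same sense of rotation is again called [i]; iterating [turn] walks around the edge. *)
Definition turn (s : 'I_n * 'S_4) : 'I_n * 'S_4 := flip (cross_face i s).

Lemma flipK : involutive flip.
Proof. by case=> t r; rewrite /flip /= mulgA tperm2 mul1g. Qed.

Lemma flip_cross s : flip (cross_face i (flip s)) = cross_face j s.
Proof.
by case: s => t r; rewrite /flip /cross_face /= permM tpermL !mulgA tperm2 mul1g.
Qed.

Lemma turn_inj : injective turn.
Proof. exact: inj_comp (can_inj flipK) (can_inj (cross_faceK i)). Qed.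

(* Turning around an edge never reverses the sense of rotation: a reversal
   would be conjugate, in the dihedral group generated by flip and turn, to a
   state fixed by a reflection. *)
Lemma turn_flip m s : iter m turn s <> flip s.
Proof.
have [k km] := ubnP m; elim: k => // k IH in m s km *.
case: m km => [_ /=|[_ /=|m km]].
- case: s => t r [] h; have e : tperm i j = 1%g by apply: (mulIg r); rewrite mul1g -h.
  by move: ij; rewrite -(tpermL i j) e perm1 eqxx.
- by move/(can_inj flipK)/cross_face_neq.
- rewrite iterSr /= => h; apply: (IH m (turn s)).
    exact: ltn_trans (ltnSn m) km.
  (* [turn (flip (turn s)) = flip s], so one turn can be cancelled at each end. *)
  apply: turn_inj; rewrite -iterS iterSr -iterSr /= h.
  by rewrite /turn flipK cross_faceK.
Qed.

End Edge.

(** The states at an edge point lie in an orbit of [turn] or in its image under [flip], disjoint by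
    [turn_flip]; the side tells the parity of crossings. A coordinate above 1/2 occurs only once, so
    no symmetry of the coordinates exchanges the ends of the edge: only the identity and the swap of
    [i] and [j] remain. *)
Lemma edge_coloured (x : D) (k a i j : 'I_4) : uniq [:: k; a; i; j] ->
  1 / 2 < bary x k -> bary x a != 0 -> bary x i = 0 -> bary x j = 0 ->
  fibre_coloured x.
Proof.
move=> u xk xa xi xj.
have ij : i != j by move: u; rewrite /= !inE => /and4P[_ _ -> _].
pose tn := turn i j.
pose conn s := fconnect tn (tag x, 1%g) s.
have tnI : injective tn by exact: turn_inj.
have conn_turn s : conn (tn s) = conn s.
  by rewrite /conn; apply/esym/same_connect_r; [exact: fconnect_sym|exact: fconnect1].
have conn_flip s : conn s -> conn (flip i j s) -> False.
  rewrite /conn fconnect_sym // => h1 h2.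
  have /iter_findex h := connect_trans h1 h2.
  exact: (turn_flip ij h).
have only_k p : bary x p = bary x k -> p = k.
  move=> pk; apply/eqP/contraT => nk.
  have := bary_sum x; rewrite (bigD1 k) //= (bigD1 p) //= pk.
  have : 0 <= \sum_(q | (q != k) && (q != p)) bary x q.
    by apply: sumr_ge0 => q _; exact: bary_ge0.
  lra.
have zero p : bary x p = 0 -> p = i \/ p = j.
  have := all_corners u erefl p; rewrite !inE => /or4P[] /eqP -> h; try tauto.
    by exfalso; move: xk; rewrite h; lra.
  by move: xa; rewrite h eqxx.
pose C (s : 'I_n * 'S_4) (e : bool) := is_true (conn (if e then flip i j s else s)).
apply: (@colouring_of_orbit x C).
- exact: connect0.
- move=> s e p Cs /zero pij; rewrite /C; case: e Cs => /= Cs; case: pij => ->.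
  + by rewrite -conn_turn /tn /turn cross_faceK.
  + by rewrite -(flip_cross i j) -[flip _ _ _]/(tn (flip i j s)) conn_turn.
  + by rewrite -[flip _ _ _]/(tn s) conn_turn.
  + by rewrite -(flip_cross i j) flipK -conn_turn /tn /turn cross_faceK flipK.
move=> t r r' e e' Cs Cs' hb.
pose tau := (r * r'^-1)%g.
have tauE p : bary x (tau p) = bary x p by rewrite /tau permM.
have rE : r = (tau * r')%g by rewrite /tau mulgKV.
have tk : tau k = k by apply: only_k.
have ta : tau a = a.
  have := all_corners u erefl (tau a); rewrite !inE => /or4P[] /eqP h //.
  - have /perm_inj ak : tau a = tau k by rewrite tk.
    by move: u; rewrite ak /= inE eqxx.
  - by move: xa; rewrite -tauE h xi eqxx.
  - by move: xa; rewrite -tauE h xj eqxx.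
have [ti|ti] := zero _ (etrans (tauE i) xi); last first.
  have tau_flip : tau = tperm i j.
    have tj : tau j = i.
      have [//|tj] := zero _ (etrans (tauE j) xj).
      by move: ij; rewrite -(inj_eq (@perm_inj _ tau)) ti tj eqxx.
    apply/permP => p; have := all_corners u erefl p; rewrite !inE.
    move: u; rewrite /= !inE !negb_or => /and4P[/and3P[ka ki kj] /andP[ai aj] _ _].
    case/or4P => /eqP ->; rewrite ?tk ?ta ?ti ?tj ?tpermL ?tpermR //.
      by rewrite tpermD // eq_sym.
    by rewrite tpermD // eq_sym.
  have rf : flip i j (t, r') = (t, r) by rewrite /flip /= rE tau_flip.
  rewrite rE tau_flip odd_permM odd_tperm ij.
  case: e e' Cs Cs' => [] [] Cs Cs' //=; rewrite ?addbT ?addbF ?negbK //.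
  - by rewrite /C rf in Cs'; case: (conn_flip _ Cs' Cs).
  - by case: (conn_flip _ Cs'); rewrite rf.
have tau1 : tau = 1%g.
  have tj : tau j = j.
    have [tj|//] := zero _ (etrans (tauE j) xj).
    by move: ij; rewrite -(inj_eq (@perm_inj _ tau)) ti tj eqxx.
  apply/permP => p; rewrite perm1; have := all_corners u erefl p; rewrite !inE.
  by case/or4P => /eqP ->.
rewrite tau1 mul1g in rE; rewrite -{}rE in Cs' *.
by case: e e' Cs Cs' => [] [] Cs Cs' //; case: (@conn_flip (t, r)).
Qed.

(** Away from the vertex, the point is interior to an edge, a face or a tetrahedron. The last two
    cases have at most two states, kept apart because no face is glued to itself. *)
Lemma near_vertex_coloured (x : D) k :
  1 / 2 < bary x k -> bary x k != 1 -> fibre_coloured x.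
Proof.
move=> xk xk1.
have [a ka xa] : exists2 a, k != a & bary x a != 0.
  apply/exists2P; apply: contrapT => /forallNP h; move: xk1; rewrite -(bary_sum x).
  rewrite (bigD1 k) //= big1 ?addr0 ?eqxx // => p pk.
  by apply/eqP/contraT => xp; case: (h p); rewrite eq_sym.
have [i [j u]] := other_corners ka.
wlog xi : i j u / bary x i = 0 -> bary x j = 0.
  move=> W; have [xj|xj] := eqVneq (bary x j) 0; first exact: (W i j).
  apply: (W j i) => //; last by move=> h; rewrite h eqxx in xj.
  move: u; rewrite /= !inE !negb_or (eq_sym j i).
  by move=> /and4P[/and3P[-> -> ->] /andP[-> ->] -> _].
have [xi0|xi0] := eqVneq (bary x i) 0; first exact: edge_coloured u _ _ _ (xi xi0).
have zero p : bary x p = 0 -> p = j.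
  have := all_corners u erefl p; rewrite !inE => /or4P[] /eqP -> // h.
  - by exfalso; move: xk; rewrite h; lra.
  - by move: xa; rewrite h eqxx.
  - by move: xi0; rewrite h eqxx.
have [xj|xj] := eqVneq (bary x j) 0; last first.
  apply: (@colouring_of_orbit x (fun s e => s = (tag x, 1%g) /\ e = false)) => //.
    by move=> s e p _ xp; move: (xj); rewrite -(zero p xp) xp eqxx.
  by move=> t r r' e e' [[_ ->] ->] [[_ ->] ->].
apply: (@colouring_of_orbit x (fun s e => s = if e then cross_face j (tag x, 1%g) else (tag x, 1%g))) => //.
  by move=> s [] p -> /zero -> /=; rewrite ?cross_faceK.
have neq : forall (t : 'I_n) (r r' : 'S_4), (t, r) = cross_face j (tag x, 1%g) ->
    (t, r') = (tag x, 1%g) ->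
    (forall p, bary x ((r'^-1)%g (r p)) = bary x p) -> False.
  move=> t r r' [tE rE] [tE' rE'] h; subst r'; rewrite perm1 mul1g in rE tE.
  have := h j; rewrite invg1 perm1 xj => /zero; rewrite rE => gj.
  apply: (@gluing_distinct _ T (tag x) j).
  by rewrite gj -tE tE'.
move=> t r r' [] [] h h' hb; try by [rewrite h in h'; case: h' => -> | move: h'; rewrite -h => -[->]].
  by case: (neq _ _ _ h h' hb).
case: (neq _ _ _ h' h) => p.
by have := hb ((r^-1)%g (r' p)); rewrite permKV permK => ->.
Qed.

End FibreColouring.

(** * The obstruction at a Moebius corner *)

Section MoebiusCorner.
Variables (R : realType) (n : nat) (T : triangulation n).
Local Notation D := (disjoint_tetrahedra R n).

(** A point within [d] of a copy of [x] takes the colour of that copy. As [d] is at most half of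
    each gap between distinct coordinates, the copy is unique; as it is at most each nonzero
    coordinate, a nearby point lies on a face only if the copy does. *)
Lemma fibre_neighbourhood (x : D) : fibre_coloured T x ->
  exists (O : D -> Prop) (col : D -> bool),
  [/\ O x, saturated T O, tet_open O,
      forall i y z, O y -> glued_at T i y z -> col z = col y (+) twist T (tag y) i
    & forall y, O y -> exists2 d, 0 < d & forall z, tet_close d y z -> col z = col y].
Proof.
case=> col colE.
have [e e0 he] : exists2 e, 0 < e & forall i j, bary x i != bary x j ->
    2 * e <= `|bary x i - bary x j|.
  have [|e e0 he] := @positive_lower_bound R ('I_4 * 'I_4)%type
     (fun p => if bary x p.1 == bary x p.2 then 1 else `|bary x p.1 - bary x p.2| / 2).
    by move=> p; case: eqP => // /eqP h; rewrite divr_gt0 // normr_gt0 subr_eq0.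
  exists e => // i j /negbTE h; have := he (i, j); rewrite /= h; lra.
have [e' e'0 he'] : exists2 e', 0 < e' & forall i, bary x i != 0 -> e' <= bary x i.
  have [|e' e'0 he'] := @positive_lower_bound R 'I_4
     (fun p => if bary x p == 0 then 1 else bary x p).
    by move=> p; case: eqP => // /eqP h; rewrite lt_neqAle eq_sym h bary_ge0.
  by exists e' => // i /negbTE h; have := he' i; rewrite h.
pose d := Num.min e e'.
have d0 : 0 < d by rewrite lt_min e0.
have de : d <= e by rewrite ge_min lexx.
have de' : d <= e' by rewrite ge_min lexx orbT.
have uniq_near y x1 x2 : same_point T x x1 -> same_point T x x2 ->
    tet_close d x1 y -> tet_close d x2 y -> x1 = x2.
  move=> xx1 xx2 [t1 c1] [t2 c2]; apply: bary_inj; first by rewrite -t1 -t2.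
  move=> i; have [j1 E1] := same_point_bary xx1 i.
  have [j2 E2] := same_point_bary xx2 i.
  apply/eqP; rewrite E1 E2; apply/contraT => /he; rewrite -E1 -E2.
  have := c1 i; have := c2 i; have := ler_distD (bary y i) (bary x1 i) (bary x2 i).
  rewrite (distrC (bary y i)); lra.
pose O y := exists2 x', same_point T x x' & tet_close d x' y.
pose col' y := `[< exists x', [/\ same_point T x x', tet_close d x' y & col x'] >].
have colO y x' : same_point T x x' -> tet_close d x' y -> col' y = col x'.
  move=> xx' cy; apply/asboolP/idP => [[x2 [xx2 c2 c]]|h]; last by exists x'.
  by rewrite (uniq_near y x' x2).
have move_near i x' y z : same_point T x x' -> tet_close d x' y -> glued_at T i y z ->
    exists2 z', glued_at T i x' z' & tet_close d z' z.
  move=> xx' [ty cy] yz; have [y0 tz cz] := yz.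
  have x'0 : bary x' i = 0.
    have [j E] := same_point_bary xx' i.
    apply/eqP/contraT; rewrite E => /he'; rewrite -E.
    have := cy i; rewrite y0 subr0 ger0_norm ?bary_ge0 //; lra.
  have [z' x'z'] := glued_at_ex T x'0; exists z' => //.
  case: x'z' => _ tz' cz'; split; first by rewrite tz tz' ty.
  move=> j; rewrite -[j](permKV (gluing T (tag x') i)) cz' -{2}ty cz; exact: cy.
exists O, col'; split.
- by exists x; [exact: same_point_refl | split=> // i; rewrite subrr normr0].
- apply: glued_saturated => i y z yz [x' xx' cy].
  have [z' x'z' cz] := move_near _ _ _ _ xx' cy yz.
  by exists z' => //; apply: same_point_trans xx' _; exact: glued_at_same x'z'.
- move=> y [x' xx' /tet_close_shrink [r r0 hr]]; exists r => // z /hr h.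
  by exists x'.
- move=> i y z [x' xx' cy] yz.
  have [z' x'z' cz] := move_near _ _ _ _ xx' cy yz.
  rewrite (colO y x') // (colO z z') //; last first.
    by apply: same_point_trans xx' _; exact: glued_at_same x'z'.
  by rewrite (colE x' z' i xx' x'z'); case: cy => ->.
- move=> y [x' xx' cy]; have [r r0 hr] := tet_close_shrink cy.
  by exists r => // z /hr cz; rewrite (colO y x') // (colO z x').
Qed.

Lemma within_interval (a b c v h : R) : 0 <= b -> a - h < b -> b <= a <= c ->
  c < a + h -> c <= 1 -> b <= v <= c -> 0 <= v <= 1 /\ `|a - v| < h.
Proof.
move=> b0 ab /andP[ba ac] ca c1 /andP[bv vc].
by rewrite ltr_norml; split; apply/andP; split; lra.
Qed.

Section WithChart.
Variables (DU : D -> Prop) (F : D -> 'rV[R]_3).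
Hypothesis DU_same : forall x y, same_point T x y -> DU x -> DU y /\ F x = F y.
Hypothesis F_inj : forall x y, DU x -> DU y -> F x = F y -> same_point T x y.
Hypothesis F_open : forall x O, DU x -> O x -> saturated T O -> tet_open O ->
  exists2 e, 0 < e & forall z, `|F x - z| < e ->
    exists y, [/\ DU y, O y & F y = z].

Lemma coloured_locally_orientable (x : D) : DU x -> fibre_coloured T x ->
  locally_orientable T DU F (F x).
Proof.
move=> Dx /fibre_neighbourhood [N [col [Nx sN oN glueN locN]]].
have [e e0 he] := F_open Dx Nx sN oN.
have inN y : lies_over DU F [set w | `|F x - w| < e]%classic y -> N y.
  case=> Dy /he [y' [Dy' Ny' Fy]]; apply: sN Ny'; exact: F_inj.
exists e => //; exists col; split=> [i y z /inN|y /inN Ny]; first exact: glueN.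
by have [d d0 hd] := locN y Ny; exists d => // z /hd.
Qed.

(** [N] consists of the half-size corners at all copies of the vertex. It is saturated, since a
    gluing carries the large coordinate along, and a point of it with large coordinate 1 is a copy
    of the vertex. *)
Lemma vertex_neighbourhood_coordinates (x : D) k : bary x k = 1 -> DU x ->
  exists2 e, 0 < e & forall z, `|F x - z| < e -> exists y, [/\ DU y,
    F y <> F x -> exists2 m, 1 / 2 < bary y m & bary y m != 1 & F y = z].
Proof.
move=> xk Dx.
pose N (y : D) := exists m v,
  [/\ 1 / 2 < bary y m, same_point T x v, tag v = tag y & bary v m = 1].
have bary1 (y : D) m : bary y m = 1 -> forall p, p != m -> bary y p = 0.
  move=> ym p pm; have := bary_sum y; rewrite (bigD1 m) //= (bigD1 p) //= ym.
  have : 0 <= \sum_(q | (q != m) && (q != p)) bary y q.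
    by apply: sumr_ge0 => q _; exact: bary_ge0.
  by have := bary_ge0 y p; lra.
have sN : saturated T N.
  apply: glued_saturated => p y z [y0 tz cz] [m [v [ym xv tv vm]]].
  have mp : p != m by apply/eqP => pm; move: ym; rewrite -pm y0; lra.
  have [v' vv'] := glued_at_ex T (bary1 v m vm p mp).
  have [_ tv' cv'] := vv'.
  exists (gluing T (tag y) p m), v'; split.
  - by rewrite cz.
  - by apply: same_point_trans xv _; exact: glued_at_same vv'.
  - by rewrite tv' tz tv.
  - by rewrite -tv cv'.
have oN : tet_open N.
  move=> y [m [v [ym xv tv vm]]]; exists (bary y m - 1 / 2); first by lra.
  move=> z [tz cz]; exists m, v; split=> //; last by rewrite tz.
  by have := cz m; rewrite ltr_norml => /andP[_]; lra.
have Nx : N x.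
  by exists k, x; split; [rewrite xk; lra | exact: same_point_refl | |].
have [e e0 he] := F_open Dx Nx sN oN; exists e => // z /he [y [Dy [m [v [ym xv tv vm]]] Fy]].
exists y; split=> // Fyx; exists m => //; apply/eqP => ym1.
apply: Fyx; have [_ ->] := DU_same xv Dx; congr F.
apply: bary_inj => [|p]; first by rewrite tv.
by have [->|pm] := eqVneq p m; rewrite ?ym1 ?vm // (bary1 y m) // (bary1 v m).
Qed.

Variable g : R -> D.
Hypothesis g_cont : forall v v' d, 0 <= v <= 1 -> 0 <= v' <= 1 -> `|v - v'| < d ->
  tet_close d (g v) (g v').

(** The distance to [q] is locally bounded below by a positive number, and [interval_induction]
    makes the bound uniform. *)
Lemma path_avoids (q : 'rV[R]_3) :
  (forall x, DU x -> forall e, 0 < e -> exists2 d, 0 < d &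
    forall y, tet_close d x y -> DU y /\ `|F x - F y| < e) ->
  (forall v, 0 <= v <= 1 -> DU (g v)) -> (forall v, 0 <= v <= 1 -> F (g v) <> q) ->
  exists2 d, 0 < d & forall v, 0 <= v <= 1 -> d <= `|q - F (g v)|.
Proof.
move=> F_cont gD gq.
apply: (@interval_induction R (fun a b => exists2 d, 0 < d &
   forall v, a <= v <= b -> d <= `|q - F (g v)|)) => //.
- move=> a m b /andP[am mb] [d d0 hd] [d' d'0 hd'].
  exists (Num.min d d'); first by rewrite lt_min d0.
  move=> v /andP[av vb]; rewrite ge_min; have [vm|mv] := leP v m.
    by rewrite hd // av.
  by rewrite hd' ?orbT // (ltW mv).
- move=> a a01; pose d := `|q - F (g a)| / 2.
  have d0 : 0 < d.
    by rewrite divr_gt0 // normr_gt0 subr_eq0; apply/eqP => /esym; exact: gq.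
  have [h h0 hh] := F_cont _ (gD a a01) d d0.
  exists h => // b c b0 ab bac ca c1; exists d => // v bvc.
  have [v01 av] := within_interval b0 ab bac ca c1 bvc.
  have [_] := hh _ (g_cont a01 v01 av).
  have := ler_distD (F (g v)) q (F (g a)).
  by rewrite (distrC (F (g v))) /d; lra.
Qed.

Lemma path_constant W f : orients T DU F W f ->
  (forall v, 0 <= v <= 1 -> lies_over DU F W (g v)) -> f (g 1) = f (g 0).
Proof.
move=> [_ hf] gW.
have [b hb] : exists b, forall v, 0 <= v <= 1 -> f (g v) = b.
  apply: (@interval_induction R (fun a c => exists b, forall v, a <= v <= c -> f (g v) = b)) => //.
  - move=> a m c /andP[am mc] [b hb] [b' hb']; exists b => v /andP[av vc].
    have [vm|mv] := leP v m; first by rewrite hb // av.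
    by rewrite hb' ?(ltW mv) // -(hb' m) ?lexx // hb ?lexx ?andbT.
  - move=> a a01; have [h h0 hh] := hf (g a) (gW a a01).
    exists h => // b c b0 ab bac ca c1; exists (f (g a)) => v bvc.
    have [v01 av] := within_interval b0 ab bac ca c1 bvc.
    exact: hh (g_cont a01 v01 av) (gW v v01).
by rewrite !hb ?lexx ?ler01.
Qed.

End WithChart.

(* A segment crossing the corner k of t, close to the vertex, from the face i
   to the face j. *)
Lemma corner_path (t : 'I_n) (i j l k : 'I_4) (s : R) :
  uniq [:: i; j; l; k] -> 0 < s -> s <= 1 / 2 -> exists g : R -> D,
  [/\ forall v, 0 <= v <= 1 -> [/\ tag (g v) = t,
        forall p, `|(p == k)%:R - bary (g v) p| <= s & forall p, bary (g v) p < 1],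
      forall v v' d, 0 <= v <= 1 -> 0 <= v' <= 1 -> `|v - v'| < d ->
        tet_close d (g v) (g v'),
      bary (g 0) i = 0
    & [/\ bary (g 1) j = bary (g 0) i, bary (g 1) l = bary (g 0) j,
          bary (g 1) i = bary (g 0) l & bary (g 1) k = bary (g 0) k]].
Proof.
move=> u s0 s1; have cover := all_corners u erefl.
move: (u); rewrite /= !inE !negb_or => /and4P[/and3P[ij il ik] /andP[jl jk] lk _].
have sum4 (w : 'I_4 -> R) : \sum_p w p = w i + w j + w l + w k.
  rewrite (bigD1 i) //= (bigD1 j) 1?eq_sym //= (bigD1 l) /=; last first.
    by rewrite ![l == _]eq_sym il jl.
  rewrite (bigD1 k) /=; last by rewrite ![k == _]eq_sym ik jk lk.
  rewrite big1 ?addr0 ?addrA // => p /andP[/andP[/andP[]]].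
  by have := cover p; rewrite !inE => /or4P[] ->.
(* The weight [s / 2] at [l] is dictated by the gluing: [i -> j -> l -> i] must send the weights
   [0, s/2, s/2] of [i, j, l] at time 0 to those at time 1. *)
pose W v p := if p == k then 1 - s else if p == l then s / 2
  else if p == i then v * (s / 2) else (1 - v) * (s / 2).
have Wk v : W v k = 1 - s by rewrite /W eqxx.
have Wl v : W v l = s / 2 by rewrite /W eqxx (negbTE lk).
have Wi v : W v i = v * (s / 2) by rewrite /W eqxx (negbTE ik) (negbTE il).
have Wj v : W v j = (1 - v) * (s / 2).
  by rewrite /W (negbTE jk) (negbTE jl) [j == i]eq_sym (negbTE ij).
have vs (v : R) : 0 <= v <= 1 -> 0 <= v * (s / 2) <= s / 2.
  move=> /andP[v0 v1]; rewrite mulr_ge0 ?divr_ge0 ?(ltW s0) //=.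
  by rewrite ler_piMl // divr_ge0 // ltW.
have [g hg] : exists g : R -> D, forall v, 0 <= v <= 1 -> tag (g v) = t /\ bary (g v) =1 W v.
  have [x0 _] : exists x0 : D, tag x0 = t /\ bary x0 =1 (fun p => (p == k)%:R).
    apply: point_of => [p|]; first by rewrite ler0n.
    by rewrite (bigD1 k) //= eqxx big1 ?addr0 // => p /negbTE ->.
  suff /choice [g hg] : forall v, exists x : D, 0 <= v <= 1 -> tag x = t /\ bary x =1 W v.
    by exists g.
  move=> v; have [v01|nv] := boolP (0 <= v <= 1); last by exists x0.
  have /andP[vs0 vs1] := vs v v01.
  have [||x hx] := @point_of R n t (W v); [| |by exists x].
    by move=> p; have := cover p; rewrite !inE => /or4P[] /eqP ->; rewrite ?Wi ?Wj ?Wl ?Wk; lra.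
  by rewrite sum4 Wi Wj Wl Wk; lra.
have [k_i k_j k_l] : [/\ (i == k) = false, (j == k) = false & (l == k) = false].
  by split; apply/negbTE.
exists g; split.
- move=> v v01; have [tg cg] := hg v v01; have /andP[vs0 vs1] := vs v v01.
  clear cover vs hg; split=> // p; rewrite cg; have := all_corners u erefl p;
    rewrite !inE => /or4P[] /eqP ->; rewrite ?k_i ?k_j ?k_l ?eqxx ?Wi ?Wj ?Wl ?Wk ?ler_norml;
    rewrite /=; try (apply/andP; split); lra.
- move=> v v' d v01 v'01 vv'; have [tg cg] := hg v v01; have [tg' cg'] := hg v' v'01.
  split; first by rewrite tg tg'.
  have d0 : 0 < d by apply: le_lt_trans vv'.
  have : `|v * (s / 2) - v' * (s / 2)| < d.
    rewrite -mulrBl normrM; apply: le_lt_trans vv'.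
    by rewrite ler_piMr // ger0_norm; lra.
  move=> h p; rewrite cg cg'; have := cover p; rewrite !inE.
  case/or4P => /eqP ->; rewrite ?Wi ?Wj ?Wl ?Wk ?subrr ?normr0 //.
  have -> : (1 - v) * (s / 2) - (1 - v') * (s / 2) = v' * (s / 2) - v * (s / 2) by lra.
  by rewrite distrC.
- by rewrite (hg 0 _).2 ?lexx ?ler01 // Wi mul0r.
- by rewrite !(hg _ _).2 ?lexx ?ler01 // !Wi !Wj !Wl !Wk; split; rewrite ?subrr ?mul0r // ?subr0 ?mul1r.
Qed.

Lemma moebius_corner_not_manifold (t : 'I_n) (i j l k : 'I_4) :
  uniq [:: i; j; l; k] -> glue T (t, i, k) = (t, j, k) ->
  glue T (t, i, j) = (t, j, l) -> glue T (t, i, l) = (t, j, i) ->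
  ~ manifold_triangulation R T.
Proof.
move=> u [nt gi gk] [_ _ gj] [_ _ gl] man.
have cover := all_corners u erefl.
move: (u); rewrite /= !inE !negb_or => /and4P[/and3P[ij il ik] /andP[jl jk] lk _].
(* A 3-cycle is a product of two transpositions, hence even, so this gluing changes sheets. *)
have tw : twist T t i = true.
  rewrite /twist; suff -> : gluing T t i = (tperm i j * tperm i l)%g.
    by rewrite odd_permM !odd_tperm ij il.
  apply/permP => p; rewrite permM.
  have := cover p; rewrite !inE => /or4P[] /eqP ->; rewrite ?gi ?gj ?gl ?gk.
  - by rewrite tpermL tpermD // eq_sym.
  - by rewrite tpermR tpermL.
  - by rewrite [tperm i j l]tpermD // tpermR.
  - by rewrite [tperm i j k]tpermD // tpermD.
have [x0 [tx0 cx0]] : exists x0 : D, tag x0 = t /\ bary x0 =1 (fun p => (p == k)%:R).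
  apply: point_of => [p|]; first by rewrite ler0n.
  by rewrite (bigD1 k) //= eqxx big1 ?addr0 // => p /negbTE ->.
have x0k : bary x0 k = 1 by rewrite cx0 eqxx.
have [DU [F [Dx0 DU_same F_inj F_cont F_open]]] := local_chart x0 man.
pose q := F x0.
have [r0 r00 hr0] : exists2 r0, 0 < r0 & forall z, `|q - z| < r0 -> exists y, [/\ DU y,
    F y <> q -> exists2 m, 1 / 2 < bary y m & bary y m != 1 & F y = z].
  exact: (vertex_neighbourhood_coordinates DU_same F_open x0k Dx0).
pose r := r0 / 2.
have rpos : 0 < r by rewrite divr_gt0.
have inball (z : 'rV[R]_3) : (forall p, `|z ord0 p - q ord0 p| <= r) -> `|q - z| < r0.
  move=> h; apply/row_norm_ltP => // p; rewrite !mxE distrC.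
  by apply: le_lt_trans (h p) _; rewrite ltr_pdivrMr // ltr_pMr // ltr1n.
have [e e0 he] := F_cont x0 Dx0 r rpos.
have [s [s0 s1 se]] : exists s, [/\ 0 < s, s <= 1 / 2 & s < e].
  exists (Num.min (1 / 2) (e / 2)); rewrite lt_min !divr_gt0 // ge_min lexx; split=> //.
  by rewrite gt_min; apply/orP; right; rewrite ltr_pdivrMr // ltr_pMr // ltr1n.
have [g [gP gcont g0i [g1j g1l g1i g1k]]] := corner_path t u s0 s1.
have gDF v : 0 <= v <= 1 -> DU (g v) /\ `|q - F (g v)| < r.
  move=> /gP [tg cg _]; apply: he; split; first by rewrite tg tx0.
  by move=> p; rewrite cx0; apply: le_lt_trans (cg p) se.
have gq v : 0 <= v <= 1 -> F (g v) <> q.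
  move=> v01 /esym /(F_inj _ _ Dx0 (gDF v v01).1).
  rewrite same_point_sym => /same_point_bary /(_ k) [p]; rewrite x0k => e1.
  by have [_ _ /(_ p)] := gP v v01; rewrite -e1 ltxx.
have [d0 d00 hd0] : exists2 d, 0 < d & forall v, 0 <= v <= 1 -> d <= `|q - F (g v)|.
  have gD v : 0 <= v <= 1 -> DU (g v) by move/gDF => [].
  exact: (path_avoids gcont F_cont gD gq).
(* At most [d0] keeps the path in the shell; at most [r] is required by [shell_orientable]. *)
pose d := Num.min d0 r.
have dpos : 0 < d by rewrite lt_min d00.
have [|||f hf] := @shell_orientable R n T DU F DU_same F_inj F_cont F_open q d r.
- by rewrite dpos ge_min lexx orbT.
- by move=> z /inball /hr0 [y [Dy _ <-]]; exists y.
- move=> z /inball /hr0 [y [Dy ym <-]] /ym [m y1 y2].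
  apply: coloured_locally_orientable => //; exact: near_vertex_coloured y1 y2.
have gover v : 0 <= v <= 1 -> lies_over DU F [set z : 'rV[R]_3 |
    (forall i, `|z ord0 i - q ord0 i| <= r) /\ d <= `|q - z|]%classic (g v).
  move=> v01; have [Dg rg] := gDF v v01; split=> //; split; last by rewrite ge_min hd0.
  by move=> p; rewrite distrC; apply/ltW; exact: row_coord_dist.
have fconst := path_constant gcont hf gover.
have i0 : 0 <= (0 : R) <= 1 by rewrite lexx ler01.
have i1 : 0 <= (1 : R) <= 1 by rewrite lexx ler01.
have [t0 _ _] := gP 0 i0; have [t1 _ _] := gP 1 i1.
(* The section is constant along the path, yet the ends of the path are glued with a twist. *)
have /(hf.1 _ _ _ (gover 0 i0)) : glued_at T i (g 0) (g 1).
  split; rewrite ?t0 ?t1 ?nt //.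
  move=> p; have := cover p; rewrite !inE.
  by case/or4P => /eqP ->; rewrite ?gi ?gj ?gl ?gk.
by rewrite fconst t0 tw; case: (f _).
Qed.

End MoebiusCorner.

End Topology.

Lemma manifold_no_moebius_corner (R : realType) S G n (T : triangulation n) (c : chart n) :
  manifold_triangulation R T -> charts S c -> realizes G c T -> moebius_corner S G = false.
Proof.
move=> man cS cG; apply/negP => /(moebius_cornerP cS cG) [t [i [j [l [k [u g1 g2 g3]]]]]].
exact: (moebius_corner_not_manifold u g1 g2 g3 man).
Qed.

Theorem theorem4p5 (R : realType) (n n' : nat)
    (T : triangulation n) (T' : triangulation n')
    (manT : manifold_triangulation R T)
    (manT' : manifold_triangulation R T')
    (T'_from_T : exists (m : nat) (T1 : triangulation m),
       move23 T T1 /\ move32 T1 T') :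
  [\/ isomorphic T T',
      exists (m : nat) (T2 : triangulation m), move32 T T2 /\ move23 T2 T'
    | [\/ octahedron_flip T T', pillow_flip T T' | prism_flip T T']].
Proof.
have [m [T1 [mv23 mv32]]] := T'_from_T.
have [c [c1 [h1 [h1' [s1 st1]]]]] := @replaces_step bipyramid2 bipyramid3 isT isT _ _ _ _ mv23.
have [c2 [c' [h2 [h2' [s2 st2]]]]] := @replaces_step bipyramid3 bipyramid2 isT isT _ _ _ _ mv32.
have cS1 : charts (iota 0 3) c1 := step_tgt st1.
have cS2 : charts (iota 0 3) c2 := step_src st2.
have cpt := compatible_read cS1 cS2.
have st := step_compose template23_wf template32_wf st1 st2 cpt.
have := resolved_read cS1 cS2 (step_tgt_glue st1) (step_src_glue st2).
rewrite /resolved; case: ifP => // wL.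
(* Source gluings of the composite hold in [T] and target gluings in [T'], so both Moebius tests in
   [resolved] return false. *)
rewrite (manifold_no_moebius_corner manT (step_src st) (step_src_glue st)).
rewrite (manifold_no_moebius_corner manT' (step_tgt st) (step_tgt_glue st)).
have rec P Q : well_formed P -> well_formed Q ->
    recognizes (compose (mkseq (entry c1 c2) 3) template23 template32) (replacement P Q) ->
    replaces P Q T T' by move=> wP wQ; exact: recognizes_replaces wP wQ wL st.
(* A count above three falls into the default branch of [resolved], like zero. *)
case E: (count _ _) => [|[|[|[|k]]]].
- by move=> /(recognizes_isomorphic wL st) iso; apply: Or31.
- case: ifP => [/(rec pillow_before pillow_after isT isT) pil _|_]; first by apply: Or33; apply: Or32.
  case: ifP => [/(rec prismA_before prismA_after isT isT) prA _|_ /(rec prismB_before prismB_after isT isT) prB].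
    by apply/Or33/Or33; left.
  by apply/Or33/Or33; right.
- by move=> /(rec octahedron_x octahedron_y isT isT) oct; apply/Or33/Or31; left.
- move=> _; apply: Or32.
  have none : mkseq (entry c1 c2) 3 = disjoint_configuration := count_None3 E.
  by move: st; rewrite none; exact: disjoint_moves_commute.
- by move=> /(recognizes_isomorphic wL st) iso; apply: Or31.
Qed.
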